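(* Let $F=\alpha^2/\beta$ be a Kropina metric on a manifold $M$ which is an Einstein metric or, more generally, a weak Einstein metric. Then any conformal vector field $V$ of $F$ is homothetic. Further, $V$ can be locally determined if $F$ is of constant flag curvature.
   Context: Manifolds are assumed connected. Here $\alpha=\sqrt{a_{ij}(x)y^iy^j}$ is a positive definite Riemannian metric and $\beta=b_i(x)y^i$ is a nowhere vanishing 1-form on the $n$-dimensional manifold $M$; $F=\alpha^2/\beta$ is a singular Finsler metric, considered on the open conic part of $TM\setminus 0$ where $\beta>0$. A Finsler metric $F$ with Riemann curvature $R^i{}_k(x,y)$ and Ricci curvature $\mathrm{Ric}=R^i{}_i$ is a weak Einstein metric if $\mathrm{Ric}=(n-1)\left(\frac{3\theta}{F}+\sigma\right)F^2$ for some 1-form $\theta=\theta_i(x)y^i$ and some scalar function $\sigma=\sigma(x)$ on $M$; it is an Einstein metric if this holds with $\theta=0$. $F$ is of constant flag curvature $K$ if $R^i{}_k=K\,(F^2\delta^i_k-FF_{y^k}y^i)$ with $K$ a constant. Conformal and homothetic vector fields: for $V=V^i\partial/\partial x^i$ let $V^c:=V^i\frac{\partial}{\partial x^i}+y^i\frac{\partial V^j}{\partial x^i}\frac{\partial}{\partial y^j}$ be its complete lift to $TM$ (the superscript $c$ is only notation). $V$ is a conformal vector field of $F$ with conformal factor $c=c(x)$ if $V^c(F)=2cF$ (equivalently, the lifted flow $\widetilde\varphi_t$ of $V$ satisfies $\widetilde\varphi_t^*F=e^{2\sigma_t}F$ with $\sigma_t$ functions on $M$, $c=\frac{d}{dt}|_{t=0}\sigma_t$).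 $V$ is homothetic if it is conformal with constant conformal factor $c$. Meaning of ''locally determined'': after normalizing $\alpha,\beta$ (without changing $F$) so that $\|\beta\|_\alpha=1$, in the constant flag curvature case $\alpha$ has constant sectional curvature and $\beta$ is a Killing form of $\alpha$, and the local structure of $V$ can be obtained by solving the equations $V^c(\alpha^2)=4c\alpha^2$, $V^c(\beta)=2c\beta$. The theorem gives no explicit formula for $V$. *)

(* Defs.v *)
From HB Require Import structures.
From mathcomp Require Import all_boot all_order all_algebra.
From mathcomp Require Import all_classical all_reals all_analysis.

Set Implicit Arguments.
Unset Strict Implicit.
Unset Printing Implicit Defensive.

Import Order.TTheory GRing.Theory Num.Theory numFieldNormedType.Exports.

Local Open Scope classical_set_scope.
Local Open Scope ring_scope.

(* Tangent vectors and covectors are row vectors;                             *)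
(* the Jacobian ('J) of the library acts on row vectors from the right, so    *)
(* its (k, l) entry is the k-th partial derivative of the l-th component.     *)

Section Coordinates.
Context {R : realType} {n : nat}.
Implicit Types (A : set 'rV[R]_n) (x y u v : 'rV[R]_n).

Definition partial (k : 'I_n) (f : 'rV[R]_n -> R) (x : 'rV[R]_n) : R :=
  'D_(delta_mx 0 k) f x.

(* Intended for open sets A. *)
Fixpoint Cr (r : nat) A (f : 'rV[R]_n -> R) : Prop :=
  (forall x, A x -> {for x, continuous f}) /\
  match r with
  | 0 => True
  | r'.+1 => forall k : 'I_n,
      (forall x, A x -> derivable f x (delta_mx 0 k)) /\ Cr r' A (partial k f)
  end.

Definition smooth A (f : 'rV[R]_n -> R) : Prop := forall r, Cr r A f.

Definition pairing (b y : 'rV[R]_n) : R := \sum_k b 0 k * y 0 k.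

Definition bil (a : 'M[R]_n) (u v : 'rV[R]_n) : R :=
  \sum_k \sum_l a k l * u 0 k * v 0 l.

(* Finsler geometry of a local expression L x y. *)

Implicit Types L : 'rV[R]_n -> 'rV[R]_n -> R.

Definition dx (k : 'I_n) L x y : R := partial k (fun z => L z y) x.
Definition dy (k : 'I_n) L x y : R := partial k (L x) y.

Definition sq L x y : R := L x y ^+ 2.

(* g_kl = [F^2]_{y^k y^l} / 2 *)
Definition fundamental_tensor L x y : 'M[R]_n :=
  \matrix_(k, l) (2^-1 * dy k (dy l (sq L)) x y).

(* G^i = g^il ([F^2]_{x^m y^l} y^m - [F^2]_{x^l}) / 4 *)
Definition spray L (i : 'I_n) x y : R :=
  4^-1 * \sum_l invmx (fundamental_tensor L x y) i l *
    (\sum_m dx m (dy l (sq L)) x y * y 0 m - dx l (sq L) x y).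

(* R^i_k = 2 G^i_{x^k} - y^j G^i_{x^j y^k} + 2 G^j G^i_{y^j y^k}
           - G^i_{y^j} G^j_{y^k} *)
Definition riemann_curvature L (i k : 'I_n) x y : R :=
  2 * dx k (spray L i) x y
  - \sum_j y 0 j * dx j (dy k (spray L i)) x y
  + 2 * (\sum_j spray L j x y * dy j (dy k (spray L i)) x y)
  - \sum_j dy j (spray L i) x y * dy k (spray L j) x y.

Definition ricci L x y : R := \sum_k riemann_curvature L k k x y.

(* V^c L = V^k L_{x^k} + y^k V^l_{x^k} L_{y^l} *)
Definition complete_lift (V : 'rV[R]_n -> 'rV[R]_n) L x y : R :=
  \sum_k V x 0 k * dx k L x y
  + \sum_k \sum_l y 0 k * partial k (fun z => V z 0 l) x * dy l L x y.

(* Riemannian geometry of a local metric A x. *)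

Implicit Types a : 'rV[R]_n -> 'M[R]_n.

(* Gamma^k_lm *)
Definition christoffel a (k l m : 'I_n) x : R :=
  2^-1 * \sum_s invmx (a x) k s *
    (partial l (fun z => a z s m) x + partial m (fun z => a z s l) x
     - partial s (fun z => a z l m) x).

(* b_{k|l} *)
Definition cov_deriv a (b : 'rV[R]_n -> 'rV[R]_n) (k l : 'I_n) x : R :=
  partial l (fun z => b z 0 k) x - \sum_m christoffel a m k l x * b x 0 m.

(* The i-th component of R(d_k, d_l) d_j, where
   R(X, Y) = [nabla_X, nabla_Y] - nabla_[X, Y]. *)
Definition riemann_tensor a (i j k l : 'I_n) x : R :=
  partial k (christoffel a i l j) x - partial l (christoffel a i k j) x
  + \sum_m (christoffel a i k m x * christoffel a m l j x
            - christoffel a i l m x * christoffel a m k j x).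

(* <R(u, v) v, u> / (|u|^2 |v|^2 - <u, v>^2) *)
Definition sectional_curvature a x u v : R :=
  (\sum_i \sum_j \sum_k \sum_l \sum_m
     a x i m * riemann_tensor a i j k l x * u 0 k * v 0 l * v 0 j * u 0 m)
  / (bil (a x) u u * bil (a x) v v - bil (a x) u v ^+ 2).

End Coordinates.

(* A smooth manifold given by an atlas, which need not be maximal: every      *)
(* notion below is invariant under smooth changes of coordinates. The map     *)
(* param i is the inverse of the chart coord i; the values of coord i outside *)
(* dom i, and of param i outside the image of dom i, are irrelevant.          *)
Record manifold (R : realType) (n : nat) := Manifold {
  carrier :> topologicalType;
  chart : Type;
  dom : chart -> set carrier;
  coord : chart -> carrier -> 'rV[R]_n;
  param : chart -> 'rV[R]_n -> carrier;
  manifold_hausdorff : hausdorff_space carrier;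
  manifold_second_countable : @second_countable carrier;
  dom_cover : forall p, exists i, dom i p;
  dom_open : forall i, open (dom i);
  coord_open : forall i, open (coord i @` dom i);
  coordK : forall i p, dom i p -> param i (coord i p) = p;
  coord_continuous : forall i p, dom i p -> {for p, continuous (coord i)};
  param_continuous :
    forall i p, dom i p -> {for coord i p, continuous (param i)};
  transition_smooth : forall i j k,
    smooth (coord i @` (dom i `&` dom j)) (fun x => coord j (param i x) 0 k)
}.

Section Fields.
Context {R : realType} {n : nat} {M : manifold R n}.
Implicit Types (U : set M) (i j : chart M) (p : M).

Definition jac i j p : 'M[R]_n :=
  jacobian (fun x => coord j (@param _ _ M i x)) (coord i p).

(* A tensor field is the family of its components in the charts, subject to   *)
(* the classical transformation law.                                          *)
Definition vfield := chart M -> M -> 'rV[R]_n.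
Definition covfield := chart M -> M -> 'rV[R]_n.
Definition bilfield := chart M -> M -> 'M[R]_n.

Definition smooth_on U i (f : M -> R) : Prop :=
  smooth (coord i @` (dom i `&` U)) (fun x => f (param i x)).

Definition smooth_scalar U (f : M -> R) : Prop := forall i, smooth_on U i f.

Definition is_vector_field U (V : vfield) : Prop :=
  (forall i j p, U p -> dom i p -> dom j p -> V j p = V i p *m jac i j p) /\
  (forall i k, smooth_on U i (fun p => V i p 0 k)).

Definition is_one_form (b : covfield) : Prop :=
  (forall i j p, dom i p -> dom j p -> b i p = b j p *m (jac i j p)^T) /\
  (forall i k, smooth_on setT i (fun p => b i p 0 k)).

Definition is_riemannian_metric (a : bilfield) : Prop :=
  [/\ forall i j p, dom i p -> dom j p ->
        a i p = jac i j p *m a j p *m (jac i j p)^T,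
      forall i k l, smooth_on setT i (fun p => a i p k l),
      forall i p, dom i p -> (a i p)^T = a i p &
      forall i p y, dom i p -> y != 0 -> 0 < bil (a i p) y y].

Definition nowhere_vanishing (b : covfield) : Prop :=
  forall i p, dom i p -> b i p != 0.

Definition unit_length (a : bilfield) (b : covfield) : Prop :=
  forall i p, dom i p -> bil (invmx (a i p)) (b i p) (b i p) = 1.

Definition is_killing_form (a : bilfield) (b : covfield) : Prop :=
  forall i p k l, dom i p ->
    cov_deriv (a i \o param i) (b i \o param i) k l (coord i p)
    + cov_deriv (a i \o param i) (b i \o param i) l k (coord i p) = 0.

Definition has_constant_sectional_curvature (a : bilfield) (mu : R) : Prop :=
  forall i p u v, dom i p -> row_free (col_mx u v) ->
    sectional_curvature (a i \o param i) (coord i p) u v = mu.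

(* A function on an open conic part of TM, in the induced coordinates (x, y). *)
Record conic_fun := ConicFun {
  cval :> chart M -> 'rV[R]_n -> 'rV[R]_n -> R;
  cone : chart M -> M -> set 'rV[R]_n
}.

Definition eq_conic (F F' : conic_fun) : Prop :=
  forall i p, dom i p -> cone F i p = cone F' i p /\
    forall y, cone F i p y -> F i (coord i p) y = F' i (coord i p) y.

Definition alpha2 (a : bilfield) : conic_fun :=
  ConicFun (fun i x y => bil (a i (param i x)) y y) (fun _ _ => setT).

Definition beta (b : covfield) : conic_fun :=
  ConicFun (fun i x y => pairing (b i (param i x)) y) (fun _ _ => setT).

Definition kropina (a : bilfield) (b : covfield) : conic_fun :=
  ConicFun (fun i x y => alpha2 a i x y / beta b i x y)
           (fun i p => [set y | 0 < pairing (b i p) y]).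

Definition einstein_eq (F : conic_fun) (theta : covfield) (sigma : M -> R) :=
  forall i p y, dom i p -> cone F i p y ->
    ricci (F i) (coord i p) y =
    (n.-1)%:R * (3 * pairing (theta i p) y / F i (coord i p) y + sigma p)
    * F i (coord i p) y ^+ 2.

Definition weak_einstein (F : conic_fun) : Prop :=
  exists theta sigma,
    [/\ is_one_form theta, smooth_scalar setT sigma & einstein_eq F theta sigma].

Definition einstein (F : conic_fun) : Prop :=
  exists2 sigma, smooth_scalar setT sigma & einstein_eq F (fun _ _ => 0) sigma.

Definition constant_flag_curvature (F : conic_fun) (K : R) : Prop :=
  forall i p y (k l : 'I_n), dom i p -> cone F i p y ->
    riemann_curvature (F i) k l (coord i p) y =
    K * (F i (coord i p) y ^+ 2 * (k == l)%:R
         - F i (coord i p) y * dy l (F i) (coord i p) y * y 0 k).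

(* V^c(F) = f F over U *)
Definition lift_scales U (V : vfield) (F : conic_fun) (f : M -> R) : Prop :=
  forall i p y, U p -> dom i p -> cone F i p y ->
    complete_lift (V i \o param i) (F i) (coord i p) y = f p * F i (coord i p) y.

Definition conformal_with U (F : conic_fun) (V : vfield) (c : M -> R) : Prop :=
  [/\ is_vector_field U V, smooth_scalar U c &
      lift_scales U V F (fun p => 2 * c p)].

Definition conformal (F : conic_fun) (V : vfield) : Prop :=
  exists c, conformal_with setT F V c.

Definition homothetic (F : conic_fun) (V : vfield) : Prop :=
  exists k : R, conformal_with setT F V (fun=> k).

End Fields.

Arguments vfield {R n} M.
Arguments covfield {R n} M.
Arguments bilfield {R n} M.
Arguments conic_fun {R n} M.

(* Main.v *)
From HB Require Import structures.
Require Import Defs.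
From mathcomp Require Import all_boot all_order all_algebra.
From mathcomp Require Import all_classical all_reals all_analysis.
From mathcomp Require Import ring lra.

(** Multiplying alpha^2 and beta by the same positive function of x does not
   change F = alpha^2/beta; replacing a by a/|b|^2 and b by b/|b|^2 makes
   |b| = 1. From there on (a, b) is such a unit pair, W is the field dual
   to b (so that beta(W) = |W| = 1), f = F/2, and S denotes the geodesic
   spray of alpha.

   All the differential geometry is done by algebra. The functions of (x,
   y) obtained from smooth functions of x and the coordinates y^k by ring
   operations and by inverting nowhere vanishing functions form a
   commutative ring with commuting derivations d/dx^k and d/dy^k
   ([phase_ring], realized by [phaseR]); commutation is the theorem of
   Schwarz [partialC]. Every identity below is proved in such a ring and
   then evaluated at points.

   The spray of F. Let r = S(beta), c_k = S(b_k) - d beta/dx^k and lambda =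
   r + f c(W). The semispray H = S - (lambda W^k - f c^k) d/dy^k satisfies
   H(beta) = 0, H(alpha^2) = - 2 lambda beta and H(F_{y^k}) = F_{x^k}. The
   last equation is Rapcsak's criterion: H has the geodesics of F, up to
   parametrization, and the projective factor P = - lambda beta/alpha^2
   makes the length constant ([S_kr_kropF], [euler_lagrange]). Since the
   Hessian of F^2/2 is positive definite ([hessian_form],
   [fundamental_unit]), H - 2 P y^k d/dy^k is the spray of F ([ev_spray]).

   Weak Einstein metrics. A projective change alters the Ricci curvature by
   (n - 1)(P^2 - H(P)) ([ricci_projective]). Hence Ric is, with U = -
   lambda beta, the sum of (n - 1)(3 U^2/alpha^4 - H(U)/alpha^2) and of
   terms whose only denominators are powers of beta ([ricci_pole],
   [polar_ricci_reg]). On a line y = W + t u with u orthogonal to W one has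
   beta = 1 and alpha^2 = 1 + |u|^2 t^2, and everything else is a
   polynomial in t. The weak Einstein equation forces 1 + |u|^2 t^2 to
   divide the square of U, hence of r; but r is of the form B t + C t^2, so
   it vanishes ([square_multiple], [weak_einstein_line]). Thus r = 0, and b
   is a Killing form ([weak_einstein_killing]).

   Constant flag curvature. For a Killing form b, lambda = P = 0. The flow
   of W preserves S ([killing_affine]), which with the Ricci identity and
   the Bianchi identity expresses the second covariant derivative of W
   through the curvature tensor ([DDWE]). It follows that the Riemann
   curvature of F at y is u |-> R_z (u - df(u) W), where R_z is the Jacobi
   operator of alpha at z = y - f W ([jacobi_Rz]). If F has constant flag
   curvature K, R_z is that of constant sectional curvature 4 K
   ([constant_curvature]), the factor 4 coming from f = F/2; as z takes all
   nonzero values with beta(z) >= 0 when y runs through the cone, and R_z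
   is even in z, alpha has constant curvature 4 K ([flag_sectional]).

   Conformal fields. The equation V^c(F) = 2 c F reads V^c(alpha^2) beta =
   alpha^2 (V^c(beta) + 2 c beta). As alpha^2 and beta are coprime
   polynomials in y, V^c(alpha^2) = mu alpha^2 and V^c(beta) = (mu - 2 c)
   beta ([quadratic_division]), and the normalization |b| = 1 gives mu = 4
   c ([lie_unit]). Consequently [V, W] = - 2 c W ([bracket_W]), and the
   bracket of the lifts of V and W applied to alpha^2, which is killed by
   W^c, gives W(c) alpha^2 = dc(y) beta ([conformal_gradient]). Where beta
   vanishes this yields W(c) = 0, and then dc = 0. So c is locally
   constant, and constant on connected open sets ([locally_cst_cst]). *)

Set Implicit Arguments.
Unset Strict Implicit.
Unset Printing Implicit Defensive.

Import Order.TTheory GRing.Theory Num.Theory numFieldNormedType.Exports.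

Local Open Scope classical_set_scope.
Local Open Scope ring_scope.

(** * Derivations and phase rings *)

Record derivation (A : comPzRingType) := Derivation {
  der_fun :> A -> A;
  derD : forall f g, der_fun (f + g) = der_fun f + der_fun g;
  derM : forall f g, der_fun (f * g) = der_fun f * g + f * der_fun g
}.

Section DerivationTheory.
Context {A : comPzRingType} (D : derivation A).

Lemma der0 : D 0 = 0.
Proof. by apply: (addrI (D 0)); rewrite -derD !addr0. Qed.

Lemma derN f : D (- f) = - D f.
Proof. by apply: (addrI (D f)); rewrite -derD !subrr der0. Qed.

Lemma derB f g : D (f - g) = D f - D g.
Proof. by rewrite derD derN. Qed.

Lemma der_sum (I : finType) (F : I -> A) : D (\sum_i F i) = \sum_i D (F i).
Proof. by apply: (big_morph D (derD D) der0). Qed.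

Lemma der1 : D 1 = 0.
Proof.
by apply: (addrI (D 1)); rewrite addr0 -[in RHS](mulr1 1) derM mul1r mulr1.
Qed.

Lemma der_nat m : D m%:R = 0.
Proof. by elim: m => [|m IH]; rewrite ?der0 // -addn1 natrD derD IH der1 addr0. Qed.

End DerivationTheory.

(** The model is a ring of functions on an open part of the tangent bundle:
    [dX k] and [dY k] are the partial derivatives in the position and in the
    direction, and [yc k] is the k-th component of the direction. The ring may
    have zero divisors, since the underlying domain need not be connected;
    inverses are therefore always given by explicit elements. *)
Record phase_ring (n : nat) := PhaseRing {
  phase :> comPzRingType;
  dX : 'I_n -> derivation phase;
  dY : 'I_n -> derivation phase;
  dXX : forall k l f, dX k (dX l f) = dX l (dX k f);
  dXY : forall k l f, dX k (dY l f) = dY l (dX k f);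
  dYY : forall k l f, dY k (dY l f) = dY l (dY k f);
  yc : 'I_n -> phase;
  dX_yc : forall k l, dX k (yc l) = 0;
  dY_yc : forall k l, dY k (yc l) = (k == l)%:R;
  onehalf : phase;
  onehalfK : 2 * onehalf = 1
}.

(** Closes an equality of linear combinations of sums, once all of them run
    over the same index. *)
Ltac sumring := rewrite ?(mulr_sumr, mulr_suml) -?sumrN -?big_split /=;
  apply: eq_bigr => ? _; ring.

Section PhaseTheory.
Context {n : nat} {A : phase_ring n}.
Implicit Types (f g : A) (xi eta : 'I_n -> A) (D : derivation A).
Notation y := (@yc n A).

Lemma der_onehalf D : D (onehalf A) = 0.
Proof.
have e : 2 * D (onehalf A) = 0.
  by have := congr1 D (onehalfK A); rewrite derM der_nat mul0r add0r der1.
by rewrite -[LHS]mul1r -(onehalfK A) mulrAC e mul0r.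
Qed.

Lemma double_inj f g : 2 * f = 2 * g -> f = g.
Proof.
move=> e; rewrite -[f]mul1r -[g]mul1r -(onehalfK A) -!mulrA.
by rewrite [_ * f]mulrC [_ * g]mulrC !mulrA e.
Qed.

Lemma onehalf_double f : onehalf A * (2 * f) = f.
Proof. by rewrite mulrCA mulrA onehalfK mul1r. Qed.

Definition act_fun xi eta f := \sum_k (xi k * dX A k f + eta k * dY A k f).

Lemma act_funD xi eta f g :
  act_fun xi eta (f + g) = act_fun xi eta f + act_fun xi eta g.
Proof.
rewrite /act_fun -big_split /=; apply: eq_bigr => k _; rewrite !derD; ring.
Qed.

Lemma act_funM xi eta f g :
  act_fun xi eta (f * g) = act_fun xi eta f * g + f * act_fun xi eta g.
Proof.
rewrite /act_fun mulr_suml mulr_sumr -big_split /=; apply: eq_bigr => k _.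
rewrite !derM; ring.
Qed.

(** The vector field with components xi in position and eta in direction. It
    is locked because unification would otherwise unfold it into its
    coordinate expression. *)
Definition act xi eta :=
  locked (Derivation (act_funD xi eta) (act_funM xi eta)).

Lemma act_sum xi eta f :
  act xi eta f = \sum_k (xi k * dX A k f + eta k * dY A k f).
Proof. by rewrite /act -lock. Qed.

Lemma actE xi eta f :
  act xi eta f = \sum_k xi k * dX A k f + \sum_k eta k * dY A k f.
Proof. by rewrite act_sum big_split. Qed.

Lemma sum_deltal (F : 'I_n -> A) k : \sum_l (k == l)%:R * F l = F k.
Proof.
rewrite (bigD1 k) //= eqxx mul1r big1 ?addr0 // => l lk.
by rewrite eq_sym (negbTE lk) mul0r.
Qed.

Lemma sum_deltar (F : 'I_n -> A) k : \sum_l F l * (l == k)%:R = F k.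
Proof.
by rewrite -[RHS](sum_deltal F); apply: eq_bigr => l _; rewrite mulrC eq_sym.
Qed.

Lemma act_y xi eta k : act xi eta (y k) = eta k.
Proof.
rewrite actE big1 ?add0r => [|l _]; last by rewrite dX_yc mulr0.
by rewrite -[RHS](sum_deltar eta); apply: eq_bigr => l _; rewrite dY_yc.
Qed.

(** The second order terms cancel because the coordinate derivations
    commute. *)
Lemma act_bracket xi eta xi' eta' f :
  act xi eta (act xi' eta' f) - act xi' eta' (act xi eta f) =
  act (fun k => act xi eta (xi' k) - act xi' eta' (xi k))
      (fun k => act xi eta (eta' k) - act xi' eta' (eta k)) f.
Proof.
set U := act xi eta; set V := act xi' eta'.
have UE g : U g = \sum_k (xi k * dX A k g + eta k * dY A k g).
  exact: act_sum.
have VE g : V g = \sum_k (xi' k * dX A k g + eta' k * dY A k g).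
  exact: act_sum.
have sym : \sum_k (xi' k * U (dX A k f) + eta' k * U (dY A k f)) =
           \sum_k (xi k * V (dX A k f) + eta k * V (dY A k f)).
  under eq_bigr do rewrite !UE !mulr_sumr -big_split /=.
  under [RHS]eq_bigr do rewrite !VE !mulr_sumr -big_split /=.
  rewrite exchange_big; apply: eq_bigr => k _; apply: eq_bigr => l _ /=.
  rewrite (dXX k l) (dXY k l) -(dXY l k) (dYY k l); ring.
have UV : U (V f) = \sum_k (xi' k * U (dX A k f) + eta' k * U (dY A k f))
    + \sum_k (U (xi' k) * dX A k f + U (eta' k) * dY A k f).
  rewrite VE der_sum -big_split /=; apply: eq_bigr => k _.
  by rewrite derD !derM; ring.
have VU : V (U f) = \sum_k (xi k * V (dX A k f) + eta k * V (dY A k f))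
    + \sum_k (V (xi k) * dX A k f + V (eta k) * dY A k f).
  rewrite UE der_sum -big_split /=; apply: eq_bigr => k _.
  by rewrite derD !derM; ring.
rewrite UV VU sym opprD addrACA subrr add0r -sumrB act_sum.
by apply: eq_bigr => k _; ring.
Qed.

End PhaseTheory.

Section Geo.
Context {n : nat} {A : phase_ring n}.
Implicit Types (f g : A) (T B : 'I_n -> A).
Notation y := (@yc n A).

(** These elements are the functions of the position alone. *)
Definition basic (c : A) := forall m, dY A m c = 0.

Lemma basicD f g : basic f -> basic g -> basic (f + g).
Proof. by move=> hf hg m; rewrite derD hf hg addr0. Qed.
Lemma basicN f : basic f -> basic (- f).
Proof. by move=> hf m; rewrite derN hf oppr0. Qed.
Lemma basicM f g : basic f -> basic g -> basic (f * g).
Proof. by move=> hf hg m; rewrite derM hf hg mul0r mulr0 addr0. Qed.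
Lemma basic_sum (F : 'I_n -> A) : (forall i, basic (F i)) -> basic (\sum_i F i).
Proof. by move=> hF m; rewrite der_sum big1 // => i _; apply: hF. Qed.
Lemma basic_dX k f : basic f -> basic (dX A k f).
Proof. by move=> hf m; rewrite -dXY hf der0. Qed.
Lemma basic_onehalf : basic (onehalf A).
Proof. by move=> m; apply: der_onehalf. Qed.

Lemma dY_linear (c : 'I_n -> A) k : (forall l, basic (c l)) ->
  dY A k (\sum_l c l * y l) = c k.
Proof.
move=> hc; rewrite der_sum -[RHS](sum_deltar c); apply: eq_bigr => l _.
by rewrite derM hc mul0r add0r dY_yc eq_sym.
Qed.

(** The coefficients T are normalized so that geodesics solve x'' + T(x, x') =
    0; they are twice the usual spray coefficients. *)
Definition spray_der T := act y (fun k => - T k).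

Lemma spray_derE T g : spray_der T g = \sum_k y k * dX A k g - \sum_k T k * dY A k g.
Proof. by rewrite actE -sumrN; congr (_ + _); apply: eq_bigr => k _; rewrite mulNr. Qed.

Lemma spray_der_y T k : spray_der T (y k) = - T k.
Proof. exact: act_y. Qed.

Lemma spray_der_shift T B g :
  spray_der (fun k => T k + B k) g = spray_der T g - \sum_k B k * dY A k g.
Proof.
rewrite !spray_derE -addrA -opprD; congr (_ - _).
by rewrite -big_split; apply: eq_bigr => k _; rewrite /= mulrDl.
Qed.

Lemma spray_der_basic T c : basic c -> spray_der T c = \sum_k y k * dX A k c.
Proof. by move=> hc; rewrite spray_derE [X in _ - X]big1 ?subr0 // => k _; rewrite hc mulr0. Qed.

End Geo.
Arguments basic {n A} c.

(** * The Levi-Civita spray of a metric *)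

(** The inverse matrix is part of the data because the phase ring has no
    division. *)
Record unit_form n (A : phase_ring n) := UnitForm {
  metric : 'I_n -> 'I_n -> A;
  cometric : 'I_n -> 'I_n -> A;
  form : 'I_n -> A;
  metric_basic : forall k l, basic (metric k l);
  cometric_basic : forall k l, basic (cometric k l);
  form_basic : forall k, basic (form k);
  metric_sym : forall k l, metric k l = metric l k;
  cometric_sym : forall k l, cometric k l = cometric l k;
  metricK : forall k l, \sum_m metric k m * cometric m l = (k == l)%:R;
  cometricK : forall k l, \sum_m cometric k m * metric m l = (k == l)%:R;
  form_unit : \sum_k \sum_l cometric k l * form k * form l = 1
}.

Section Metric.
Context {n : nat} {A : phase_ring n} (U : unit_form A).
Implicit Types (u v w : 'I_n -> A).
Notation y := (@yc n A).
Notation X := (dX A).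
Notation Y := (dY A).
Notation g := (metric U).
Notation gi := (cometric U).
Notation b := (form U).

Definition flat v k := \sum_l g k l * v l.
Definition sharp w k := \sum_l gi k l * w l.

Lemma flatK v k : sharp (flat v) k = v k.
Proof.
rewrite /sharp /flat; under eq_bigr do rewrite mulr_sumr.
rewrite exchange_big /= -[RHS](sum_deltal v); apply: eq_bigr => l _.
by rewrite -(cometricK U) mulr_suml; apply: eq_bigr => m _; rewrite mulrA.
Qed.

Lemma sharpK w k : flat (sharp w) k = w k.
Proof.
rewrite /sharp /flat; under eq_bigr do rewrite mulr_sumr.
rewrite exchange_big /= -[RHS](sum_deltal w); apply: eq_bigr => l _.
by rewrite -(metricK U) mulr_suml; apply: eq_bigr => m _; rewrite mulrA.
Qed.

Lemma flat_inj u v : (forall k, flat u k = flat v k) -> forall k, u k = v k.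
Proof.
by move=> e k; rewrite -(flatK u) -(flatK v); apply: eq_bigr => l _; rewrite e.
Qed.

Lemma flat_sym u v : \sum_k u k * flat v k = \sum_k v k * flat u k.
Proof.
rewrite /flat; under eq_bigr do rewrite mulr_sumr.
rewrite exchange_big; apply: eq_bigr => k _ /=; rewrite mulr_sumr.
by apply: eq_bigr => l _; rewrite (metric_sym U l k); ring.
Qed.

Lemma sharp_sym u v : \sum_k u k * sharp v k = \sum_k v k * sharp u k.
Proof.
rewrite /sharp; under eq_bigr do rewrite mulr_sumr.
rewrite exchange_big; apply: eq_bigr => k _ /=; rewrite mulr_sumr.
by apply: eq_bigr => l _; rewrite (cometric_sym U l k); ring.
Qed.

Definition W := sharp b.
Lemma flatW k : flat W k = b k. Proof. exact: sharpK. Qed.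
Lemma W_basic k : basic (W k).
Proof. by apply: basic_sum => l; apply: basicM; [apply: cometric_basic|apply: form_basic]. Qed.

Lemma bW : \sum_k b k * W k = 1.
Proof.
rewrite -(form_unit U); apply: eq_bigr => k _; rewrite /W /sharp mulr_sumr.
by apply: eq_bigr => l _; ring.
Qed.

Definition ylow := flat y.
Definition asq := \sum_k \sum_l g k l * y k * y l.
Definition bform := \sum_k b k * y k.

Lemma asqE : asq = \sum_k y k * ylow k.
Proof.
apply: eq_bigr => k _; rewrite /ylow /flat mulr_sumr.
by apply: eq_bigr => l _; ring.
Qed.

Lemma dY_ylow k l : Y k (ylow l) = g l k.
Proof. by apply: (dY_linear k) => m; apply: metric_basic. Qed.

Lemma dY_bform k : Y k bform = b k.
Proof. by apply: dY_linear => m; apply: form_basic. Qed.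

Lemma dY_asq k : Y k asq = 2 * ylow k.
Proof.
rewrite asqE der_sum; under eq_bigr do rewrite derM dY_ylow dY_yc.
rewrite big_split /= sum_deltal mulr_natl mulr2n; congr (_ + _).
by apply: eq_bigr => l _; rewrite (metric_sym U) mulrC.
Qed.

Definition Gam i k l :=
  onehalf A * \sum_s gi i s * (X k (g s l) + X l (g s k) - X s (g k l)).

Lemma Gam_sym i k l : Gam i k l = Gam i l k.
Proof.
congr (_ * _); apply: eq_bigr => s _; rewrite (metric_sym U k l); congr (_ * _); ring.
Qed.

Lemma Gam_basic i k l : basic (Gam i k l).
Proof.
apply: basicM; first exact: basic_onehalf.
apply: basic_sum => s; apply: basicM; first exact: cometric_basic.
by do 2?[apply: basicD]; rewrite ?basicN //; do ?apply: basicN;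
  apply: basic_dX; apply: metric_basic.
Qed.

(** Twice the Christoffel symbols of the first kind. *)
Lemma flat_Gam k l s : 2 * flat (fun i => Gam i k l) s =
  X k (g s l) + X l (g s k) - X s (g k l).
Proof.
rewrite -(sharpK (fun s => X k (g s l) + X l (g s k) - X s (g k l))).
rewrite /flat mulr_sumr; apply: eq_bigr => i _; rewrite /Gam -/(sharp _ _).
by rewrite mulrCA [2 * _]mulrA onehalfK mul1r.
Qed.

(** The vanishing of the covariant derivative of the metric, written with
    Christoffel symbols. *)
Lemma metric_compat m k l : X m (g k l) =
  flat (fun i => Gam i m l) k + flat (fun i => Gam i m k) l.
Proof.
apply: double_inj; rewrite mulrDr !flat_Gam (metric_sym U l k) (metric_sym U m k) (metric_sym U l m).
ring.
Qed.

(** The nonlinear connection of the metric, that is half the derivative of the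
    spray coefficients in the direction. *)
Definition N_lc i k := \sum_l Gam i k l * y l.
Definition Th_lc i := \sum_k N_lc i k * y k.

Lemma dY_N i k m : Y m (N_lc i k) = Gam i k m.
Proof. by apply: (dY_linear m) => l; apply: Gam_basic. Qed.

Lemma dY_Th_lc i k : Y k (Th_lc i) = 2 * N_lc i k.
Proof.
rewrite der_sum; under eq_bigr do rewrite derM dY_N dY_yc.
rewrite big_split /= mulr_natl mulr2n; congr (_ + _).
  by apply: eq_bigr => l _; rewrite Gam_sym.
by rewrite -[RHS](sum_deltar (N_lc i)); apply: eq_bigr => l _; rewrite eq_sym.
Qed.

Definition S_lc := spray_der Th_lc.
(** By [dX_asq] this is half the derivative of alpha^2 in the position; the
    Lagrange equations of alpha^2/2 then take the form [S_lc_ylow]. *)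
Definition yN k := \sum_i ylow i * N_lc i k.

Lemma flat_lin (F : 'I_n -> 'I_n -> A) u k :
  flat (fun i => \sum_l F i l * u l) k = \sum_l flat (fun i => F i l) k * u l.
Proof.
rewrite /flat; under eq_bigr do rewrite mulr_sumr.
rewrite exchange_big; apply: eq_bigr => l _ /=; rewrite mulr_suml.
by apply: eq_bigr => i _; rewrite mulrA.
Qed.

Lemma S_lc_g k l : S_lc (g k l) = flat (fun i => N_lc i l) k + flat (fun i => N_lc i k) l.
Proof.
rewrite spray_der_basic; last exact: metric_basic.
rewrite /N_lc !flat_lin -big_split; apply: eq_bigr => m _ /=.
rewrite metric_compat -mulrDl mulrC; congr ((_ + _) * _); apply: eq_bigr => i _;
  by rewrite Gam_sym.
Qed.

Lemma yN_E k : \sum_l flat (fun i => N_lc i k) l * y l = yN k.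
Proof.
transitivity (\sum_l y l * flat (fun i => N_lc i k) l).
  by apply: eq_bigr => l _; rewrite mulrC.
by rewrite flat_sym; apply: eq_bigr => i _; rewrite mulrC.
Qed.

Lemma S_lc_ylow k : S_lc (ylow k) = yN k.
Proof.
rewrite /ylow /flat der_sum; under eq_bigr do rewrite derM S_lc_g spray_der_y mulrDl.
rewrite !big_split /= yN_E [in RHS]/yN addrAC -[RHS]add0r; congr (_ + _).
rewrite -flat_lin -/(flat _ _) -big_split big1 // => l _ /=.
by rewrite mulrN subrr.
Qed.

Lemma dX_asq k : X k asq = 2 * yN k.
Proof.
have h l : X k (ylow l) = \sum_m (flat (fun i => Gam i k m) l + flat (fun i => Gam i k l) m) * y m.
  rewrite der_sum; apply: eq_bigr => m _.
  by rewrite derM dX_yc mulr0 addr0 metric_compat.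
rewrite asqE der_sum; under eq_bigr do rewrite derM dX_yc mul0r add0r h mulr_sumr.
transitivity (\sum_i \sum_m (y i * (flat (fun i => Gam i k m) i * y m)) +
  \sum_i \sum_m (y i * (flat (fun j => Gam j k i) m * y m))).
  rewrite -big_split; apply: eq_bigr => i _ /=; rewrite -big_split.
  by apply: eq_bigr => m _ /=; ring.
rewrite [X in _ + X]exchange_big /= mulr_natl mulr2n.
have e : \sum_i \sum_m (y i * (flat (fun i => Gam i k m) i * y m)) = yN k.
  rewrite -yN_E; apply: eq_bigr => i _; rewrite -mulr_sumr -flat_lin mulrC.
  by congr (_ * _).
rewrite {1}e; congr (_ + _); rewrite -[RHS]e; apply: eq_bigr => i _.
by apply: eq_bigr => m _; ring.
Qed.

(** Conservation of the length along geodesics. *)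
Lemma S_lc_asq : S_lc asq = 0.
Proof.
rewrite asqE der_sum; under eq_bigr do rewrite derM S_lc_ylow spray_der_y.
rewrite big_split /=; under eq_bigr do rewrite mulNr.
rewrite sumrN addrC; apply/eqP; rewrite subr_eq0; apply/eqP.
rewrite /yN /Th_lc; under eq_bigr do rewrite mulr_sumr.
rewrite exchange_big; apply: eq_bigr => i _ /=; rewrite mulr_suml.
by apply: eq_bigr => k _; ring.
Qed.

End Metric.

(** * The spray of a Kropina metric *)

Lemma derV (A : comPzRingType) (D : derivation A) i f :
  i * f = 1 -> D i = - (i * i * D f).
Proof.
move=> e; have := congr1 D e; rewrite derM der1 => h.
have h' : D i * f = - (i * D f) by apply/eqP; rewrite -addr_eq0 h.
by rewrite -[D i]mulr1 -e [i * f]mulrC mulrA h'; ring.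
Qed.

Section Kropina.
Context {n : nat} {A : phase_ring n} (U : unit_form A) (ib : A).
Hypothesis ibK : ib * bform U = 1.
Notation y := (@yc n A).
Notation X := (dX A).
Notation Y := (dY A).
Notation g := (metric U).
Notation b := (form U).
Notation W := (W U).
Notation al := (asq U).
Notation bform := (bform U).
Notation yl := (ylow U).
Notation Sb := (S_lc U).
Notation Th := (Th_lc U).

(** With [ib] the inverse of beta, this is alpha^2/beta. *)
Definition kropF := al * ib.
Definition halfF := onehalf A * kropF.
(** Contracting the exterior derivative of b with y gives these components, up
    to sign. *)
Definition curl k := Sb (b k) - X k bform.
(** The symmetrized covariant derivative of b evaluated on (y, y), see [r00E];
    it vanishes exactly when b is a Killing form. *)
Definition r00 := Sb bform.
Definition curlW := \sum_k W k * curl k.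
Definition lam := r00 + halfF * curlW.
(** The correction turning the geodesic spray of alpha into a spray with the
    geodesics of F as unparametrized curves. Its coefficients are found by
    imposing that beta be conserved and that [S_reg_dYkropF] hold. It has only
    powers of beta as denominators, hence the name: it is regular where
    alpha^2 vanishes for complex y. *)
Definition reg_shift k := lam * W k - halfF * sharp U curl k.
Definition Th_reg k := Th k + reg_shift k.
Definition S_reg := spray_der Th_reg.

Lemma halfF_double : 2 * halfF = kropF.
Proof. by rewrite /halfF mulrA onehalfK mul1r. Qed.

Lemma halfF_bform : 2 * (halfF * bform) = al.
Proof. by rewrite mulrA halfF_double /kropF -mulrA ibK mulr1. Qed.

Lemma flat_reg_shift k : flat U reg_shift k = lam * b k - halfF * curl k.
Proof.
rewrite -(flatW U) -[in RHS](sharpK U curl k) /flat /reg_shift; sumring.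
Qed.

Lemma reg_shift_form : \sum_k reg_shift k * b k = r00.
Proof.
transitivity (lam * (\sum_k b k * W k) - halfF * (\sum_k b k * sharp U curl k)).
  by rewrite /reg_shift; sumring.
rewrite bW sharp_sym.
have -> : \sum_k curl k * sharp U b k = curlW by apply: eq_bigr => k _; rewrite mulrC.
by rewrite /lam; ring.
Qed.

(** The exterior derivative is antisymmetric. *)
Lemma curl_y : \sum_k curl k * y k = 0.
Proof.
rewrite /curl; under eq_bigr do rewrite mulrBl.
rewrite sumrB; apply/eqP; rewrite subr_eq0; apply/eqP.
under eq_bigr do rewrite (spray_der_basic _ (form_basic U _)) mulr_suml.
rewrite exchange_big; apply: eq_bigr => k _ /=.
rewrite /bform der_sum mulr_suml; apply: eq_bigr => l _.
by rewrite derM dX_yc; ring.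
Qed.

Lemma reg_shift_y : \sum_k reg_shift k * yl k = lam * bform.
Proof.
rewrite flat_sym; under eq_bigr do rewrite flat_reg_shift.
transitivity (lam * bform - halfF * \sum_k curl k * y k).
  by rewrite /bform; sumring.
by rewrite curl_y mulr0 subr0.
Qed.

Lemma S_regE f : S_reg f = Sb f - \sum_k reg_shift k * Y k f.
Proof. exact: spray_der_shift. Qed.

Lemma S_reg_bform : S_reg bform = 0.
Proof.
rewrite S_regE; under eq_bigr do rewrite dY_bform.
by rewrite reg_shift_form subrr.
Qed.

Lemma S_reg_ib : S_reg ib = 0.
Proof. by rewrite (derV _ ibK) S_reg_bform mulr0 oppr0. Qed.

Lemma S_reg_asq : S_reg al = - (2 * (lam * bform)).
Proof.
rewrite S_regE S_lc_asq add0r -reg_shift_y mulr_sumr; congr (- _).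
by apply: eq_bigr => k _; rewrite dY_asq mulrCA.
Qed.

Lemma S_reg_ylow k : S_reg (yl k) = yN U k - flat U reg_shift k.
Proof.
rewrite S_regE S_lc_ylow; congr (_ - _); apply: eq_bigr => l _.
by rewrite dY_ylow mulrC.
Qed.

Lemma S_reg_b k : S_reg (b k) = X k bform + curl k.
Proof.
rewrite S_regE [X in _ - X]big1 ?subr0; last by move=> l _; rewrite form_basic mulr0.
by rewrite /curl; ring.
Qed.

Lemma dY_kropF k : Y k kropF = 2 * yl k * ib - al * ib * ib * b k.
Proof. by rewrite /kropF derM dY_asq (derV _ ibK) dY_bform; ring. Qed.

Lemma hessian k l : onehalf A * Y k (Y l (kropF * kropF)) = Y k kropF * Y l kropF
  + 2 * al * ib * ib * (g k l - ib * (yl l * b k + yl k * b l)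
     + al * ib * ib * b k * b l).
Proof.
have e : Y k (Y l kropF) = 2 * ib * (g k l - ib * (yl l * b k + yl k * b l)
     + al * ib * ib * b k * b l).
  rewrite dY_kropF derB (derM _ (2 * yl l)) (derM _ 2) der_nat (derM _ _ (b l)).
  rewrite (derM _ (al * ib)) (derM _ al) (derV _ ibK) dY_bform dY_ylow dY_asq.
  by rewrite (form_basic U l) (metric_sym U l k); ring.
rewrite (derM (Y l) kropF kropF) derD (derM (Y k) (Y l kropF)) (derM (Y k) kropF) e.
by rewrite -[RHS]onehalf_double /kropF; ring.
Qed.

(** With w = v - (beta(v)/beta) y the Hessian of F^2/2 is dF(v)^2 + (2
    alpha^2/beta^2) |w|^2. Both terms vanish only if v is a multiple of y, and
    then dF(v) = 0 forces v = 0; so the fundamental tensor is invertible. *)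
Lemma hessian_form (v : 'I_n -> A) :
  let w k := v k - ib * (\sum_m b m * v m) * y k in
  \sum_k \sum_l onehalf A * Y k (Y l (kropF * kropF)) * v k * v l =
  (\sum_k v k * Y k kropF) * (\sum_k v k * Y k kropF) +
  2 * al * ib * ib * \sum_k w k * flat U w k.
Proof.
move=> w; have [t tE] : exists t, t = \sum_m v m * b m by exists (\sum_m v m * b m).
have wE k : w k = v k - ib * t * y k.
  rewrite /w tE; congr (_ - _ * _ * _).
  by apply: eq_bigr => m _; exact: mulrC.
move: w wE => w wE; have [p pE] : exists p, p = \sum_k v k * yl k.
  by exists (\sum_k v k * yl k).
have [q qE] : exists q, q = \sum_k v k * Y k kropF by exists (\sum_k v k * Y k kropF).
have lw k : flat U w k = flat U v k - ib * t * yl k.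
  rewrite /ylow /flat [ib * t * _]mulr_sumr -sumrB.
  by apply: eq_bigr => l _; rewrite wE; ring.
have ww : \sum_k w k * flat U w k = \sum_k v k * flat U v k
    - 2 * (ib * t * p) + ib * t * ib * t * al.
  have vyl : p = \sum_k y k * flat U v k by rewrite pE flat_sym.
  transitivity (\sum_k v k * flat U v k - ib * t * (\sum_k v k * yl k)
    - ib * t * (\sum_k y k * flat U v k) + ib * t * ib * t * \sum_k y k * yl k).
    rewrite [ib * t * (\sum_k v k * _)]mulr_sumr [ib * t * (\sum_k y k * _)]mulr_sumr.
    rewrite [ib * t * ib * t * _]mulr_sumr -!sumrB -big_split.
    by apply: eq_bigr => k _; rewrite /= lw wE; ring.
  by rewrite -asqE -vyl -pE; ring.
rewrite ww -qE.
transitivity (q * (\sum_l v l * Y l kropF) + 2 * al * ib * ib *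
  (\sum_k v k * flat U v k - ib * (\sum_k v k * (t * yl k + p * b k)) +
   al * ib * ib * (t * \sum_k v k * b k))); last first.
  rewrite -qE -tE; congr (_ + _ * (_ - _ + _)); last by ring.
  transitivity (ib * (t * (\sum_k v k * yl k) + p * (\sum_k v k * b k))).
    congr (_ * _); rewrite [t * _]mulr_sumr [p * _]mulr_sumr -big_split.
    by apply: eq_bigr => k _; rewrite /=; ring.
  by rewrite -pE -tE; ring.
rewrite [q * _]mulr_sumr [ib * \sum_k _]mulr_sumr [t * \sum_k _]mulr_sumr.
rewrite [al * ib * ib * \sum_k _]mulr_sumr -sumrB -big_split.
rewrite [2 * al * ib * ib * \sum_k _]mulr_sumr -big_split; apply: eq_bigr => k _ /=.
transitivity (\sum_l (v k * Y k kropF * (v l * Y l kropF) + 2 * al * ib * ib * v k *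
   (g k l * v l - ib * (b k * (v l * yl l) + yl k * (v l * b l))
    + al * ib * ib * b k * (v l * b l)))).
  by apply: eq_bigr => l _; rewrite hessian; ring.
rewrite big_split -!mulr_sumr /= -qE big_split sumrB -!mulr_sumr big_split -!mulr_sumr /=.
by rewrite -pE -tE -/(flat U v k); ring.
Qed.

Lemma S_reg_kropF : S_reg kropF = - (2 * lam).
Proof.
by rewrite /kropF derM S_reg_ib S_reg_asq mulr0 addr0 -[in RHS](mulr1 lam) -ibK; ring.
Qed.

(** Rapcsak's criterion: a spray satisfying this equation is projectively
    equivalent to the spray of F. In each term, alpha^2 is replaced by 2 f
    beta, so that the identity becomes polynomial modulo the relation between
    beta and its inverse. *)
Lemma S_reg_dYkropF k : S_reg (Y k kropF) = X k kropF.
Proof.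
rewrite dY_kropF /kropF [RHS]derM (derV _ ibK) dX_asq derB !derM S_reg_ib S_reg_asq S_reg_ylow S_reg_b.
rewrite flat_reg_shift der_nat.
have e : al = 2 * (halfF * bform) by rewrite halfF_bform.
rewrite e.
ring: ibK.
Qed.

(** The Euler field; homogeneity of degree d is expressed by being multiplied
    by d. *)
Definition euler := act (fun=> 0) y.
Lemma euler_y k : euler (y k) = y k. Proof. exact: act_y. Qed.
Lemma eulerE f : euler f = \sum_k y k * Y k f.
Proof. by rewrite actE big1 ?add0r // => k _; rewrite mul0r. Qed.
Lemma euler_basic c : basic c -> euler c = 0.
Proof. by move=> hc; rewrite eulerE big1 // => k _; rewrite hc mulr0. Qed.
Lemma euler_linear (c : 'I_n -> A) : (forall l, basic (c l)) ->
  euler (\sum_l c l * y l) = \sum_l c l * y l.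
Proof.
move=> hc; rewrite eulerE; apply: eq_bigr => k _.
by rewrite dY_linear // mulrC.
Qed.
Lemma euler_bform : euler bform = bform.
Proof. exact: (euler_linear (form_basic U)). Qed.
Lemma euler_ib : euler ib = - ib.
Proof. by rewrite (derV _ ibK) euler_bform -mulrA ibK mulr1. Qed.
Lemma euler_ylow k : euler (yl k) = yl k.
Proof. by apply: euler_linear => l; apply: metric_basic. Qed.
Lemma euler_asq : euler al = 2 * al.
Proof.
rewrite eulerE asqE mulr_sumr; apply: eq_bigr => k _.
by rewrite -asqE dY_asq; ring.
Qed.
Lemma euler_kropF : euler kropF = kropF.
Proof. by rewrite /kropF derM euler_asq euler_ib; ring. Qed.
Lemma euler_dYkropF k : euler (Y k kropF) = 0.
Proof.
rewrite dY_kropF derB !derM euler_asq euler_ib euler_ylow (euler_basic (form_basic U k)) der_nat.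
ring.
Qed.

Variable ia : A.
Hypothesis iaK : ia * al = 1.

(** Chosen so that F becomes a first integral of the modified spray: H(F) = -
    2 lambda, and the Euler field multiplies F by 1. *)
Definition pfactor := - (lam * bform * ia).
Definition Th_kr k := Th_reg k + 2 * pfactor * y k.
Definition S_kr := spray_der Th_kr.

Lemma S_krE f : S_kr f = S_reg f - 2 * pfactor * euler f.
Proof.
rewrite /S_kr /Th_kr (spray_der_shift Th_reg (fun k => 2 * pfactor * y k)) eulerE mulr_sumr.
by congr (_ - _); apply: eq_bigr => k _; rewrite mulrA.
Qed.

Lemma pfactor_kropF : pfactor * kropF = - lam.
Proof.
rewrite /pfactor /kropF -[in RHS](mulr1 lam) -[1]mulr1 -{1}ibK -iaK; ring.
Qed.

Lemma S_kr_kropF : S_kr kropF = 0.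
Proof. by rewrite S_krE S_reg_kropF euler_kropF -mulrA pfactor_kropF; ring. Qed.

Lemma S_kr_dYkropF k : S_kr (Y k kropF) = X k kropF.
Proof. by rewrite S_krE S_reg_dYkropF euler_dYkropF mulr0 subr0. Qed.

(** Since F is a first integral, S(F_{y^l}) = F_{x^l} amounts to S(E_{y^l}) =
    E_{x^l} for E = F^2, which is the Euler-Lagrange equation of E once the
    term of S in y^m d/dx^m is separated. The factors 2 avoid division. *)
Lemma euler_lagrange l :
  2 * \sum_m (onehalf A * Y l (Y m (kropF * kropF))) * (2 * Th_kr m) =
  2 * (\sum_m X m (Y l (kropF * kropF)) * y m - X l (kropF * kropF)).
Proof.
have e : S_kr (Y l (kropF * kropF)) = X l (kropF * kropF).
  rewrite (derM (Y l) kropF kropF) (derM (X l) kropF kropF) derD (derM S_kr (Y l kropF)) (derM S_kr kropF).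
  by rewrite S_kr_kropF S_kr_dYkropF; ring.
rewrite spray_derE in e.
have -> : \sum_m X m (Y l (kropF * kropF)) * y m =
   X l (kropF * kropF) + \sum_m Th_kr m * Y m (Y l (kropF * kropF)).
  rewrite -e subrK; apply: eq_bigr => m _; exact: mulrC.
rewrite [X in 2 * (X - _)]addrC addrK; congr (2 * _); apply: eq_bigr => m _.
by rewrite dYY; ring: (onehalfK A).
Qed.

End Kropina.

(** * Riemann curvature and projective changes of a spray *)

Section Curv.
Context {n : nat} {A : phase_ring n}.
Implicit Types (T : 'I_n -> A) (N : 'I_n -> 'I_n -> A) (P f : A).
Notation y := (@yc n A).
Notation X := (dX A).
Notation Y := (dY A).
Notation EE := (@euler n A).

(** The Riemann curvature of the spray with coefficients T and connection N,
    for N i k half of dT_i/dy^k; the connection is an argument so that its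
    expression can be chosen freely. *)
Definition jacobi_end T N i k := X k (T i) - spray_der T (N i k) - \sum_m N i m * N m k.

Lemma euler_dY k f : EE (Y k f) = Y k (EE f) - Y k f.
Proof.
rewrite !eulerE der_sum; under [in RHS]eq_bigr do rewrite derM dY_yc.
rewrite big_split /= sum_deltal addrC addrK; apply: eq_bigr => l _.
by rewrite dYY.
Qed.

Section Projective.
Variables (T : 'I_n -> A) (N : 'I_n -> 'I_n -> A) (P : A).
Hypothesis NE : forall i k, Y k (T i) = 2 * N i k.
Hypothesis TE : forall i, EE (T i) = 2 * T i.
Hypothesis PE : EE P = P.

Lemma N_y i : \sum_m N i m * y m = T i.
Proof.
apply: double_inj; rewrite -TE eulerE mulr_sumr; apply: eq_bigr => m _.
by rewrite NE; ring.
Qed.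

Lemma euler_N i k : EE (N i k) = N i k.
Proof.
apply: double_inj.
have -> : 2 * EE (N i k) = EE (2 * N i k) by rewrite derM der_nat mul0r add0r.
by rewrite -NE euler_dY TE derM der_nat NE; ring.
Qed.

(** The effect of a projective change on the Ricci curvature. The cross terms
    are evaluated by Euler's theorem for T, of degree 2, and P, of degree
    1. *)
Lemma ricci_projective :
  \sum_k jacobi_end (fun i => T i + 2 * P * y i)
      (fun i k => N i k + Y k P * y i + P * (i == k)%:R) k k =
  \sum_k jacobi_end T N k k + (n%:R - 1) * (P * P - spray_der T P).
Proof.
set N' := (fun i k : 'I_n => N i k + Y k P * y i + P * (i == k)%:R).
set T' := (fun i : 'I_n => T i + 2 * P * y i).
have YP : \sum_k y k * Y k P = P by rewrite -eulerE PE.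
have YPT : spray_der T P = \sum_k y k * X k P - \sum_k T k * Y k P by rewrite spray_derE.
have sprayT' f : spray_der T' f = spray_der T f - 2 * P * EE f.
  rewrite /T' (spray_der_shift T (fun k => 2 * P * y k)) eulerE mulr_sumr.
  by congr (_ - _); apply: eq_bigr => k _; rewrite mulrA.
(* The three traces of the curvature of the modified spray are computed
   separately. *)
have trN' : \sum_k N' k k = \sum_k N k k + (n%:R + 1) * P.
  rewrite /N' !big_split /= -addrA; congr (_ + _).
  have -> : \sum_i Y i P * y i = P by rewrite -{2}YP; apply: eq_bigr => k _; rewrite mulrC.
  rewrite -mulr_sumr; under eq_bigr do rewrite eqxx.
  by rewrite sumr_const card_ord [true%:R]mulr1n; ring.
have trS : \sum_k spray_der T' (N' k k) =
    \sum_k spray_der T (N k k) + (n%:R + 1) * spray_der T P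
    - 2 * P * (\sum_k N k k + (n%:R + 1) * P).
  have tr1 : EE (\sum_k N k k) = \sum_k N k k.
    by rewrite der_sum; apply: eq_bigr => k _; apply: euler_N.
  have tr2 : EE ((n%:R + 1) * P) = (n%:R + 1) * P.
    by rewrite derM derD der_nat der1 PE; ring.
  have tr3 : spray_der T ((n%:R + 1) * P) = (n%:R + 1) * spray_der T P.
    by rewrite derM derD der_nat der1; ring.
  by rewrite -der_sum trN' sprayT' !derD tr1 tr2 tr3 der_sum.
have NN : \sum_k \sum_m N' k m * N' m k =
    \sum_k \sum_m N k m * N m k + 2 * \sum_k T k * Y k P
    + 2 * P * \sum_k N k k + (n%:R + 3) * (P * P).
  have inner k : \sum_m N' k m * N' m k = \sum_m N k m * N m k
      + \sum_m N k m * (Y k P * y m) + \sum_m (N k m * P) * (m == k)%:R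
      + \sum_m Y m P * y k * N m k + Y k P * y k * \sum_m y m * Y m P
      + \sum_m (Y m P * y k * P) * (m == k)%:R
      + \sum_m (k == m)%:R * (P * N m k)
      + \sum_m (k == m)%:R * (P * Y k P * y m) + \sum_m (k == m)%:R * (P * (P * (m == k)%:R)).
    by rewrite /N'; sumring.
  under eq_bigr do rewrite inner !sum_deltal !sum_deltar YP.
  rewrite !big_split /= -!addrA; congr (_ + _).
  have e1 : \sum_i \sum_m N i m * (Y i P * y m) = \sum_k T k * Y k P.
    apply: eq_bigr => k _; rewrite -N_y mulr_suml; apply: eq_bigr => m _; ring.
  have e2 : \sum_i \sum_m Y m P * y i * N m i = \sum_k T k * Y k P.
    rewrite exchange_big; apply: eq_bigr => k _ /=; rewrite -N_y mulr_suml.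
    by apply: eq_bigr => m _; ring.
  have e3 : \sum_(i < n) P * (P * (i == i)%:R) = n%:R * (P * P).
    by under eq_bigr do rewrite eqxx mulr1n mulr1; rewrite sumr_const card_ord mulr_natl.
  have e4 : \sum_i Y i P * y i * P = P * P.
    rewrite -{4}YP mulr_sumr; apply: eq_bigr => k _; ring.
  have e5 : \sum_i P * Y i P * y i = P * P.
    rewrite -{4}YP mulr_sumr; apply: eq_bigr => k _; ring.
  rewrite e1 e2 e3 e4 e5 -mulr_suml -mulr_sumr; ring.
rewrite /jacobi_end !sumrB trS NN YPT.
have -> : \sum_i X i (T' i) = \sum_i X i (T i) + 2 * \sum_k y k * X k P.
  rewrite mulr_sumr -big_split; apply: eq_bigr => k _.
  by rewrite /T' derD !derM der_nat dX_yc /=; ring.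
ring.
Qed.

End Projective.
End Curv.

(** * The pole of the Ricci curvature along the null cone of the metric *)

Section Homogeneity.
Context {n : nat} {A : phase_ring n} (U : unit_form A) (ib ia : A).
Hypothesis ibK : ib * bform U = 1.
Hypothesis iaK : ia * asq U = 1.
Notation y := (@yc n A).
Notation X := (dX A).
Notation Y := (dY A).
Notation EE := (@euler n A).

Lemma euler_linear_eq (c : 'I_n -> A) : (forall k, basic (c k)) ->
  forall f : A, f = \sum_k y k * c k -> EE f = f.
Proof.
move=> hc f ->; rewrite -[RHS](_ : \sum_k c k * y k = _).
  rewrite -(euler_linear hc); congr (EE _); apply: eq_bigr => k _; exact: mulrC.
by apply: eq_bigr => k _; exact: mulrC.
Qed.

Lemma euler_N_lc i k : EE (N_lc U i k) = N_lc U i k.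
Proof. by apply: euler_linear => l; apply: Gam_basic. Qed.

Lemma euler_Th_lc i : EE (Th_lc U i) = 2 * Th_lc U i.
Proof.
rewrite der_sum mulr_sumr; apply: eq_bigr => k _.
by rewrite derM euler_N_lc euler_y; ring.
Qed.

Lemma euler_dX_bform k : EE (X k (bform U)) = X k (bform U).
Proof.
apply: (@euler_linear_eq (fun l => X k (form U l))) => [l|].
  exact: basic_dX (form_basic U l).
rewrite /bform der_sum; apply: eq_bigr => l _.
by rewrite derM dX_yc; ring.
Qed.

Lemma euler_S_lc_b k : EE (S_lc U (form U k)) = S_lc U (form U k).
Proof.
apply: (@euler_linear_eq (fun l => X l (form U k))) => [l|].
  exact: basic_dX (form_basic U k).
exact: spray_der_basic (form_basic U k).
Qed.

Lemma euler_curl k : EE (curl U k) = curl U k.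
Proof. by rewrite /curl derB euler_S_lc_b euler_dX_bform. Qed.

Lemma euler_sharp_curl k : EE (sharp U (curl U) k) = sharp U (curl U) k.
Proof.
rewrite der_sum; apply: eq_bigr => l _.
by rewrite derM euler_curl (euler_basic (cometric_basic U k l)); ring.
Qed.

Lemma euler_curlW : EE (curlW U) = curlW U.
Proof.
rewrite der_sum; apply: eq_bigr => l _.
by rewrite derM euler_curl (euler_basic (W_basic U l)); ring.
Qed.

Lemma euler_r00 : EE (r00 U) = 2 * r00 U.
Proof.
rewrite /r00 /S_lc spray_derE derB !der_sum mulrBr !mulr_sumr.
congr (_ - _); apply: eq_bigr => k _; rewrite derM.
  by rewrite euler_dX_bform euler_y; ring.
by rewrite dY_bform euler_Th_lc (euler_basic (form_basic U k)); ring.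
Qed.

Lemma euler_halfF : EE (halfF U ib) = halfF U ib.
Proof. by rewrite /halfF derM euler_kropF // der_onehalf; ring. Qed.

Lemma euler_lam : EE (lam U ib) = 2 * lam U ib.
Proof. by rewrite /lam derD (derM _ (halfF U ib)) euler_r00 euler_curlW euler_halfF; ring. Qed.

Lemma euler_Th_reg i : EE (Th_reg U ib i) = 2 * Th_reg U ib i.
Proof.
rewrite /Th_reg /reg_shift derD derB (derM _ (lam U ib)) (derM _ (halfF U ib)) euler_Th_lc euler_lam euler_halfF.
rewrite euler_sharp_curl.
by rewrite (euler_basic (W_basic U i)); ring.
Qed.

Lemma euler_ia : EE ia = - (2 * ia).
Proof.
by rewrite (derV _ iaK) euler_asq; ring: iaK.
Qed.

Lemma euler_pfactor : EE (pfactor U ib ia) = pfactor U ib ia.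
Proof. by rewrite /pfactor derN !derM euler_lam euler_bform euler_ia; ring. Qed.

Definition N_reg i k := onehalf A * Y k (Th_reg U ib i).
Definition N_kr i k := onehalf A * Y k (Th_kr U ib ia i).

Lemma N_regE i k : Y k (Th_reg U ib i) = 2 * N_reg i k.
Proof. by rewrite /N_reg mulrA onehalfK mul1r. Qed.

(** The numerator of the projective factor, which is [pnum] divided by
    alpha^2. *)
Definition pnum := - (lam U ib * bform U).

Lemma pfactorE : pfactor U ib ia = pnum * ia.
Proof. by rewrite /pfactor /pnum mulNr. Qed.

(** The derivative of 1/alpha^2 along H is 2 lambda beta/alpha^4, that is - 2
    pnum/alpha^4, so that P^2 - H(P) = 3 pnum^2/alpha^4 - H(pnum)/alpha^2. *)
Lemma ricci_pole :
  \sum_k jacobi_end (Th_kr U ib ia) N_kr k k = \sum_k jacobi_end (Th_reg U ib) N_reg k k +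
  (n%:R - 1) * (3 * (pnum * pnum) * (ia * ia) - S_reg U ib pnum * ia).
Proof.
transitivity (\sum_k jacobi_end (fun i => Th_reg U ib i + 2 * pfactor U ib ia * y i)
  (fun i k => N_reg i k + Y k (pfactor U ib ia) * y i + pfactor U ib ia * (i == k)%:R) k k).
  apply: eq_bigr => k _.
  have e i j : N_kr i j = N_reg i j + Y j (pfactor U ib ia) * y i + pfactor U ib ia * (i == j)%:R.
    rewrite /N_kr /N_reg /Th_kr derD !derM der_nat dY_yc (eq_sym j i).
    ring: (onehalfK A).
  rewrite /jacobi_end e; congr (_ - _ ).
  by apply: eq_bigr => m _; rewrite !e.
rewrite ricci_projective; [|exact: N_regE|exact: euler_Th_reg|exact: euler_pfactor].
congr (_ + _ * _); rewrite -/(S_reg U ib) pfactorE derM (derV _ iaK) S_reg_asq //.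
rewrite -/(S_reg U ib pnum) /pnum; ring.
Qed.

(** The ring generated by the functions of the position, the y^k and 1/beta.
    It is stable under both kinds of derivations and does not involve
    1/alpha^2, so its elements become polynomials on the lines where beta =
    1. *)
Inductive polar : A -> Prop :=
| polar_basic c : basic c -> polar c
| polar_y k : polar (y k)
| polar_ib : polar ib
| polarD f g : polar f -> polar g -> polar (f + g)
| polarM f g : polar f -> polar g -> polar (f * g).

Lemma polarN f : polar f -> polar (- f).
Proof.
move=> hf; rewrite -mulN1r; apply: polarM => //; apply: polar_basic => m.
by rewrite derN der1 oppr0.
Qed.
Lemma polarB f g : polar f -> polar g -> polar (f - g).
Proof. by move=> hf hg; apply: polarD => //; apply: polarN. Qed.
Lemma polar_nat m : polar m%:R.
Proof. by apply: polar_basic => k; apply: der_nat. Qed.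
Lemma polar_onehalf : polar (onehalf A).
Proof. exact: polar_basic basic_onehalf. Qed.
Lemma polar_sum (G : 'I_n -> A) : (forall i, polar (G i)) -> polar (\sum_i G i).
Proof.
move=> hG; apply: (big_ind polar) => //; first exact: (polar_nat 0).
exact: polarD.
Qed.

Lemma polar_bform : polar (bform U).
Proof.
by apply: polar_sum => k; apply: polarM; [apply/polar_basic/form_basic|apply: polar_y].
Qed.

Lemma polar_dX k f : polar f -> polar (X k f).
Proof.
elim=> {f} [c hc|l||f g hf ihf hg ihg|f g hf ihf hg ihg].
- exact/polar_basic/basic_dX.
- by rewrite dX_yc; apply: (polar_nat 0).
- rewrite (derV _ ibK); apply/polarN/polarM; first by apply: polarM; apply: polar_ib.
  rewrite der_sum; apply: polar_sum => l; rewrite derM dX_yc mulr0 addr0.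
  by apply: polarM; [apply/polar_basic/basic_dX/form_basic|apply: polar_y].
- by rewrite derD; apply: polarD.
- by rewrite derM; apply: polarD; apply: polarM.
Qed.

Lemma polar_dY k f : polar f -> polar (Y k f).
Proof.
elim=> {f} [c hc|l||f g hf ihf hg ihg|f g hf ihf hg ihg].
- by rewrite hc; apply: (polar_nat 0).
- by rewrite dY_yc; apply: polar_nat.
- rewrite (derV _ ibK) dY_bform; apply/polarN/polarM; last exact/polar_basic/form_basic.
  by apply: polarM; apply: polar_ib.
- by rewrite derD; apply: polarD.
- by rewrite derM; apply: polarD; apply: polarM.
Qed.

Lemma polar_spray_der (T : 'I_n -> A) f :
  (forall i, polar (T i)) -> polar f -> polar (spray_der T f).
Proof.
move=> hT hf; rewrite spray_derE; apply: polarB; apply: polar_sum => k; apply: polarM => //.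
- exact: polar_y.
- exact: polar_dX.
- exact: polar_dY.
Qed.

Lemma polar_Th_lc i : polar (Th_lc U i).
Proof.
apply: polar_sum => k; apply: polarM; last exact: polar_y.
apply: polar_sum => l; apply: polarM; last exact: polar_y.
exact/polar_basic/Gam_basic.
Qed.

Lemma polar_asq : polar (asq U).
Proof.
apply: polar_sum => k; apply: polar_sum => l; do 2?apply: polarM; try exact: polar_y.
exact/polar_basic/metric_basic.
Qed.

Lemma polar_halfF : polar (halfF U ib).
Proof.
apply: polarM; first exact: polar_onehalf.
by apply: polarM; [exact: polar_asq|exact: polar_ib].
Qed.

Lemma polar_curl k : polar (curl U k).
Proof.
apply: polarB; last exact/polar_dX/polar_bform.
by apply: polar_spray_der; [exact: polar_Th_lc|apply/polar_basic/form_basic].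
Qed.

Lemma polar_r00 : polar (r00 U).
Proof. by apply: polar_spray_der; [exact: polar_Th_lc|exact: polar_bform]. Qed.

Lemma polar_curlW : polar (curlW U).
Proof.
by apply: polar_sum => k; apply: polarM; [apply/polar_basic/W_basic|apply: polar_curl].
Qed.

Lemma polar_lam : polar (lam U ib).
Proof.
apply: polarD; first exact: polar_r00.
by apply: polarM; [exact: polar_halfF|exact: polar_curlW].
Qed.

Lemma polar_pnum : polar pnum.
Proof. by apply/polarN/polarM; [exact: polar_lam|exact: polar_bform]. Qed.

Lemma polar_Th_reg i : polar (Th_reg U ib i).
Proof.
apply: polarD; first exact: polar_Th_lc.
apply: polarB; apply: polarM.
- exact: polar_lam.
- exact/polar_basic/W_basic.
- exact: polar_halfF.
- apply: polar_sum => k; apply: polarM; last exact: polar_curl.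
  exact/polar_basic/cometric_basic.
Qed.

Lemma polar_S_reg_pnum : polar (S_reg U ib pnum).
Proof. by apply: polar_spray_der; [exact: polar_Th_reg|exact: polar_pnum]. Qed.

Lemma polar_ricci_reg : polar (\sum_k jacobi_end (Th_reg U ib) N_reg k k).
Proof.
have hN i k : polar (N_reg i k).
  by apply: polarM; [exact: polar_onehalf|apply/polar_dY/polar_Th_reg].
apply: polar_sum => k; apply: polarB; last first.
  by apply: polar_sum => m; apply: polarM.
apply: polarB; first exact/polar_dX/polar_Th_reg.
by apply: polar_spray_der => //; exact: polar_Th_reg.
Qed.

End Homogeneity.

(** * Covariant derivatives and the curvature tensor *)

Section Covariant.
Context {n : nat} {A : phase_ring n} (U : unit_form A).
Notation y := (@yc n A).
Notation X := (dX A).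
Notation Y := (dY A).
Notation b := (form U).
Notation W := (W U).
Notation N := (N_lc U).
Notation Th := (Th_lc U).
Notation Sb := (S_lc U).
Notation Gam := (Gam U).
Notation lower := (flat U).

(** The components of the covariant derivative of W. *)
Definition DW i m := X m (W i) + \sum_l Gam i l m * W l.
(** The covariant derivative of W in the direction y, written with the
    spray. *)
Definition DyW i := Sb (W i) + \sum_m N i m * W m.

Lemma DW_basic i m : basic (DW i m).
Proof.
apply: basicD; first exact/basic_dX/W_basic.
by apply: basic_sum => l; apply: basicM; [apply: Gam_basic|apply: W_basic].
Qed.

Lemma DyWE i : DyW i = \sum_m DW i m * y m.
Proof.
rewrite /DyW spray_der_basic; last exact: W_basic.
rewrite /DW; under [RHS]eq_bigr do rewrite mulrDl mulr_suml.
rewrite big_split /=; congr (_ + _); first by apply: eq_bigr => k _; rewrite mulrC.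
rewrite exchange_big; apply: eq_bigr => k _ /=; rewrite mulr_suml.
by apply: eq_bigr => l _; ring.
Qed.

Lemma dY_DyW i m : Y m (DyW i) = DW i m.
Proof. by rewrite DyWE; apply: (dY_linear m) => l; apply: DW_basic. Qed.

Lemma flat_DyW k : lower DyW k = Sb (b k) - \sum_l b l * N l k.
Proof.
have -> : Sb (b k) = Sb (lower W k) by rewrite flatW.
rewrite /lower der_sum; under [X in _ = X - _]eq_bigr do rewrite derM S_lc_g mulrDl.
rewrite !big_split /=.
have -> : \sum_i lower (fun j => N j k) i * W i = \sum_l b l * N l k.
  transitivity (\sum_i W i * lower (fun j => N j k) i).
    by apply: eq_bigr => i _; rewrite mulrC.
  by rewrite flat_sym; apply: eq_bigr => i _; rewrite flatW mulrC.
rewrite -flat_lin [X in _ = X - _]addrAC addrK /DyW /lower -big_split /=.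
by apply: eq_bigr => l _; ring.
Qed.

(** Derivative of the relation beta(W) = 1. *)
Lemma b_DyW : \sum_k b k * DyW k = 0.
Proof.
have e : Sb (\sum_k b k * W k) = 0 by rewrite bW der1.
apply: double_inj; rewrite mulr0 -[RHS]e der_sum.
have -> : 2 * (\sum_k b k * DyW k) = \sum_k W k * lower DyW k + \sum_k b k * DyW k.
  rewrite flat_sym mulr_natl mulr2n; congr (_ + _).
  by apply: eq_bigr => k _; rewrite flatW mulrC.
under eq_bigr do rewrite flat_DyW mulrBr.
rewrite sumrB /DyW; under [X in _ + X]eq_bigr do rewrite mulrDr.
under [RHS]eq_bigr do rewrite derM.
rewrite !big_split /=.
have -> : \sum_i W i * \sum_l b l * N l i = \sum_i b i * \sum_m N i m * W m.
  under eq_bigr do rewrite mulr_sumr.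
  rewrite exchange_big; apply: eq_bigr => k _ /=; rewrite mulr_sumr.
  by apply: eq_bigr => l _; ring.
under eq_bigr do rewrite mulrC.
ring.
Qed.

Lemma b_DW m : \sum_k b k * DW k m = 0.
Proof.
transitivity (Y m (\sum_k b k * DyW k)); last by rewrite b_DyW der0.
rewrite der_sum; apply: eq_bigr => k _.
by rewrite derM dY_DyW form_basic mul0r add0r.
Qed.

(** The second covariant derivative of W: the first index after i is that of
    the second differentiation. *)
Definition DDW i k l :=
  X k (DW i l) + \sum_m Gam i k m * DW m l - \sum_m Gam m k l * DW i m.
(** The curvature tensor, with the index conventions of [riemann_tensor]. *)
Definition curv i j k l := X k (Gam i l j) - X l (Gam i k j)
  + \sum_m (Gam i k m * Gam m l j - Gam i l m * Gam m k j).

Lemma DDW_basic i k l : basic (DDW i k l).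
Proof.
apply: basicD; first apply: basicD; first exact/basic_dX/DW_basic.
  by apply: basic_sum => m; apply: basicM; [apply: Gam_basic|apply: DW_basic].
by apply/basicN/basic_sum => m; apply: basicM; [apply: Gam_basic|apply: DW_basic].
Qed.

Lemma curv_basic i j k l : basic (curv i j k l).
Proof.
apply: basicD.
  by apply: basicD; [|apply: basicN]; apply/basic_dX/Gam_basic.
by apply: basic_sum => m; apply: basicD; [|apply: basicN]; apply: basicM;
  apply: Gam_basic.
Qed.

Lemma curv_anti i j k l : curv i j k l = - curv i j l k.
Proof.
rewrite /curv opprD opprB -sumrN; congr (_ + _).
by apply: eq_bigr => m _; rewrite opprB.
Qed.

Lemma bianchi i j k l : curv i j k l + curv i k l j + curv i l j k = 0.
Proof.
rewrite /curv (Gam_sym U i l j) (Gam_sym U i k j) (Gam_sym U i l k).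
transitivity (\sum_m (Gam i k m * Gam m l j - Gam i l m * Gam m k j
 + (Gam i l m * Gam m j k - Gam i j m * Gam m l k)
 + (Gam i j m * Gam m k l - Gam i k m * Gam m j l))).
  by rewrite !big_split /=; ring.
rewrite big1 // => m _.
rewrite (Gam_sym U m l j) (Gam_sym U m k j) (Gam_sym U m l k); ring.
Qed.

Lemma ricci_identity i k l : DDW i k l - DDW i l k = \sum_j curv i j k l * W j.
Proof.
have dss m p : X m (DW i p) = X m (X p (W i))
   + \sum_j (X m (Gam i j p) * W j + Gam i j p * X m (W j)).
  rewrite /DW derD; congr (_ + _).
  by rewrite der_sum; apply: eq_bigr => j _; rewrite derM.
rewrite /DDW !dss (dXX k l).
rewrite (_ : \sum_m Gam m l k * DW i m = \sum_m Gam m k l * DW i m); last first.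
  by apply: eq_bigr => m _; rewrite Gam_sym.
have gs p q : \sum_m Gam i p m * DW m q = \sum_m Gam i p m * X q (W m)
   + \sum_j \sum_m Gam i p m * Gam m q j * W j.
  rewrite exchange_big -big_split; apply: eq_bigr => m _ /=.
  rewrite /DW mulrDr mulr_sumr; congr (_ + _); apply: eq_bigr => j _.
  by rewrite mulrA (Gam_sym U m).
rewrite !gs.
have Re j : curv i j k l * W j = X k (Gam i j l) * W j - X l (Gam i j k) * W j
   + (\sum_m Gam i k m * Gam m l j * W j - \sum_m Gam i l m * Gam m k j * W j).
  rewrite /curv mulrDl mulr_suml -sumrB (Gam_sym U i l j) (Gam_sym U i k j).
  by congr (_ + _); [ring|apply: eq_bigr => m _; ring].
under [RHS]eq_bigr do rewrite Re.
rewrite !(big_split, sumrB) /=.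
rewrite (_ : \sum_i0 Gam i k i0 * X l (W i0) = \sum_j Gam i j k * X l (W j)); last first.
  by apply: eq_bigr => j _; rewrite Gam_sym.
rewrite (_ : \sum_i0 Gam i l i0 * X k (W i0) = \sum_j Gam i j l * X k (W j)); last first.
  by apply: eq_bigr => j _; rewrite Gam_sym.
rewrite !sumrN; ring.
Qed.

(** For the geodesic spray of a metric, the curvature of the spray is
    quadratic in y and given by the curvature tensor. *)
Lemma jacobi_Th_lc i k : jacobi_end Th N i k = \sum_j \sum_l curv i j k l * y j * y l.
Proof.
have e1 : X k (Th i) = \sum_j \sum_l X k (Gam i l j) * y j * y l.
  rewrite der_sum exchange_big; apply: eq_bigr => l _ /=.
  rewrite derM dX_yc mulr0 addr0 der_sum mulr_suml; apply: eq_bigr => m _.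
  by rewrite derM dX_yc mulr0 addr0.
have e2 : Sb (N i k) = \sum_j \sum_l X l (Gam i k j) * y j * y l
    - \sum_j \sum_l (\sum_m Gam i k m * Gam m l j) * y j * y l.
  rewrite spray_derE; congr (_ - _).
    rewrite exchange_big; apply: eq_bigr => m _ /=.
    rewrite der_sum mulr_sumr; apply: eq_bigr => l _.
    by rewrite derM dX_yc; ring.
  have ThGam m : Th m * Gam i k m = \sum_j \sum_l Gam i k m * Gam m l j * y j * y l.
    rewrite exchange_big /Th mulr_suml; apply: eq_bigr => l _ /=.
    by rewrite /N_lc !mulr_suml; apply: eq_bigr => j _; ring.
  under eq_bigr do rewrite dY_N ThGam.
  rewrite exchange_big; apply: eq_bigr => j _ /=.
  rewrite exchange_big; apply: eq_bigr => l _ /=.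
  by rewrite !mulr_suml.
have e3 : \sum_m N i m * N m k =
    \sum_j \sum_l (\sum_m Gam i l m * Gam m k j) * y j * y l.
  have NN m : N i m * N m k = \sum_j \sum_l Gam i l m * Gam m k j * y j * y l.
    rewrite mulrC /N_lc mulr_suml; apply: eq_bigr => j _.
    by rewrite mulr_sumr; apply: eq_bigr => l _; rewrite (Gam_sym U i l); ring.
  under eq_bigr do rewrite NN.
  rewrite exchange_big; apply: eq_bigr => j _ /=.
  rewrite exchange_big; apply: eq_bigr => l _ /=.
  by rewrite !mulr_suml.
rewrite /jacobi_end -/Sb e1 e2 e3 -!sumrB; apply: eq_bigr => j _.
rewrite -!sumrB; apply: eq_bigr => l _.
by rewrite /curv sumrB; ring.
Qed.

(** The complete lift of a vector field of the base. *)
Definition clift (V : 'I_n -> A) := act V (fun l => \sum_m y m * X m (V l)).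

End Covariant.

Section Commutators.
Context {n : nat} {A : phase_ring n}.
Lemma dX_act k (xi eta : 'I_n -> A) f : dX A k (act xi eta f) =
  act xi eta (dX A k f) + act (fun l => dX A k (xi l)) (fun l => dX A k (eta l)) f.
Proof.
rewrite !act_sum der_sum -big_split /=; apply: eq_bigr => l _.
rewrite derD !derM (dXX k l) (dXY k l); ring.
Qed.
Lemma dY_act k (xi eta : 'I_n -> A) f : dY A k (act xi eta f) =
  act xi eta (dY A k f) + act (fun l => dY A k (xi l)) (fun l => dY A k (eta l)) f.
Proof.
rewrite !act_sum der_sum -big_split /=; apply: eq_bigr => l _.
rewrite derD !derM -(dXY l k) (dYY k l); ring.
Qed.

Lemma dY_spray_der k (T : 'I_n -> A) f : dY A k (spray_der T f) =
  spray_der T (dY A k f) + dX A k f - \sum_m dY A k (T m) * dY A m f.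
Proof.
rewrite /spray_der dY_act [X in _ + X = _]actE -addrA; congr (_ + (_ + _)).
  by under eq_bigr do rewrite dY_yc; rewrite sum_deltal.
by rewrite -sumrN; apply: eq_bigr => m _; rewrite derN mulNr.
Qed.
End Commutators.

(** * Killing forms of unit length *)

Section Killing.
Context {n : nat} {A : phase_ring n} (U : unit_form A).
Notation y := (@yc n A).
Notation X := (dX A).
Notation Y := (dY A).
Notation b := (form U).
Notation W := (W U).
Notation N := (N_lc U).
Notation Th := (Th_lc U).
Notation Sb := (S_lc U).
Notation Gam := (Gam U).
Notation lower := (flat U).
Notation cc := (curl U).
Notation sig := (DyW U).
Notation ss := (DW U).
Notation yl := (ylow U).
Notation al := (asq U).

(** The covariant derivative of the form b. *)
Definition Db k l := X l (b k) - \sum_m Gam m k l * b m.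

Lemma flat_DyW_Db k : lower sig k = \sum_l Db k l * y l.
Proof.
rewrite flat_DyW spray_der_basic; last exact: form_basic.
rewrite /Db; under [RHS]eq_bigr do rewrite mulrBl mulr_suml.
rewrite sumrB; congr (_ - _); first by apply: eq_bigr => l _; rewrite mulrC.
rewrite exchange_big; apply: eq_bigr => m _ /=; rewrite /N_lc mulr_sumr.
by apply: eq_bigr => l _; ring.
Qed.

Lemma Db_basic k l : basic (Db k l).
Proof.
apply: basicD; first exact/basic_dX/form_basic.
by apply/basicN/basic_sum => m; apply: basicM; [apply: Gam_basic|apply: form_basic].
Qed.

Lemma DbE k l : Db k l = lower (fun i => ss i l) k.
Proof.
transitivity (Y l (lower sig k)).
  by rewrite flat_DyW_Db; apply/esym/(dY_linear l) => m; apply: Db_basic.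
rewrite der_sum; apply: eq_bigr => i _.
by rewrite derM dY_DyW metric_basic mul0r add0r.
Qed.

(** Derivative of the relation |b| = 1, W being dual to b. *)
Lemma W_Db l : \sum_k W k * Db k l = 0.
Proof.
under eq_bigr do rewrite DbE.
rewrite flat_sym; transitivity (\sum_k b k * ss k l); last exact: b_DW.
apply: eq_bigr => k _.
by rewrite flatW mulrC.
Qed.

Lemma r00E : r00 U = \sum_k \sum_l Db k l * y k * y l.
Proof.
transitivity (\sum_k y k * lower sig k); last first.
  apply: eq_bigr => k _; rewrite flat_DyW_Db mulr_sumr.
  by apply: eq_bigr => l _; ring.
rewrite /r00 /bform (der_sum Sb) ; under [RHS]eq_bigr do rewrite flat_DyW mulrBr.
rewrite (eq_bigr (fun k => y k * Sb (b k) - b k * Th k)); last first.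
  by move=> k _; rewrite (derM Sb) [Sb (y k)]spray_der_y; ring.
rewrite !sumrB; congr (_ - _).
transitivity (\sum_k \sum_l b k * N k l * y l).
  apply: eq_bigr => k _; rewrite /Th_lc mulr_sumr.
  by apply: eq_bigr => l _; rewrite mulrA.
rewrite exchange_big; apply: eq_bigr => l _ /=; rewrite mulr_sumr.
by apply: eq_bigr => k _; ring.
Qed.

Hypothesis killing : r00 U = 0.

(** Derivative in y of the equation S(beta) = 0. *)
Lemma killing_b k : Sb (b k) + X k (bform U) = 2 * \sum_l b l * N l k.
Proof.
have e := congr1 (Y k) killing; rewrite der0 /r00 /S_lc dY_spray_der dY_bform in e.
transitivity (\sum_m Y k (Th m) * Y m (bform U)).
  by apply/eqP; rewrite -subr_eq0; apply/eqP.
by rewrite mulr_sumr; apply: eq_bigr => m _; rewrite dY_Th_lc dY_bform; ring.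
Qed.

Lemma curl_DyW k : cc k = 2 * lower sig k.
Proof. by rewrite flat_DyW mulrBr -killing_b /cc; ring. Qed.

Lemma y_DyW : \sum_k y k * lower sig k = 0.
Proof.
apply: double_inj; rewrite mulr0; transitivity (\sum_k cc k * y k); last exact: curl_y.
rewrite mulr_sumr; apply: eq_bigr => k _.
by rewrite curl_DyW; ring.
Qed.

(** The Killing equation in its usual form, obtained by polarizing the
    quadratic form [r00]. *)
Lemma Db_anti k l : Db k l = - Db l k.
Proof.
have h m : lower sig m + \sum_k y k * Db k m = 0.
  transitivity (Y m (\sum_k y k * lower sig k)); last by rewrite y_DyW der0.
  rewrite der_sum; under [RHS]eq_bigr do rewrite derM dY_yc.
  rewrite [RHS]big_split sum_deltal; congr (_ + _); apply: eq_bigr => j _.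
  by rewrite flat_DyW_Db dY_linear // => p; apply: Db_basic.
have := congr1 (Y l) (h k); rewrite der0 derD flat_DyW_Db dY_linear; last first.
  by move=> p; apply: Db_basic.
move=> /eqP; rewrite addr_eq0 => /eqP ->; congr (- _).
rewrite -[RHS](_ : Y l (\sum_p Db p k * y p) = _).
  by congr (Y l _); apply: eq_bigr => p _; rewrite mulrC.
by rewrite dY_linear // => p; apply: Db_basic.
Qed.

(** Integral curves of a Killing field of constant length are geodesics. *)
Lemma DW_W i : \sum_m ss i m * W m = 0.
Proof.
apply: (flat_inj (U := U) (u := fun i => \sum_m ss i m * W m) (v := fun=> 0)) => k.
rewrite flat_lin; under eq_bigr do rewrite -DbE Db_anti mulNr mulrC.
rewrite sumrN W_Db oppr0 /flat big1 // => l _; exact: mulr0.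
Qed.

(** The flow of W is isometric. *)
Lemma lift_W_asq : clift W al = 0.
Proof.
rewrite /clift actE.
transitivity (2 * \sum_l yl l * sig l).
  rewrite /DyW; under [in RHS]eq_bigr do rewrite mulrDr mulr_sumr.
  rewrite big_split mulrDr addrC; congr (_ + _).
    rewrite mulr_sumr; apply: eq_bigr => l _.
    by rewrite dY_asq -(spray_der_basic Th (W_basic U l)) -/(S_lc U); ring.
  rewrite exchange_big mulr_sumr; apply: eq_bigr => k _ /=.
  rewrite dX_asq /yN mulr_sumr !mulr_sumr; apply: eq_bigr => l _; ring.
rewrite (_ : \sum_l yl l * sig l = 0) ?mulr0 //.
transitivity (\sum_k y k * lower sig k); last exact: y_DyW.
by rewrite flat_sym; apply: eq_bigr => l _; exact: mulrC.
Qed.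

(** An isometric flow preserves geodesics, so the lift of W commutes with the
    geodesic spray S. The bracket Z is vertical, and it is detected by its
    action on the y_k (lowered index), because the matrix d y_k/dy^m is the
    metric; and 2 S(y_k) = d alpha^2/dx^k while alpha^2 is invariant under the
    lift of W. *)
Lemma killing_affine k : clift W (Th k) + Sb (Sb (W k)) = 0.
Proof.
pose eta l := \sum_m y m * X m (W l).
have etaE l : eta l = Sb (W l) by rewrite spray_der_basic //; exact: W_basic.
pose Z l := clift W (- Th l) - Sb (eta l).
suff hZ l : Z l = 0.
  by have := hZ k; rewrite /Z derN etaE => /eqP; rewrite -opprD oppr_eq0 => /eqP.
apply: (flat_inj (U := U) (u := Z) (v := fun=> 0)) => {}l.
rewrite [RHS]/flat [RHS]big1 => [|m _]; last exact: mulr0.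
have brk f : clift W (Sb f) - Sb (clift W f) = \sum_m Z m * Y m f.
  rewrite /clift /S_lc /spray_der act_bracket actE big1 ?add0r // => m _.
  by rewrite act_y -/(spray_der Th) -/(S_lc U) -etaE subrr mul0r.
have -> : lower Z l = \sum_m Z m * Y m (yl l).
  by apply: eq_bigr => m _; rewrite dY_ylow mulrC.
rewrite -brk; apply: double_inj; rewrite mulr0 mulrBr.
(* Both LY and LX are derivatives of the invariance of alpha^2, in the
   direction and in the position. *)
have LY j : clift W (yl j) = - \sum_m X j (W m) * yl m.
  apply: double_inj; have := congr1 (Y j) lift_W_asq.
  rewrite der0 dY_act dY_asq derM der_nat mul0r add0r [X in _ + X = _]actE.
  rewrite big1 ?add0r; last by move=> m _; rewrite /= W_basic mul0r.
  move=> /eqP; rewrite addr_eq0 => /eqP ->; rewrite mulrN mulr_sumr.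
  congr (- _); apply: eq_bigr => m _.
  rewrite dY_asq der_sum (_ : \sum_i _ = X j (W m)); first by ring.
  rewrite -[RHS](sum_deltal (fun i => X i (W m))); apply: eq_bigr => i _.
  by rewrite derM dY_yc (basic_dX i (W_basic U m)) mulr0 addr0.
have LX : clift W (X l al) = - \sum_m X l (W m) * X m al
    - 2 * \sum_m Sb (X l (W m)) * yl m.
  have := congr1 (X l) lift_W_asq; rewrite der0 dX_act [X in _ + X = _]actE => /eqP.
  rewrite addr_eq0 => /eqP ->; rewrite opprD mulr_sumr; congr (_ - _).
  apply: eq_bigr => m _; rewrite dY_asq spray_der_basic; last exact/basic_dX/W_basic.
  rewrite der_sum mulrCA; congr (_ * (_ * _)); apply: eq_bigr => i _.
  by rewrite derM dX_yc mul0r add0r dXX.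
have -> : 2 * clift W (Sb (yl l)) = clift W (X l al).
  by rewrite S_lc_ylow dX_asq derM der_nat; ring.
rewrite LX LY derN der_sum.
under [X in _ * - X]eq_bigr do rewrite derM S_lc_ylow.
rewrite big_split /=.
under eq_bigr do rewrite dX_asq.
rewrite (_ : \sum_i X l (W i) * (2 * yN U i) = 2 * \sum_i X l (W i) * yN U i).
  ring.
by rewrite mulr_sumr; apply: eq_bigr => i _; ring.
Qed.

(** W is a Jacobi field along every geodesic; this is [killing_affine]
    rewritten with covariant derivatives. *)
Lemma DyW_jacobi i : Sb (sig i) + \sum_m N i m * sig m =
  - \sum_m jacobi_end Th N i m * W m.
Proof.
have eS : Sb (sig i) = Sb (Sb (W i)) + \sum_m Sb (N i m) * W m
    + \sum_m N i m * Sb (W m).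
  rewrite /DyW derD -addrA; congr (_ + _); rewrite (der_sum Sb) -big_split /=.
  by apply: eq_bigr => m _; rewrite (derM Sb).
have eN : \sum_m N i m * sig m = \sum_m N i m * Sb (W m)
    + \sum_m N i m * \sum_p N m p * W p.
  by rewrite -big_split; apply: eq_bigr => m _; rewrite /= /DyW mulrDr.
have eR : \sum_m jacobi_end Th N i m * W m =
  \sum_m W m * X m (Th i) - \sum_m Sb (N i m) * W m
  - \sum_m N i m * (\sum_p N m p * W p).
  rewrite /jacobi_end; under eq_bigr do rewrite !mulrBl.
  rewrite !sumrB; congr (_ - _ - _); first by apply: eq_bigr => m _; rewrite mulrC.
  under eq_bigr do rewrite mulr_suml.
  rewrite exchange_big; apply: eq_bigr => m _ /=; rewrite mulr_sumr.
  by apply: eq_bigr => p _; ring.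
have eL : clift W (Th i) = \sum_m W m * X m (Th i) + 2 * \sum_m N i m * Sb (W m).
  rewrite /clift actE; congr (_ + _); rewrite mulr_sumr; apply: eq_bigr => k _.
  by rewrite -(spray_der_basic Th (W_basic U k)) dY_Th_lc -/(S_lc U); ring.
have e := killing_affine i; rewrite eL in e.
by apply/eqP; rewrite -addr_eq0 eS eN eR; apply/eqP; rewrite -[RHS]e; ring.
Qed.

End Killing.

(** * Curvature of a Kropina metric with a Killing form *)

Section KillingKropina.
Context {n : nat} {A : phase_ring n} (U : unit_form A) (ib ia : A).
Hypothesis ibK : ib * bform U = 1.
Hypothesis iaK : ia * asq U = 1.
Hypothesis killing : r00 U = 0.
Notation y := (@yc n A).
Notation X := (dX A).
Notation Y := (dY A).
Notation b := (form U).
Notation W := (W U).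
Notation N := (N_lc U).
Notation Th := (Th_lc U).
Notation Sb := (S_lc U).
Notation Gam := (Gam U).
Notation lower := (flat U).
Notation sig := (DyW U).
Notation ss := (DW U).
Notation yl := (ylow U).
Notation al := (asq U).
Notation bform := (bform U).
Notation rho := (DDW U).
Notation Rt := (curv U).
Notation ff := (halfF U ib).
Notation ThH := (Th_reg U ib).
Notation NH := (N_reg U ib).
Notation SH := (S_reg U ib).

Lemma curlW0 : curlW U = 0.
Proof.
rewrite /curlW; under eq_bigr do rewrite curl_DyW // mulrCA.
rewrite -mulr_sumr flat_sym.
rewrite (_ : \sum_k sig k * lower W k = 0) ?mulr0 //.
transitivity (\sum_k b k * sig k); last exact: b_DyW.
by apply: eq_bigr => k _; rewrite flatW mulrC.
Qed.

Lemma lam0 : lam U ib = 0.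
Proof. by rewrite /lam killing curlW0 mulr0 addr0. Qed.

Lemma Th_reg_killing i : ThH i = Th i - 2 * (ff * sig i).
Proof.
rewrite /Th_reg /reg_shift lam0 mul0r sub0r; congr (_ - _).
rewrite mulrCA; congr (_ * _).
transitivity (2 * sharp U (lower sig) i); last by rewrite flatK.
by rewrite /sharp mulr_sumr; apply: eq_bigr => k _; rewrite curl_DyW //; ring.
Qed.

Lemma N_reg_killing i k : NH i k = N i k - ff * ss i k - Y k ff * sig i.
Proof.
rewrite /N_reg Th_reg_killing derB dY_Th_lc (derM (Y k) 2) der_nat (derM (Y k) ff) dY_DyW.
by rewrite -[RHS]onehalf_double; ring.
Qed.

Lemma S_reg_killing f : SH f = Sb f + 2 * ff * \sum_m sig m * Y m f.
Proof.
rewrite /S_reg /S_lc !spray_derE -addrA; congr (_ + _).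
under eq_bigr do rewrite Th_reg_killing mulrBl.
rewrite sumrB opprB addrC; congr (_ + _); rewrite mulr_sumr.
by apply: eq_bigr => k _; ring.
Qed.

Lemma S_reg_basic c : basic c -> SH c = Sb c.
Proof.
move=> hc; rewrite S_reg_killing big1 ?mulr0 ?addr0 // => m _.
by rewrite hc mulr0.
Qed.

Lemma S_reg_halfF : SH ff = 0.
Proof.
by rewrite /halfF derM der_onehalf S_reg_kropF // lam0; ring.
Qed.

Lemma S_reg_dhalfF k : SH (Y k ff) = X k ff.
Proof.
rewrite /halfF !(derM _ (onehalf A)) !der_onehalf !mul0r !add0r.
by rewrite derM der_onehalf mul0r add0r S_reg_dYkropF.
Qed.

Lemma dX_halfF k : X k ff = \sum_m NH m k * Y m ff.
Proof.
apply: double_inj; have e := congr1 (Y k) S_reg_halfF.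
rewrite der0 /S_reg dY_spray_der -/(S_reg U ib) S_reg_dhalfF in e.
transitivity (\sum_m Y k (ThH m) * Y m ff).
  by apply/eqP; rewrite -subr_eq0 -[X in _ == X]e; apply/eqP; ring.
by rewrite mulr_sumr; apply: eq_bigr => m _; rewrite N_regE mulrA.
Qed.

(** The coefficients of H are now those of S minus 2 f times the covariant
    derivative of W along y, and f is a first integral of H with H(f_{y^k}) =
    f_{x^k}; so the derivatives of f in the position can be eliminated and the
    curvature is a polynomial in f and df. *)
Lemma jacobi_killing i k : jacobi_end ThH NH i k = jacobi_end Th N i k
  + ff * (Sb (ss i k) + \sum_m N i m * ss m k + \sum_m ss i m * N m k
          - 2 * X k (sig i) - 2 * \sum_m Gam i k m * sig m)
  + Y k ff * (Sb (sig i) + \sum_m N i m * sig m + ff * \sum_m ss i m * sig m)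
  - ff * ff * \sum_m ss i m * ss m k.
Proof.
have e1 : X k (ThH i) = X k (Th i) - 2 * (X k ff * sig i + ff * X k (sig i)).
  by rewrite Th_reg_killing derB (derM (X k) 2) der_nat (derM (X k) ff); ring.
have e2 : SH (N i k) = Sb (N i k) + 2 * ff * \sum_m Gam i k m * sig m.
  rewrite S_reg_killing; congr (_ + _ * _).
  by apply: eq_bigr => m _; rewrite dY_N mulrC.
have e3 : SH (sig i) = Sb (sig i) + 2 * ff * \sum_m ss i m * sig m.
  rewrite S_reg_killing; congr (_ + _ * _).
  by apply: eq_bigr => m _; rewrite dY_DyW mulrC.
have e4 : SH (NH i k) = Sb (N i k) + 2 * ff * \sum_m Gam i k m * sig m
   - ff * Sb (ss i k) - X k ff * sig i
   - Y k ff * (Sb (sig i) + 2 * ff * \sum_m ss i m * sig m).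
  rewrite N_reg_killing !(derB SH) (derM SH ff) (derM SH (Y k ff)) S_reg_halfF S_reg_dhalfF e2 e3.
  by rewrite (S_reg_basic (DW_basic U i k)); ring.
have e5 : \sum_m NH i m * NH m k = \sum_m N i m * N m k
   - ff * (\sum_m N i m * ss m k + \sum_m ss i m * N m k)
   + ff * ff * \sum_m ss i m * ss m k
   - Y k ff * (\sum_m N i m * sig m - ff * \sum_m ss i m * sig m)
   - sig i * X k ff.
  rewrite dX_halfF.
  have h m : NH i m * NH m k = N i m * N m k
   - ff * (N i m * ss m k + ss i m * N m k)
   + ff * ff * (ss i m * ss m k)
   - Y k ff * (N i m * sig m - ff * (ss i m * sig m))
   - sig i * (NH m k * Y m ff).
    rewrite (N_reg_killing i m) mulrBl !(N_reg_killing m k).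
    rewrite [_ * sig i]mulrC; ring.
  under eq_bigr do rewrite h.
  rewrite !mulr_sumr -?sumrN -?big_split /= !mulr_sumr -?sumrN -?big_split /=.
  by apply: eq_bigr => m _; ring.
rewrite {1}/jacobi_end e1 -/(S_reg U ib) e4 e5 /jacobi_end -/(S_lc U); ring.
Qed.

Lemma DDW_l i k : \sum_l y l * rho i l k =
  Sb (ss i k) + \sum_m N i m * ss m k - \sum_m ss i m * N m k.
Proof.
rewrite (spray_der_basic _ (DW_basic U i k)) /DDW.
under eq_bigr do rewrite mulrBr mulrDr !mulr_sumr.
rewrite sumrB big_split /=; congr (_ + _ - _).
  rewrite exchange_big; apply: eq_bigr => m _ /=; rewrite /N_lc mulr_suml.
  by apply: eq_bigr => l _; rewrite Gam_sym; ring.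
rewrite exchange_big; apply: eq_bigr => m _ /=; rewrite /N_lc mulr_sumr.
by apply: eq_bigr => l _; rewrite Gam_sym; ring.
Qed.

Lemma DDW_r i k : \sum_l y l * rho i k l =
  X k (sig i) + \sum_m Gam i k m * sig m - \sum_m ss i m * N m k.
Proof.
have -> : X k (sig i) = \sum_l y l * X k (ss i l).
  rewrite DyWE der_sum; apply: eq_bigr => l _.
  by rewrite derM dX_yc; ring.
rewrite /DDW; under eq_bigr do rewrite mulrBr mulrDr !mulr_sumr.
rewrite sumrB big_split /=; congr (_ + _ - _).
  rewrite exchange_big; apply: eq_bigr => m _ /=; rewrite DyWE mulr_sumr.
  by apply: eq_bigr => l _; ring.
rewrite exchange_big; apply: eq_bigr => m _ /=; rewrite /N_lc mulr_sumr.
by apply: eq_bigr => l _; rewrite Gam_sym; ring.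
Qed.

Lemma DDW_yy i : \sum_k \sum_l rho i k l * y k * y l =
  Sb (sig i) + \sum_m N i m * sig m.
Proof.
transitivity (\sum_k y k * \sum_l y l * rho i l k).
  rewrite exchange_big; apply: eq_bigr => k _ /=; rewrite mulr_sumr.
  by apply: eq_bigr => l _; ring.
under eq_bigr do rewrite DDW_l.
have -> : Sb (sig i) = \sum_k y k * Sb (ss i k) - \sum_k ss i k * Th k.
  rewrite DyWE (der_sum Sb) -sumrB; apply: eq_bigr => k _.
  by rewrite (derM Sb) [Sb (y k)]spray_der_y; ring.
have -> : \sum_m N i m * sig m = \sum_k y k * \sum_m N i m * ss m k.
  under [RHS]eq_bigr do rewrite mulr_sumr.
  rewrite exchange_big; apply: eq_bigr => m _ /=; rewrite DyWE mulr_sumr.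
  by apply: eq_bigr => k _; ring.
have -> : \sum_k ss i k * Th k = \sum_k y k * \sum_m ss i m * N m k.
  under [RHS]eq_bigr do rewrite mulr_sumr.
  rewrite exchange_big; apply: eq_bigr => m _ /=; rewrite /Th_lc mulr_sumr.
  by apply: eq_bigr => k _; ring.
by rewrite addrAC -sumrN -!big_split; apply: eq_bigr => k _ /=; ring.
Qed.

(** The symmetric part of a quadratic form in y with coefficients depending on
    the position is recovered by differentiating twice in y. *)
Lemma polarize2 (c d : 'I_n -> 'I_n -> A) :
  (forall k l, basic (c k l)) -> (forall k l, basic (d k l)) ->
  \sum_k \sum_l c k l * y k * y l = \sum_k \sum_l d k l * y k * y l ->
  forall k l, c k l + c l k = d k l + d l k.
Proof.
have h (c' : 'I_n -> 'I_n -> A) k l : (forall k l, basic (c' k l)) ->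
    Y l (Y k (\sum_k \sum_l c' k l * y k * y l)) = c' k l + c' l k.
  move=> hc.
  have -> : Y k (\sum_k \sum_l c' k l * y k * y l) =
     \sum_m (c' k m + c' m k) * y m.
    transitivity (\sum_i y i * (\sum_j c' i j * (k == j)%:R)
                  + \sum_i (k == i)%:R * (\sum_j c' i j * y j)).
      rewrite der_sum -big_split; apply: eq_bigr => i _ /=.
      rewrite der_sum !mulr_sumr -big_split; apply: eq_bigr => j _ /=.
      by rewrite !derM hc !dY_yc; ring.
    rewrite sum_deltal -big_split; apply: eq_bigr => m _ /=.
    under eq_bigr do rewrite eq_sym.
    by rewrite sum_deltar; ring.
  by rewrite dY_linear // => m; apply: basicD.
by move=> hc hd e k l; rewrite -h // -[RHS]h // e.
Qed.

(** The symmetric part in k and l is given by the Jacobi equation of W, and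
    the antisymmetric part by the Ricci identity; the Bianchi identity
    combines the two. *)
Lemma DDWE i k l : rho i k l = \sum_m W m * Rt i l k m.
Proof.
have e : \sum_k \sum_l rho i k l * y k * y l =
    \sum_k \sum_l (\sum_m - (Rt i k m l * W m)) * y k * y l.
  rewrite DDW_yy DyW_jacobi //.
  have -> : \sum_m jacobi_end Th N i m * W m =
      \sum_k \sum_l (\sum_m Rt i k m l * W m) * y k * y l.
    under eq_bigr do rewrite jacobi_Th_lc mulr_suml.
    rewrite exchange_big; apply: eq_bigr => p _ /=.
    under eq_bigr do rewrite mulr_suml.
    rewrite exchange_big; apply: eq_bigr => q _ /=; rewrite !mulr_suml.
    by apply: eq_bigr => m _; ring.
  rewrite -sumrN; apply: eq_bigr => p _; rewrite -sumrN; apply: eq_bigr => q _.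
  by rewrite sumrN; ring.
have hb k' l' : basic (\sum_m - (Rt i k' m l' * W m)).
  by apply: basic_sum => m; apply/basicN/basicM; [apply: curv_basic|apply: W_basic].
have e1 := polarize2 (DDW_basic U i) hb e k l.
have e2 := ricci_identity U i k l.
apply: double_inj.
have -> : 2 * rho i k l = (rho i k l + rho i l k) + (rho i k l - rho i l k) by ring.
rewrite e1 e2 -!big_split mulr_sumr; apply: eq_bigr => m _ /=.
have bi := bianchi U i m k l.
rewrite (curv_anti U i k m l).
have -> : Rt i m k l = - Rt i k l m - Rt i l m k.
  by apply/eqP; rewrite -subr_eq0 -[X in _ == X]bi; apply/eqP; ring.
rewrite (curv_anti U i l m k); ring.
Qed.

(** Derivative of the relation that the covariant derivative of W along W
    vanishes. *)
Lemma DDW_W i k : \sum_l rho i k l * W l = - \sum_m ss i m * ss m k.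
Proof.
have e : \sum_m X k (ss i m) * W m = - \sum_m ss i m * X k (W m).
  apply/eqP; rewrite -addr_eq0; apply/eqP.
  transitivity (X k (\sum_m ss i m * W m)); last by rewrite DW_W // der0.
  by rewrite -big_split der_sum; apply: eq_bigr => m _; rewrite /= derM.
rewrite /DDW; under eq_bigr do rewrite mulrBl mulrDl !mulr_suml.
rewrite sumrB big_split /= e.
have -> : \sum_l \sum_m Gam i k m * ss m l * W l = 0.
  rewrite exchange_big big1 // => m _ /=.
  under eq_bigr do rewrite -mulrA.
  by rewrite -mulr_sumr DW_W // mulr0.
rewrite addr0 -opprD; congr (- _); rewrite [X in _ + X]exchange_big -big_split.
apply: eq_bigr => m _ /=; rewrite /DW mulrDr; congr (_ + _).
by rewrite mulr_sumr; apply: eq_bigr => l _; rewrite (Gam_sym U m l k); ring.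
Qed.

(** Here f is the solution of Zermelo's navigation problem for the metric
    alpha and the wind W: alpha(y/f - W) = 1 by [znav_norm], and z = y - f W
    is the direction of the motion relative to the wind. *)
Definition znav j := y j - ff * W j.
(** The Jacobi operator of alpha in the direction z. *)
Definition Rz i m := \sum_j \sum_l Rt i j m l * znav j * znav l.

Lemma RzE i k : Rz i k = jacobi_end Th N i k
  - ff * (2 * (\sum_l y l * rho i k l) - \sum_l y l * rho i l k)
  - ff * ff * \sum_m ss i m * ss m k.
Proof.
have a1 : \sum_j \sum_l Rt i j k l * y j * W l = \sum_l y l * rho i k l.
  apply: eq_bigr => j _; rewrite DDWE mulr_sumr; apply: eq_bigr => m _; ring.
have a2 : \sum_j \sum_l Rt i j k l * W j * y l =
    \sum_l y l * rho i k l - \sum_l y l * rho i l k.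
  rewrite exchange_big -sumrB; apply: eq_bigr => l _ /=.
  rewrite -mulrBr ricci_identity mulr_sumr; apply: eq_bigr => m _; ring.
have a3 : \sum_j \sum_l Rt i j k l * W j * W l = - \sum_m ss i m * ss m k.
  rewrite -DDW_W; apply: eq_bigr => j _; rewrite DDWE mulr_suml.
  by apply: eq_bigr => m _; ring.
have -> : Rz i k = jacobi_end Th N i k - ff * (\sum_j \sum_l Rt i j k l * y j * W l
   + \sum_j \sum_l Rt i j k l * W j * y l)
   + ff * ff * \sum_j \sum_l Rt i j k l * W j * W l.
  rewrite jacobi_Th_lc -big_split /= !mulr_sumr -sumrN -!big_split.
  apply: eq_bigr => j _ /=; rewrite -big_split /= !mulr_sumr -sumrN -!big_split.
  by apply: eq_bigr => l _ /=; rewrite /znav; ring.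
rewrite a1 a2 a3; ring.
Qed.

(** The terms of [jacobi_killing] without df make up R_z by [RzE]. Contracting
    [RzE] with W shows that the coefficient of df is - R_z(W), as the
    covariant derivative of W along W vanishes and so do the terms where an
    antisymmetric pair of indices is contracted with W twice. *)
Lemma jacobi_Rz i k : jacobi_end ThH NH i k = Rz i k - Y k ff * \sum_m W m * Rz i m.
Proof.
have b1 : \sum_m W m * jacobi_end Th N i m = - (Sb (sig i) + \sum_m N i m * sig m).
  rewrite DyW_jacobi // opprK; apply: eq_bigr => m _; exact: mulrC.
have b2 : \sum_m W m * \sum_l y l * rho i m l = 0.
  transitivity (\sum_l \sum_m \sum_p y l * W m * W p * Rt i l m p).
    under eq_bigr do rewrite mulr_sumr.
    rewrite exchange_big; apply: eq_bigr => l _ /=; apply: eq_bigr => m _.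
    by rewrite DDWE [y l * _]mulr_sumr [W m * _]mulr_sumr; apply: eq_bigr => p _; ring.
  rewrite big1 // => l _; set S := \sum_m _.
  have SN : S = - S.
    rewrite {1}/S exchange_big -sumrN; apply: eq_bigr => m _ /=.
    by rewrite -sumrN; apply: eq_bigr => p _; rewrite curv_anti; ring.
  by apply: double_inj; rewrite mulr0 mulr_natl mulr2n {2}SN subrr.
have b3 : \sum_m W m * \sum_l y l * rho i l m = - \sum_m ss i m * sig m.
  transitivity (\sum_l y l * \sum_m rho i l m * W m).
    under eq_bigr do rewrite mulr_sumr.
    rewrite exchange_big; apply: eq_bigr => l _ /=; rewrite mulr_sumr.
    by apply: eq_bigr => m _; ring.
  under eq_bigr do rewrite DDW_W mulrN mulr_sumr.
  rewrite sumrN exchange_big; congr (- _); apply: eq_bigr => m _ /=.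
  by rewrite DyWE mulr_sumr; apply: eq_bigr => l _; ring.
have b4 : \sum_m W m * \sum_p ss i p * ss p m = 0.
  under eq_bigr do rewrite mulr_sumr.
  rewrite exchange_big big1 // => p _ /=.
  transitivity (ss i p * \sum_m ss p m * W m); last by rewrite DW_W // mulr0.
  by rewrite mulr_sumr; apply: eq_bigr => m _; ring.
have -> : \sum_m W m * Rz i m = \sum_m W m * jacobi_end Th N i m
   - ff * (2 * (\sum_m W m * \sum_l y l * rho i m l) - \sum_m W m * \sum_l y l * rho i l m)
   - ff * ff * \sum_m W m * \sum_p ss i p * ss p m.
  under eq_bigr do rewrite RzE.
  rewrite !mulr_sumr -sumrN -big_split /= !mulr_sumr -!sumrN -!big_split /=.
  by apply: eq_bigr => m _; ring.
rewrite b1 b2 b3 b4 jacobi_killing RzE DDW_l DDW_r; ring.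
Qed.

Lemma dY_halfF k : Y k ff = yl k * ib - ff * ib * b k.
Proof.
rewrite /halfF derM der_onehalf mul0r add0r dY_kropF // /kropF.
by rewrite -[yl k * ib in RHS]onehalf_double; ring.
Qed.

Lemma dhalfF_W : \sum_k Y k ff * W k = 1 - ff * ib.
Proof.
transitivity (ib * (\sum_k yl k * W k) - ff * ib * (\sum_k b k * W k)).
  by rewrite !mulr_sumr -sumrB; apply: eq_bigr => k _; rewrite dY_halfF; ring.
rewrite bW mulr1; congr (_ - _); rewrite -ibK; congr (_ * _).
transitivity (\sum_k W k * lower y k).
  by apply: eq_bigr => k _; rewrite mulrC.
rewrite flat_sym; apply: eq_bigr => k _; by rewrite flatW mulrC.
Qed.

(** The covector dual to z is beta df, so that df(u) is proportional to the
    scalar product of z and u. *)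
Lemma flat_znav k : lower znav k = Y k ff * bform.
Proof.
transitivity (yl k - ff * b k).
  by rewrite -flatW /ylow /flat mulr_sumr -sumrB; apply: eq_bigr => l _; rewrite /znav; ring.
rewrite dY_halfF; ring: ibK.
Qed.

Lemma znav_norm : \sum_k znav k * lower znav k = ff * ff.
Proof.
transitivity (bform * (\sum_k y k * Y k ff) - ff * bform * (\sum_k Y k ff * W k)).
  rewrite [bform * _]mulr_sumr [ff * bform * _]mulr_sumr -sumrB.
  by apply: eq_bigr => k _; rewrite flat_znav /znav; ring.
rewrite dhalfF_W -eulerE euler_halfF //; ring: ibK.
Qed.

(** By [jacobi_Rz] the curvature of F at u = W is (1 - df(W)) R_z(W), where 1
    - df(W) = f/beta is invertible; this determines R_z(W), and then R_z on
    every vector. *)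
Lemma constant_curvature (kap : A) :
  (forall i k, jacobi_end ThH NH i k = kap * (ff * ff * (i == k)%:R - ff * Y k ff * y i)) ->
  forall i k, Rz i k =
    kap * ((\sum_m znav m * lower znav m) * (i == k)%:R - lower znav k * znav i).
Proof.
move=> h i k; rewrite znav_norm flat_znav.
set q := \sum_m W m * Rz i m.
have hq : q * (ff * ib) = kap * (ff * ff * W i - ff * (1 - ff * ib) * y i).
  transitivity (\sum_k W k * jacobi_end ThH NH i k).
    transitivity (q - q * \sum_k Y k ff * W k); first by rewrite dhalfF_W; ring.
    rewrite [q * _]mulr_sumr {1}/q -sumrB; apply: eq_bigr => m _.
    by rewrite jacobi_Rz -/q; ring.
  rewrite -dhalfF_W.
  transitivity (kap * ff * ff * (\sum_k W k * (k == i)%:R) -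
     kap * ff * y i * (\sum_k Y k ff * W k)).
    rewrite [X in _ = X - _]mulr_sumr [X in _ = _ - X]mulr_sumr -sumrB.
    by apply: eq_bigr => m _; rewrite h eq_sym; ring.
  by rewrite sum_deltar; ring.
have hq' : q = kap * (ff * bform * W i - (bform - ff) * y i).
  have e1 : ff * ib * (2 * bform * bform * ia) = 1.
    transitivity (ia * al); last by [].
    by rewrite -(halfF_bform ibK); ring: ibK.
  rewrite -[LHS]mulr1 -e1 mulrA hq.
  transitivity (kap * (ff * bform * W i - (1 - ff * ib) * bform * y i)
     * (ff * ib * (2 * bform * bform * ia))).
    ring: ibK.
  by rewrite e1 mulr1; ring: ibK.
have -> : Rz i k = jacobi_end ThH NH i k + Y k ff * q by rewrite jacobi_Rz -/q; ring.
rewrite hq' h /znav; ring.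
Qed.

End KillingKropina.

(** * The gradient of a conformal factor *)

Section Conformal.
Context {n : nat} {A : phase_ring n} (U : unit_form A).
Hypothesis killing : r00 U = 0.
Variables (V : 'I_n -> A) (c : A).
Hypotheses (Vb : forall k, basic (V k)) (cb : basic c).
Notation y := (@yc n A).
Notation X := (dX A).
Notation Y := (dY A).
Notation W := (W U).
Hypothesis Val : clift V (asq U) = 4 * c * asq U.
Hypothesis Vbeta : clift V (bform U) = 2 * c * bform U.

Let Z k := \sum_m (V m * X m (W k) - W m * X m (V k)).

Lemma dW_asq : \sum_k W k * Y k (asq U) = 2 * bform U.
Proof.
under eq_bigr do rewrite dY_asq mulrCA.
rewrite -mulr_sumr flat_sym /bform; congr (_ * _); apply: eq_bigr => k _.
by rewrite flatW mulrC.
Qed.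

(** Here the field [V, W] is Z. The bracket of the complete lift of V with the
    vertical lift of W is the vertical lift of [V, W]; applied to alpha^2, it
    gives 2 <[V, W], y> = V^c(2 beta) - W^v(4 c alpha^2) = - 4 c beta. *)
Lemma bracket_W k : Z k = - (2 * c) * W k.
Proof.
have e : \sum_k Z k * Y k (asq U) = - (4 * c * bform U).
  have dWE f : act (fun=> 0) W f = \sum_k W k * Y k f.
    by rewrite actE big1 ?add0r // => m _; rewrite mul0r.
  have h := act_bracket V (fun l => \sum_m y m * X m (V l)) (fun=> 0) W (asq U).
  rewrite -/(clift V) !dWE dW_asq Val [in RHS]actE in h.
  rewrite [X in _ = X + _]big1 ?add0r in h; last first.
    move=> m _; rewrite der0 sub0r dWE big1 ?oppr0 ?mul0r // => p _.
    by rewrite Vb mulr0.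
  have e1 : clift V (2 * bform U) = 4 * c * bform U.
    by rewrite derM der_nat Vbeta; ring.
  have e2 : \sum_k0 W k0 * Y k0 (4 * c * asq U) = 8 * c * bform U.
    transitivity (4 * c * \sum_k W k * Y k (asq U)); last by rewrite dW_asq; ring.
    rewrite mulr_sumr; apply: eq_bigr => m _.
    rewrite (derM (Y m) (4 * c)) (derM (Y m) 4) der_nat cb; ring.
  rewrite e1 e2 in h.
  transitivity (4 * c * bform U - 8 * c * bform U); last by ring.
  rewrite h; apply: eq_bigr => m _; congr (_ * _).
  rewrite dWE /clift actE [X in _ = _ + X - _]big1 ?addr0; last first.
    by move=> p _; rewrite W_basic mulr0.
  rewrite /Z sumrB; congr (_ - _); apply: eq_bigr => p _; congr (_ * _).
  rewrite der_sum -[LHS](sum_deltal (fun i => X i (V m))); apply: eq_bigr => q _.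
  by rewrite derM dY_yc (basic_dX q (Vb m)) mulr0 addr0.
have Zb m : basic (Z m).
  apply: basic_sum => p; apply: basicD; [|apply: basicN]; apply: basicM => //.
  - exact/basic_dX/W_basic.
  - exact: W_basic.
  - exact: basic_dX.
apply: (flat_inj (U := U) (u := Z) (v := fun m => - (2 * c) * W m)) => {}k.
have -> : flat U (fun m => - (2 * c) * W m) k = - (2 * c) * form U k.
  by rewrite -flatW /flat mulr_sumr; apply: eq_bigr => m _; ring.
have e' : \sum_k flat U Z k * y k = \sum_k (- (2 * c) * form U k) * y k.
  apply: double_inj; transitivity (\sum_k Z k * Y k (asq U)).
    transitivity (2 * \sum_k y k * flat U Z k).
      by congr (_ * _); apply: eq_bigr => m _; exact: mulrC.
    by rewrite flat_sym mulr_sumr; apply: eq_bigr => m _; rewrite dY_asq /ylow; ring.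
  by rewrite e /bform mulr_sumr -sumrN mulr_sumr; apply: eq_bigr => m _; ring.
have := congr1 (Y k) e'; rewrite !dY_linear // => l.
- apply: basicM; last exact: form_basic.
  by apply: basicN; apply: basicM => // m; apply: der_nat.
- by apply: basic_sum => m; apply: basicM; [apply: metric_basic|].
Qed.

(** The complete lift of [V, W] = - 2 c W is - 2 c W^c - 2 dc(y) W^v. Applied
    to alpha^2 it is - 4 dc(y) beta, while the bracket of the lifts of V and W
    gives - 4 W(c) alpha^2. *)
Lemma conformal_gradient :
  (\sum_k W k * X k c) * asq U = (\sum_k y k * X k c) * bform U.
Proof.
pose del f := \sum_m y m * X m f.
have delE (f : 'I_n -> A) : (fun l => \sum_m y m * X m (f l)) = (fun l => del (f l)) by [].
have h := act_bracket V (fun l => del (V l)) W (fun l => del (W l)) (asq U).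
rewrite -!/(clift _) in h.
have hW := lift_W_asq killing; rewrite /clift delE in hW.
have hV := Val; rewrite /clift delE in hV.
rewrite hW der0 hV (derM _ (4 * c)) hW (derM _ 4) der_nat in h.
have Wc : act W (fun l => del (W l)) c = \sum_k W k * X k c.
  by rewrite actE [X in _ + X]big1 ?addr0 // => k _; rewrite cb mulr0.
rewrite Wc actE in h.
have c1 k : act V (fun l => del (V l)) (W k) - act W (fun l => del (W l)) (V k)
   = - (2 * c) * W k.
  rewrite -bracket_W !actE [X in _ + X - _]big1 ?addr0; last first.
    by move=> p _; rewrite W_basic mulr0.
  rewrite [X in _ - (_ + X)]big1 ?addr0; last by move=> p _; rewrite Vb mulr0.
  by rewrite -sumrB.
have c2 k : act V (fun l => del (V l)) (del (W k)) - act W (fun l => del (W l)) (del (V k))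
   = - (2 * c) * del (W k) - 2 * del c * W k.
  (* The complete lift of P applied to the derivative of Q' along y. *)
  have lif P Q' : (forall m, basic (P m)) -> basic Q' ->
     act P (fun l => del (P l)) (del Q') =
       \sum_p y p * (\sum_m (P m * X p (X m Q') + X p (P m) * X m Q')).
    move=> hP hQ; rewrite act_sum.
    under [RHS]eq_bigr do rewrite mulr_sumr.
    rewrite exchange_big; apply: eq_bigr => m _ /=.
    have -> : Y m (del Q') = X m Q'.
      rewrite -[RHS](dY_linear (c := fun p => X p Q') m); last by move=> p; apply: basic_dX.
      by congr (Y m _); apply: eq_bigr => p _; exact: mulrC.
    rewrite {2}/del mulr_suml /del der_sum mulr_sumr -big_split.
    apply: eq_bigr => p _ /=; rewrite derM dX_yc (dXX m p); ring.
  rewrite !lif //; last exact: W_basic; last exact: W_basic.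
  transitivity (del (Z k)).
    rewrite /del -sumrB; apply: eq_bigr => p _; rewrite /Z der_sum -mulrBr -sumrB.
    by congr (_ * _); apply: eq_bigr => m _; rewrite derB !derM; ring.
  rewrite bracket_W.
  transitivity (\sum_m (- (2 * c) * (y m * X m (W k)) - 2 * W k * (y m * X m c))).
    apply: eq_bigr => m _.
    by rewrite (derM (X m) (- (2 * c))) derN (derM (X m) 2) der_nat; ring.
  by rewrite sumrB -mulr_sumr -mulr_sumr /del; ring.
have e : \sum_k - (2 * c) * W k * X k (asq U) +
   \sum_k (- (2 * c) * del (W k) - 2 * del c * W k) * Y k (asq U) =
   - (4 * del c * bform U).
  transitivity (- (2 * c) * act W (fun l => del (W l)) (asq U)
     - 2 * del c * \sum_k W k * Y k (asq U)).
    rewrite actE mulrDr -addrA [- (2 * c) * \sum_k W k * _]mulr_sumr.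
    rewrite [- (2 * c) * _]mulr_sumr [2 * del c * _]mulr_sumr -sumrB.
    by congr (_ + _); apply: eq_bigr => m _; ring.
  by rewrite hW dW_asq; ring.
have h' : - (4 * ((\sum_k W k * X k c) * asq U)) = - (4 * del c * bform U).
  rewrite -e; transitivity (0 - ((0 * c + 4 * \sum_k W k * X k c) * asq U + 4 * c * 0)); first by ring.
  rewrite h; congr (_ + _); apply: eq_bigr => m _; first by rewrite c1.
  by rewrite c2.
apply/double_inj/double_inj; apply: oppr_inj.
transitivity (- (4 * ((\sum_k W k * X k c) * asq U))); first by ring.
by rewrite h' /del; ring.
Qed.

End Conformal.

(** * Lie derivatives of the metric and of the form *)

Section LiftForms.
Context {n : nat} {A : phase_ring n} (U : unit_form A).
Variable V : 'I_n -> A.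
Hypothesis Vb : forall k, basic (V k).
Notation y := (@yc n A).
Notation X := (dX A).
Notation g := (metric U).
Notation b := (form U).
Notation W := (W U).

(** Not symmetrized: only the quadratic form that it defines matters, see
    [clift_asq]. *)
Definition lie_g k l := \sum_m V m * X m (g k l) + 2 * \sum_j X k (V j) * g j l.
Definition lie_b k := \sum_m V m * X m (b k) + \sum_j X k (V j) * b j.

Lemma clift_asq : clift V (asq U) = \sum_k \sum_l lie_g k l * y k * y l.
Proof.
rewrite /clift actE.
have e1 m : X m (asq U) = \sum_k \sum_l X m (g k l) * y k * y l.
  rewrite der_sum; apply: eq_bigr => k _; rewrite der_sum; apply: eq_bigr => l _.
  by rewrite !derM !dX_yc; ring.
transitivity (\sum_k \sum_l ((\sum_m V m * X m (g k l)) * y k * y l) +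
   \sum_k \sum_l (2 * \sum_j X k (V j) * g j l) * y k * y l); last first.
  rewrite -big_split; apply: eq_bigr => k _ /=; rewrite -big_split.
  by apply: eq_bigr => l _ /=; rewrite /lie_g; ring.
congr (_ + _).
  under eq_bigr do rewrite e1 mulr_sumr.
  rewrite exchange_big; apply: eq_bigr => k _ /=.
  under eq_bigr do rewrite mulr_sumr.
  rewrite exchange_big; apply: eq_bigr => l _ /=; rewrite !mulr_suml.
  by apply: eq_bigr => m _; ring.
under eq_bigr do rewrite dY_asq mulr_suml.
rewrite exchange_big; apply: eq_bigr => k _ /=.
transitivity (\sum_j \sum_l 2 * (X k (V j) * g j l) * y k * y l).
  apply: eq_bigr => j _; rewrite /ylow /flat [2 * _]mulr_sumr mulr_sumr.
  by apply: eq_bigr => l _; ring.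
rewrite exchange_big; apply: eq_bigr => l _ /=.
by rewrite mulr_sumr !mulr_suml.
Qed.

Lemma clift_bform : clift V (bform U) = \sum_k lie_b k * y k.
Proof.
rewrite /clift actE.
transitivity (\sum_k (\sum_m V m * X m (b k)) * y k + \sum_k (\sum_j X k (V j) * b j) * y k);
  last by rewrite -big_split; apply: eq_bigr => k _; rewrite /lie_b mulrDl.
congr (_ + _).
  have e1 m : X m (bform U) = \sum_k X m (b k) * y k.
    by rewrite der_sum; apply: eq_bigr => k _; rewrite derM dX_yc; ring.
  under eq_bigr do rewrite e1 mulr_sumr.
  rewrite exchange_big; apply: eq_bigr => k _ /=; rewrite mulr_suml.
  by apply: eq_bigr => m _; ring.
under eq_bigr do rewrite dY_bform mulr_suml.
rewrite exchange_big; apply: eq_bigr => k _ /=; rewrite mulr_suml.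
by apply: eq_bigr => m _; ring.
Qed.

(** The derivative of |b| = 1 along V: for a conformal change of the metric by
    mu and of the form by nu, it gives mu = 2 nu. *)
Lemma lie_unit : \sum_k \sum_l lie_g k l * W k * W l = 2 * \sum_k lie_b k * W k.
Proof.
pose d := act V (fun=> 0).
have dE c : d c = \sum_m V m * X m c.
  by rewrite actE [X in _ + X]big1 ?addr0 // => m _; rewrite mul0r.
have gW : \sum_k \sum_l g k l * W k * W l = 1.
  rewrite -(bW U); apply: eq_bigr => k _; rewrite -flatW mulr_suml.
  by apply: eq_bigr => l _; ring.
have bdW : \sum_k \sum_l g k l * d (W k) * W l = \sum_k b k * d (W k).
  apply: eq_bigr => k _; rewrite -flatW mulr_suml.
  by apply: eq_bigr => l _; ring.
have bdW' : \sum_k \sum_l g k l * W k * d (W l) = \sum_k b k * d (W k).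
  rewrite exchange_big -bdW; apply: eq_bigr => k _; apply: eq_bigr => l _ /=.
  by rewrite (metric_sym U l k); ring.
have e1 : \sum_k \sum_l d (g k l) * W k * W l = - (2 * \sum_k b k * d (W k)).
  have := congr1 d gW; rewrite der1 der_sum.
  under eq_bigr do rewrite der_sum.
  under eq_bigr do under eq_bigr do rewrite !(derM d).
  have -> : \sum_i \sum_i0 ((d (g i i0) * W i + g i i0 * d (W i)) * W i0 + g i i0 * W i * d (W i0))
     = \sum_k \sum_l d (g k l) * W k * W l + \sum_k \sum_l g k l * d (W k) * W l
       + \sum_k \sum_l g k l * W k * d (W l).
    rewrite -!big_split; apply: eq_bigr => k _ /=; rewrite -!big_split.
    by apply: eq_bigr => l _ /=; ring.
  rewrite bdW bdW' => /eqP; rewrite -addrA addr_eq0 => /eqP ->.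
  ring.
have e2 : \sum_k d (b k) * W k = - \sum_k b k * d (W k).
  have := congr1 d (bW U); rewrite der1 der_sum.
  under eq_bigr do rewrite (derM d).
  by rewrite big_split => /eqP; rewrite addr_eq0 => /eqP.
have -> : \sum_k \sum_l lie_g k l * W k * W l = \sum_k \sum_l d (g k l) * W k * W l
    + 2 * \sum_k \sum_j X k (V j) * b j * W k.
  rewrite mulr_sumr -big_split; apply: eq_bigr => k _ /=.
  have e3 : \sum_j X k (V j) * b j * W k = \sum_l (\sum_j X k (V j) * g j l) * W k * W l.
    under [RHS]eq_bigr do rewrite !mulr_suml.
    rewrite exchange_big; apply: eq_bigr => j _ /=; rewrite -flatW /flat.
    by rewrite mulr_sumr mulr_suml; apply: eq_bigr => l _; ring.
  rewrite e3 mulr_sumr -big_split; apply: eq_bigr => l _ /=.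
  by rewrite /lie_g dE; ring.
have -> : \sum_k lie_b k * W k = \sum_k d (b k) * W k + \sum_k \sum_j X k (V j) * b j * W k.
  rewrite -big_split; apply: eq_bigr => k _ /=.
  by rewrite /lie_b dE mulrDl [X in _ + X = _]mulr_suml.
rewrite e1 e2; ring.
Qed.
End LiftForms.

(** * Smooth functions of several variables *)

Section Partial.
Context {R : realType} {n : nat}.
Implicit Types (A : set 'rV[R]_n) (f g : 'rV[R]_n -> R) (x : 'rV[R]_n) (k : 'I_n).

(** Differentiability along a coordinate axis, which is what [Cr] provides at
    each point. *)
Definition pderivable k f x := derivable f x (delta_mx 0 k).

Lemma pderivable_near k f g x :
  (\forall z \near x, f z = g z) -> pderivable k f x -> pderivable k g x.
Proof. exact: near_eq_derivable. Qed.

Lemma partial_near k f g x :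
  (\forall z \near x, f z = g z) -> partial k f x = partial k g x.
Proof. exact: near_eq_derive. Qed.

Lemma partialD k f g x : pderivable k f x -> pderivable k g x ->
  partial k (fun z => f z + g z) x = partial k f x + partial k g x.
Proof. exact: deriveD. Qed.

Lemma partialM k f g x : pderivable k f x -> pderivable k g x ->
  partial k (fun z => f z * g z) x = partial k f x * g x + f x * partial k g x.
Proof.
move=> hf hg; rewrite /partial (deriveM hf hg) addrC; congr (_ + _).
exact: mulrC.
Qed.

Lemma partialV k f x : f x != 0 -> pderivable k f x ->
  partial k (fun z => (f z)^-1) x = - ((f x)^-1 * (f x)^-1 * partial k f x).
Proof. by move=> h hf; rewrite /partial (deriveV h hf) expr2 invfM scaleNr. Qed.

Lemma partial_cst k (c : R) x : partial k (fun=> c) x = 0.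
Proof. exact: derive_cst. Qed.

Lemma is_derive_entry k l x :
  is_derive x (delta_mx 0 k) (fun z : 'rV[R]_n => z 0 l) (l == k)%:R.
Proof.
have h : (fun h : R => h^-1 *: (((fun z : 'rV[R]_n => z 0 l) \o shift x) (h *: delta_mx 0 k)
   - x 0 l)) @ 0^' --> ((l == k)%:R : R).
  apply: (@cvg_trans _ ((fun=> (l == k)%:R : R) @ (0 : R)^')); last exact: cvg_cst.
  apply: near_eq_cvg; near=> h => /=.
  rewrite !mxE eqxx /= addrK -[_ *: _]/(_ * _) mulrA mulVf ?mul1r //.
  by near: h; exact: nbhs_dnbhs_neq.
apply: DeriveDef; last exact: cvg_lim h.
by apply/cvg_ex; exists (l == k)%:R.
Unshelve. all: by end_near. Qed.

Lemma partial_entry k l x : partial k (fun z : 'rV[R]_n => z 0 l) x = (l == k)%:R.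
Proof. by rewrite /partial; have [_ ->] := is_derive_entry k l x. Qed.

Lemma pderivable_entry k l x : pderivable k (fun z : 'rV[R]_n => z 0 l) x.
Proof. by have [] := is_derive_entry k l x. Qed.

Lemma open_near A f g x : open A -> A x -> (forall z, A z -> f z = g z) ->
  \forall z \near x, f z = g z.
Proof. by move=> oA Ax fg; apply: filterS fg _; apply: open_nbhs_nbhs. Qed.

Lemma for_continuous_near f g x : (\forall z \near x, f z = g z) ->
  {for x, continuous f} -> {for x, continuous g}.
Proof.
move=> fg cf; have e : f x = g x by exact: nbhs_singleton fg.
have h : f z @[z --> x] --> g x by rewrite -e; exact: cf.
by apply: cvg_trans h; exact: (near_eq_cvg fg).
Qed.

Lemma Cr_ext r A f g : open A -> (forall z, A z -> f z = g z) ->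
  Cr r A f -> Cr r A g.
Proof.
move=> oA; elim: r f g => [|r IH] f g fg [cf hf]; split.
- by move=> x Ax; apply: for_continuous_near (open_near oA Ax fg) (cf x Ax).
- by [].
- by move=> x Ax; apply: for_continuous_near (open_near oA Ax fg) (cf x Ax).
- move=> k; have [df pf] := hf k; split.
    by move=> x Ax; apply: pderivable_near (df x Ax); apply: open_near Ax fg.
  by apply: IH pf => z Az; apply: partial_near; apply: open_near Az fg.
Qed.

Lemma Cr_sub r A B f : B `<=` A -> Cr r A f -> Cr r B f.
Proof.
move=> BA; elim: r f => [|r IH] f [cf hf]; split => //.
- by move=> x /BA; apply: cf.
- by move=> x /BA; apply: cf.
by move=> k; have [df pf] := hf k; split=> [x /BA|]; [exact: df|exact: IH].
Qed.

Lemma CrW r A f : Cr r.+1 A f -> Cr r A f.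
Proof.
elim: r f => [|r IH] f [cf hf]; split => // k.
by have [df pf] := hf k; split => //; exact: IH.
Qed.

Lemma Cr_cst r A (c : R) : Cr r A (fun=> c).
Proof.
elim: r c => [|r IH] c; split => //; try by move=> x _; exact: cst_continuous.
move=> k; split; first by move=> x _; exact: (derivable_cst c x).
by rewrite (_ : partial k _ = fun=> 0) //; apply/funext => x; apply: partial_cst.
Qed.

Lemma CrD r A f g : open A -> Cr r A f -> Cr r A g -> Cr r A (fun z => f z + g z).
Proof.
move=> oA; elim: r f g => [|r IH] f g [cf hf] [cg hg]; split => //.
- by move=> x Ax; apply: continuousD; [exact: cf|exact: cg].
- by move=> x Ax; apply: continuousD; [exact: cf|exact: cg].
move=> k; have [df pf] := hf k; have [dg pg] := hg k; split.
  by move=> x Ax; apply: derivableD; [exact: df|exact: dg].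
apply: Cr_ext (IH _ _ pf pg) => // z Az.
by rewrite partialD //; [exact: df|exact: dg].
Qed.

(** By induction on the order, the derivative of a product of functions of
    class r.+1 being a sum of products of functions of class r. *)
Lemma CrM r A f g : open A -> Cr r A f -> Cr r A g -> Cr r A (fun z => f z * g z).
Proof.
move=> oA; elim: r f g => [|r IH] f g hf0 hg0; have [cf hf] := hf0; have [cg hg] := hg0;
  split => //.
- by move=> x Ax; apply: continuousM; [exact: cf|exact: cg].
- by move=> x Ax; apply: continuousM; [exact: cf|exact: cg].
move=> k; have [df pf] := hf k; have [dg pg] := hg k; split.
  by move=> x Ax; apply: derivableM; [exact: df|exact: dg].
apply: Cr_ext (CrD oA (IH _ _ pf (CrW hg0)) (IH _ _ (CrW hf0) pg)) => // z Az.
by rewrite partialM //; [exact: df|exact: dg].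
Qed.

Lemma CrV r A f : open A -> (forall z, A z -> f z != 0) -> Cr r A f ->
  Cr r A (fun z => (f z)^-1).
Proof.
move=> oA f0; elim: r => [|r IH] hf0; have [cf hf] := hf0; split => //.
- by move=> x Ax; apply: continuousV; [exact: f0|exact: cf].
- by move=> x Ax; apply: continuousV; [exact: f0|exact: cf].
move=> k; have [df pf] := hf k; split.
  by move=> x Ax; apply: derivableV; [exact: f0|exact: df].
have iv := IH (CrW hf0).
apply: Cr_ext (CrM oA (Cr_cst r A (-1)) (CrM oA (CrM oA iv iv) pf)) => // z Az.
by rewrite partialV ?mulN1r //; [exact: f0|exact: df].
Qed.

Lemma smooth_ext A f g : open A -> (forall z, A z -> f z = g z) ->
  smooth A f -> smooth A g.
Proof. by move=> oA fg hf r; apply: Cr_ext fg (hf r). Qed.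
Lemma smooth_sub A B f : B `<=` A -> smooth A f -> smooth B f.
Proof. by move=> BA hf r; apply: Cr_sub BA (hf r). Qed.
Lemma smooth_cst A (c : R) : smooth A (fun=> c).
Proof. by move=> r; apply: Cr_cst. Qed.
Lemma smoothD A f g : open A -> smooth A f -> smooth A g -> smooth A (fun z => f z + g z).
Proof. by move=> oA hf hg r; apply: CrD. Qed.
Lemma smoothM A f g : open A -> smooth A f -> smooth A g -> smooth A (fun z => f z * g z).
Proof. by move=> oA hf hg r; apply: CrM. Qed.
Lemma smoothV A f : open A -> (forall z, A z -> f z != 0) -> smooth A f ->
  smooth A (fun z => (f z)^-1).
Proof. by move=> oA f0 hf r; apply: CrV. Qed.
Lemma smooth_sum (I : Type) (s : seq I) (P : pred I) A (F : I -> 'rV[R]_n -> R) : open A ->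
  (forall i, smooth A (F i)) -> smooth A (fun z => \sum_(i <- s | P i) F i z).
Proof.
move=> oA hF; elim: s => [|i s IH].
  by rewrite (_ : (fun z => _) = fun=> 0) ?funeqE => [|z]; [exact: smooth_cst|rewrite big_nil].
case: (boolP (P i)) => Pi.
  apply: smooth_ext (smoothD oA (hF i) IH) => // z _; by rewrite big_cons Pi.
by apply: smooth_ext IH => // z _; rewrite big_cons (negbTE Pi).
Qed.
Lemma smooth_prod (I : Type) (s : seq I) (P : pred I) A (F : I -> 'rV[R]_n -> R) : open A ->
  (forall i, smooth A (F i)) -> smooth A (fun z => \prod_(i <- s | P i) F i z).
Proof.
move=> oA hF; elim: s => [|i s IH].
  by rewrite (_ : (fun z => _) = fun=> 1) ?funeqE => [|z]; [exact: smooth_cst|rewrite big_nil].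
case: (boolP (P i)) => Pi.
  apply: smooth_ext (smoothM oA (hF i) IH) => // z _; by rewrite big_cons Pi.
by apply: smooth_ext IH => // z _; rewrite big_cons (negbTE Pi).
Qed.
Lemma smooth_partial A k f : smooth A f -> smooth A (partial k f).
Proof. by move=> hf r; have [_ /(_ k)[]] := hf r.+1. Qed.
Lemma smooth_continuous A f x : smooth A f -> A x -> {for x, continuous f}.
Proof. by move=> hf; have [cf _] := hf 0; apply: cf. Qed.
Lemma smooth_pderivable A k f x : smooth A f -> A x -> pderivable k f x.
Proof. by move=> hf Ax; have [_ /(_ k)[df _]] := hf 1; apply: df. Qed.

Lemma is_derive_line f x k t : pderivable k f (x + t *: delta_mx 0 k) ->
  is_derive t 1 (fun s : R => f (x + s *: delta_mx 0 k)) (partial k f (x + t *: delta_mx 0 k)).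
Proof.
move=> hf.
have e : (fun h : R => h^-1 *: (((fun s : R => f (x + s *: delta_mx 0 k)) \o shift t) (h *: 1)
   - f (x + t *: delta_mx 0 k))) = (fun h : R => h^-1 *: ((f \o shift (x + t *: delta_mx 0 k)) (h *: delta_mx 0 k)
   - f (x + t *: delta_mx 0 k))).
  apply/funext => h /=; congr (_ *: (f _ - _)).
  by rewrite [h%:A]mulr1 scalerDl addrCA.
by apply: DeriveDef; rewrite /derivable /derive e.
Qed.

(** The bounds on the intermediate point are not strict, so that the case h =
    0 is included. *)
Lemma MVT_line f x k (h : R) : 0 <= h ->
  (forall s, 0 <= s <= h -> pderivable k f (x + s *: delta_mx 0 k)) ->
  exists2 s, 0 <= s <= h &
    f (x + h *: delta_mx 0 k) - f x = partial k f (x + s *: delta_mx 0 k) * h.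
Proof.
move=> h0 df.
have D s : 0 <= s <= h -> is_derive s 1 (fun s : R => f (x + s *: delta_mx 0 k))
    (partial k f (x + s *: delta_mx 0 k)) by move=> hs; apply/is_derive_line/df.
have [||s sh e] := @MVT_segment R (fun s : R => f (x + s *: delta_mx 0 k))
   (fun s => partial k f (x + s *: delta_mx 0 k)) 0 h h0.
- by move=> s; rewrite in_itv /= => /andP[s0 s1]; apply: D; rewrite !ltW.
- apply: continuous_in_subspaceT => s; rewrite inE /= in_itv /= => /D [ds _].
  by apply: differentiable_continuous; apply/derivable1_diffP; exact: ds.
exists s; first by move: sh; rewrite in_itv.
by move: e; rewrite scale0r addr0 subr0.
Qed.

Lemma quotient_shift k f w x :
  (fun h : R => h^-1 *: (((fun z => f (z + w)) \o shift x) (h *: delta_mx 0 k) - f (x + w)))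
  = (fun h : R => h^-1 *: ((f \o shift (x + w)) (h *: delta_mx 0 k) - f (x + w))).
Proof. by apply/funext => h /=; rewrite addrA. Qed.

Lemma partial_shift k f w x : partial k (fun z => f (z + w)) x = partial k f (x + w).
Proof. by rewrite /partial /derive quotient_shift. Qed.

Lemma pderivable_shift k f w x :
  pderivable k f (x + w) -> pderivable k (fun z => f (z + w)) x.
Proof. by rewrite /pderivable /derivable quotient_shift. Qed.

(** Two applications of the mean value theorem, in the k-th and then the l-th
    variable; the expression on the left is symmetric in k and l. *)
Lemma second_difference A f x k l (h : R) : smooth A f -> 0 <= h ->
  (forall s t, 0 <= s <= h -> 0 <= t <= h ->
     A (x + s *: delta_mx 0 k + t *: delta_mx 0 l)) ->
  exists s t, [/\ 0 <= s <= h, 0 <= t <= h &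
    f (x + h *: delta_mx 0 k + h *: delta_mx 0 l) - f (x + h *: delta_mx 0 k)
    - (f (x + h *: delta_mx 0 l) - f x) =
    partial l (partial k f) (x + s *: delta_mx 0 k + t *: delta_mx 0 l) * h * h].
Proof.
move=> hf h0 hA; set w := h *: delta_mx 0 l.
have hh : 0 <= h <= h by rewrite h0 lexx.
have h00 : 0 <= (0 : R) <= h by rewrite h0 lexx.
have [s sh e] : exists2 s, 0 <= s <= h &
   (f (x + h *: delta_mx 0 k + w) - f (x + h *: delta_mx 0 k)) - (f (x + w) - f x) =
   partial k (fun z => f (z + w) - f z) (x + s *: delta_mx 0 k) * h.
  apply: (@MVT_line (fun z => f (z + w) - f z)) => // s sh.
  apply: derivableB.
    by apply: pderivable_shift; apply: smooth_pderivable hf _; apply: hA.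
  by apply: smooth_pderivable hf _; have := hA s 0 sh h00; rewrite scale0r addr0.
have [t th e'] : exists2 t, 0 <= t <= h &
   partial k f (x + s *: delta_mx 0 k + w) - partial k f (x + s *: delta_mx 0 k) =
   partial l (partial k f) (x + s *: delta_mx 0 k + t *: delta_mx 0 l) * h.
  apply: MVT_line => // t th; apply: smooth_pderivable (smooth_partial k hf) _.
  exact: hA.
exists s, t; split => //; rewrite e -e'; congr (_ * _).
rewrite -(partial_shift k f w) /partial deriveB //.
  by apply: pderivable_shift; apply: smooth_pderivable hf _; apply: hA.
by apply: smooth_pderivable hf _; have := hA s 0 sh h00; rewrite scale0r addr0.
Qed.

(** Schwarz's theorem. Both mixed derivatives are approximated by the same
    second difference, divided by h^2. *)
Lemma partialC A f x k l : open A -> A x -> smooth A f ->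
  partial l (partial k f) x = partial k (partial l f) x.
Proof.
move=> oA Ax hf.
have c1 := smooth_continuous (smooth_partial l (smooth_partial k hf)) Ax.
have c2 := smooth_continuous (smooth_partial k (smooth_partial l hf)) Ax.
apply/eqP; rewrite -subr_eq0 -normr_eq0; apply/eqP/le_anti/andP; split => //.
apply/ler_addgt0Pl => _/posnumP[e]; rewrite addr0.
have e2 : 0 < e%:num / 2 :> R by [].
set p := partial l (partial k f); set q := partial k (partial l f).
have [d /= d0 hd] : exists2 d : R, 0 < d & forall z, `|x - z| < d ->
    [/\ A z, `|p x - p z| < e%:num / 2 & `|q x - q z| < e%:num / 2].
  have h0 : nbhs x A by exact: open_nbhs_nbhs.
  move/cvgrPdist_lt : c1 => /(_ _ e2) h1.
  move/cvgrPdist_lt : c2 => /(_ _ e2) h2.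
  have h3 : \forall z \near x, (A `&` ([set z | `|p x - p z| < e%:num / 2]
      `&` [set z | `|q x - q z| < e%:num / 2])) z.
    apply: filterI; first exact: h0.
    apply: filterI; first exact: h1.
    exact: h2.
  move/nbhs_normP: h3 => [d /= d0 hd].
  clear h0 h1 h2; exists d; first exact: d0.
  move=> z xz; have [a [b c]] := hd z xz; split; [exact: a|exact: b|exact: c].
(* The choice of h keeps the square of side h at x in the ball of radius d. *)
pose C := `|delta_mx 0 k : 'rV[R]_n| + `|delta_mx 0 l : 'rV[R]_n| + 1.
have C0 : 0 < C by rewrite ltr_wpDl // addr_ge0.
pose h := d / (2 * C).
have h0 : 0 < h by rewrite divr_gt0 // mulr_gt0.
have hC : h * C < d.
  by rewrite /h invfM mulrA mulfVK ?gt_eqF // ltr_pdivrMr // ltr_pMr // ltr1n.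
have hz s t : 0 <= s <= h -> 0 <= t <= h ->
    `|x - (x + s *: delta_mx 0 k + t *: delta_mx 0 l)| < d.
  move=> /andP[s0 s1] /andP[t0 t1]; apply: le_lt_trans hC.
  rewrite -addrA opprD addNKr normrN; apply: le_trans (ler_normD _ _) _.
  rewrite !normrZ (ger0_norm s0) (ger0_norm t0) /C mulrDr mulrDr mulr1.
  apply: (@le_trans _ _ (h * `|delta_mx 0 k : 'rV[R]_n| + h * `|delta_mx 0 l : 'rV[R]_n|)).
    by apply: lerD; apply: ler_wpM2r.
  by rewrite lerDl; exact: ltW.
have h0' := ltW h0.
have hA0 s t : 0 <= s <= h -> 0 <= t <= h ->
    A (x + s *: delta_mx 0 k + t *: delta_mx 0 l).
  by move=> hs ht; case: (hd _ (hz s t hs ht)).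
have [s [t [sh th e1]]] := second_difference hf h0' hA0.
rewrite -/p in e1.
have hA' s' t' : 0 <= s' <= h -> 0 <= t' <= h ->
    A (x + s' *: delta_mx 0 l + t' *: delta_mx 0 k).
  by move=> hs ht; rewrite addrAC; case: (hd _ (hz t' s' ht hs)).
have [s' [t' [sh' th' e3]]] := second_difference hf h0' hA'.
rewrite -/q in e3.
clearbody p q.
have E : p (x + s *: delta_mx 0 k + t *: delta_mx 0 l) =
  q (x + t' *: delta_mx 0 k + s' *: delta_mx 0 l).
  have hh : h * h != 0 by rewrite mulf_neq0 // gt_eqF.
  have E0 : p (x + s *: delta_mx 0 k + t *: delta_mx 0 l) * h * h =
      q (x + s' *: delta_mx 0 l + t' *: delta_mx 0 k) * h * h.
    apply: etrans (esym e1) (etrans _ e3).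
    by rewrite (addrAC x (h *: delta_mx 0 l)); ring.
  rewrite (addrAC x (t' *: delta_mx 0 k)).
  by apply: (mulIf hh); rewrite [LHS]mulrA [RHS]mulrA E0.
have [_ B1 _] := hd _ (hz _ _ sh th).
have [_ _ B2] := hd _ (hz _ _ th' sh').
rewrite E in B1.
set v := x + t' *: delta_mx 0 k + s' *: delta_mx 0 l in E B1 B2.
rewrite (_ : p x - q x = (p x - q v) - (q x - q v)); last by ring.
apply: le_trans (ler_normB _ _) _; apply: ltW.
by rewrite [ltRHS]splitr ltrD.
Qed.

Lemma row_norm_lt (v : 'rV[R]_n) (d : R) : 0 < d ->
  (`|v| < d) <-> (forall l, `|v 0 l| < d).
Proof.
move=> d0; rewrite [`|v|](mx_normrE v); split.
  by move=> /bigmax_ltP[_ h] l; apply: (h (0, l)).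
by move=> h; apply/bigmax_ltP; split=> // -[i l] _ /=; rewrite (ord1 i).
Qed.

(** Points of a ball for the supremum norm are joined by a path parallel to
    the axes that stays in the ball; the mean value theorem applies on each
    segment. *)
Lemma partial0_locally_cst A f x : open A -> A x ->
  (forall z k, A z -> pderivable k f z) ->
  (forall z k, A z -> partial k f z = 0) ->
  \forall z \near x, f z = f x.
Proof.
move=> oA Ax df pf.
have /nbhs_normP[d /= d0 hd] : nbhs x A by exact: open_nbhs_nbhs.
apply/nbhs_normP; exists d => //= z /(row_norm_lt _ d0) xz.
have xz' l : `|x 0 l - z 0 l| < d by have := xz l; rewrite !mxE.
(* w moves one coordinate at a time from x to z *)
pose w (m : nat) : 'rV[R]_n := \row_l (if (l < m)%N then z 0 l else x 0 l).
have w0 : w 0%N = x by apply/rowP => l; rewrite mxE.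
have wn : w n = z by apply/rowP => l; rewrite mxE ltn_ord.
suff h m : (m <= n)%N -> f (w m) = f x by rewrite -wn h.
elim: m => [|m IH] mn; first by rewrite w0.
rewrite -IH; last exact: ltnW.
pose k := Ordinal mn.
have wS : w m.+1 = w m + (z 0 k - x 0 k) *: delta_mx 0 k.
  apply/rowP => l; rewrite !mxE eqxx ltnS leq_eqVlt -val_eqE /=.
  case: eqP => [e|_] /=; last by rewrite mulr0 addr0.
  have -> : l = k by apply/val_inj.
  by rewrite /= ltnn mulr1 addrC subrK.
have inA (c : R) : `|x 0 k - c| < d -> A (w m + (c - x 0 k) *: delta_mx 0 k).
  move=> hc; apply: hd; apply/(row_norm_lt _ d0) => l; rewrite !mxE eqxx /=.
  case: (eqVneq l k) => [->|lk] /=.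
    by rewrite ltnn mulr1 (_ : x 0 k + (c - x 0 k) = c) //; ring.
  rewrite mulr0 addr0; case: ifP => _; first exact: xz'.
  by rewrite subrr normr0.
have mid (u : 'rV[R]_n) (h : R) : 0 <= h ->
    (forall t, 0 <= t <= h -> A (u + t *: delta_mx 0 k)) -> f (u + h *: delta_mx 0 k) = f u.
  move=> h0 hu; have [t ht|t ht e] := @MVT_line f u k h h0; first exact/df/hu.
  by apply/eqP; rewrite -subr_eq0 e pf ?mul0r //; apply: hu.
have [zk|zk] := leP (x 0 k) (z 0 k).
  rewrite wS mid ?subr_ge0 // => t /andP[t0 t1].
  have := inA (t + x 0 k); rewrite addrK; apply.
  apply: le_lt_trans (xz' k); rewrite opprD addrCA subrr addr0 normrN distrC.
  by rewrite !ger0_norm // subr_ge0.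
have -> : w m = w m.+1 + (x 0 k - z 0 k) *: delta_mx 0 k.
  by rewrite wS -addrA -scalerDl addrA subrK subrr scale0r addr0.
rewrite mid ?subr_ge0 1?ltW // => t /andP[t0 t1].
rewrite wS -addrA -scalerDl (_ : z 0 k - x 0 k + t = (z 0 k + t) - x 0 k); last by ring.
apply: inA; apply: le_lt_trans (xz' k).
rewrite opprD addrA ger0_norm; last by rewrite subr_ge0.
rewrite ger0_norm; last by rewrite subr_ge0 ltW.
by rewrite lerBlDr lerDl.
Qed.

End Partial.

(** * The ring of regular functions of position and direction *)

(** A set of pairs (x, y), open in each variable separately, which suffices
    for partial derivatives. The set [fib x] of directions may be empty over
    points of the base. *)
Record phase_domain (R : realType) (n : nat) := PhaseDomain {
  base : set 'rV[R]_n;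
  fib : 'rV[R]_n -> set 'rV[R]_n;
  base_open : open base;
  fib_base : forall x y, fib x y -> base x;
  fib_openX : forall y, open [set x | fib x y];
  fib_openY : forall x, open (fib x)
}.

Section Regular.
Context {R : realType} {n : nat} (D : phase_domain R n).
Notation V := 'rV[R]_n.
Implicit Types (f g L : V -> V -> R) (x y : V) (k l : 'I_n) (p q : bool * 'I_n).
Notation O := (fib D).

(** Generated by closure properties instead of being defined as smoothness in
    (x, y): then stability under derivation and the commutation of derivatives
    follow by induction from the case of functions of x alone. Only the values
    on the domain matter, whence [reg_ext]. *)
Inductive reg : (V -> V -> R) -> Prop :=
| reg_coef c : smooth (base D) c -> reg (fun x _ => c x)
| reg_y k : reg (fun _ y => y 0 k)
| regD f g : reg f -> reg g -> reg (fun x y => f x y + g x y)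
| regM f g : reg f -> reg g -> reg (fun x y => f x y * g x y)
| regV f : reg f -> (forall x y, O x y -> f x y != 0) -> reg (fun x y => (f x y)^-1)
| reg_ext f g : reg f -> (forall x y, O x y -> f x y = g x y) -> reg g.

(** The two families of derivations are treated together, the boolean being
    true for derivatives in x. *)
Definition pd p L := if p.1 then dx p.2 L else dy p.2 L.
Definition pd_able p L x y :=
  if p.1 then pderivable p.2 (fun z => L z y) x else pderivable p.2 (L x) y.
Definition eqO f g := forall x y, O x y -> f x y = g x y.

Lemma nearX f g x y : eqO f g -> O x y -> \forall z \near x, f z y = g z y.
Proof.
move=> fg Oxy; apply: (@open_near R n [set z | O z y]) => //; first exact: fib_openX.
by move=> z /= Oz; apply: fg.
Qed.

Lemma nearY f g x y : eqO f g -> O x y -> \forall z \near y, f x z = g x z.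
Proof.
move=> fg Oxy; apply: (@open_near R n (O x)) => //; first exact: fib_openY.
by move=> z /= Oz; apply: fg.
Qed.

Lemma pd_ext p f g : eqO f g -> eqO (pd p f) (pd p g).
Proof.
move=> fg x y Oxy; case: p => [[] k]; rewrite /pd /=.
  by apply: partial_near; apply: nearX.
by apply: partial_near; apply: nearY.
Qed.

Lemma pd_able_ext p f g x y : eqO f g -> O x y -> pd_able p f x y -> pd_able p g x y.
Proof.
move=> fg Oxy; case: p => [[] k]; rewrite /pd_able /=; apply: pderivable_near.
  exact: nearX.
exact: nearY.
Qed.

Lemma pdD p f g x y : pd_able p f x y -> pd_able p g x y ->
  pd p (fun x y => f x y + g x y) x y = pd p f x y + pd p g x y.
Proof. by case: p => [[] k]; rewrite /pd /pd_able /=; apply: partialD. Qed.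

Lemma pdM p f g x y : pd_able p f x y -> pd_able p g x y ->
  pd p (fun x y => f x y * g x y) x y = pd p f x y * g x y + f x y * pd p g x y.
Proof.
case: p => [[] k]; rewrite /pd /pd_able /=; first exact: (@partialM _ _ k (f^~ y)).
exact: (@partialM _ _ k (f x)).
Qed.

Lemma pdV p f x y : f x y != 0 -> pd_able p f x y ->
  pd p (fun x y => (f x y)^-1) x y = - ((f x y)^-1 * (f x y)^-1 * pd p f x y).
Proof.
case: p => [[] k]; rewrite /pd /pd_able /=; first exact: (@partialV _ _ k (f^~ y)).
exact: (@partialV _ _ k (f x)).
Qed.

Lemma pdX_coef k (c : V -> R) x y : pd (true, k) (fun x _ => c x) x y = partial k c x.
Proof. by []. Qed.
Lemma pdY_coef k (c : V -> R) x y : pd (false, k) (fun x _ => c x) x y = 0.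
Proof. exact: partial_cst. Qed.
Lemma pdX_y k l x y : pd (true, k) (fun _ y => y 0 l) x y = 0.
Proof. exact: partial_cst. Qed.
Lemma pdY_y k l x y : pd (false, k) (fun _ y => y 0 l) x y = (l == k)%:R.
Proof. exact: partial_entry. Qed.

Lemma reg_cst (c : R) : reg (fun _ _ => c).
Proof. exact/reg_coef/smooth_cst. Qed.

Lemma regN f : reg f -> reg (fun x y => - f x y).
Proof.
move=> hf; apply: (reg_ext (regM (reg_cst (-1)) hf)) => x y _.
by rewrite mulN1r.
Qed.

(** Derivability and regularity of the derivative are proved together, as the
    derivative of a product or of an inverse is known only for derivable
    functions. *)
Lemma reg_pd p f : reg f -> (forall x y, O x y -> pd_able p f x y) /\ reg (pd p f).
Proof.
elim=> {f} [c hc|l|f g hf [af rf] hg [ag rg]|f g hf [af rf] hg [ag rg]|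
  f hf [af rf] f0|f g hf [af rf] fg].
- split.
    move=> x y /fib_base bx; case: p => [[] k]; rewrite /pd_able /=.
      exact: smooth_pderivable hc bx.
    exact: (derivable_cst (c x) y).
  case: p => [[] k].
    apply: (reg_ext (reg_coef (smooth_partial k hc))) => x y _; exact: pdX_coef.
  by apply: (reg_ext (reg_cst 0)) => x y _; rewrite pdY_coef.
- split.
    move=> x y _; case: p => [[] k]; rewrite /pd_able /=.
      exact: (derivable_cst (y 0 l) x).
    exact: pderivable_entry.
  case: p => [[] k].
    by apply: (reg_ext (reg_cst 0)) => x y _; rewrite pdX_y.
  by apply: (reg_ext (reg_cst (l == k)%:R)) => x y _; rewrite pdY_y.
- split.
    move=> x y Oxy; have := af _ _ Oxy; have := ag _ _ Oxy.
    case: p {af rf ag rg} => [[] k]; rewrite /pd_able /= => hg' hf'; exact: derivableD.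
  by apply: (reg_ext (regD rf rg)) => x y Oxy; rewrite pdD; [|exact: af|exact: ag].
- split.
    move=> x y Oxy; have := af _ _ Oxy; have := ag _ _ Oxy.
    case: p {af rf ag rg} => [[] k]; rewrite /pd_able /= => hg' hf'; exact: derivableM.
  by apply: (reg_ext (regD (regM rf hg) (regM hf rg))) => x y Oxy; rewrite pdM;
    [|exact: af|exact: ag].
- split.
    move=> x y Oxy; have := af _ _ Oxy; have := f0 _ _ Oxy.
    case: p {af rf} => [[] k]; rewrite /pd_able /= => f0' hf'; exact: derivableV.
  have iv := regV hf f0.
  apply: (reg_ext (regN (regM (regM iv iv) rf))) => x y Oxy.
  by rewrite pdV; [|exact: f0|exact: af].
- split.
    by move=> x y Oxy; apply: pd_able_ext fg Oxy (af x y Oxy).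
  by apply: (reg_ext rf); exact: pd_ext.
Qed.

Lemma reg_able p f x y : reg f -> O x y -> pd_able p f x y.
Proof. by move=> /(reg_pd p)[h _]; apply: h. Qed.
Lemma reg_pdr p f : reg f -> reg (pd p f).
Proof. by move=> /(reg_pd p)[]. Qed.

Lemma pd0 p : eqO (pd p (fun _ _ => 0)) (fun _ _ => 0).
Proof. by case: p => [[] k] x y _; apply: partial_cst. Qed.

Lemma pdN p f : reg f -> eqO (pd p (fun x y => - f x y)) (fun x y => - pd p f x y).
Proof.
move=> hf x y Oxy; have := pd0 p Oxy.
rewrite -(@pd_ext p (fun x y => f x y + - f x y)) //; last by move=> *; rewrite subrr.
rewrite pdD; [|exact: reg_able|apply: reg_able => //; exact: regN].
by move/eqP; rewrite addrC addr_eq0 => /eqP.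
Qed.

Lemma pdC p q f : reg f -> eqO (pd p (pd q f)) (pd q (pd p f)).
Proof.
elim=> {f} [c hc|l|f g hf ihf hg ihg|f g hf ihf hg ihg|f hf ihf f0|f g hf ihf fg] x y Oxy.
- have z1 p' m : pd p' (pd (false, m) (fun x _ => c x)) x y = 0.
    rewrite -(pd0 p' Oxy); apply: pd_ext => // x' y' _; exact: pdY_coef.
  have z2 k m : pd (false, m) (pd (true, k) (fun x _ => c x)) x y = 0.
    exact: (pdY_coef m (partial k c)).
  case: p => [[] k]; case: q => [[] m].
  + apply: (@partialC _ _ (base D) c); [exact: base_open|exact: fib_base Oxy|exact: hc].
  + by rewrite z1 z2.
  + by rewrite z1 z2.
  + by rewrite !z1.
- have h p' q' : pd p' (pd q' (fun _ y => y 0 l)) x y = 0.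
    case: q' => [[] m].
      rewrite (@pd_ext p' _ (fun _ _ => 0)) // ?pd0 //; move=> *; exact: pdX_y.
    rewrite (@pd_ext p' _ (fun _ _ => (l == m)%:R)) //; last by move=> *; exact: pdY_y.
    by case: p' => [[] k]; exact: partial_cst.
  by rewrite !h.
- have h p' q' : pd p' (pd q' (fun x y => f x y + g x y)) x y =
      pd p' (pd q' f) x y + pd p' (pd q' g) x y.
    rewrite (@pd_ext p' _ (fun x y => pd q' f x y + pd q' g x y)) //; last first.
      by move=> x' y' O'; rewrite pdD //; exact: reg_able.
    by rewrite pdD //; apply: reg_able => //; exact: reg_pdr.
  by rewrite !h (ihf x y Oxy) (ihg x y Oxy).
- have h p' q' : pd p' (pd q' (fun x y => f x y * g x y)) x y =
      (pd p' (pd q' f) x y * g x y + pd q' f x y * pd p' g x y)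
       + (pd p' f x y * pd q' g x y + f x y * pd p' (pd q' g) x y).
    rewrite (@pd_ext p' _ (fun x y => pd q' f x y * g x y + f x y * pd q' g x y)) //; last first.
      by move=> x' y' O'; rewrite pdM //; exact: reg_able.
    have r1 := reg_pdr q' hf; have r2 := reg_pdr q' hg.
    rewrite (@pdD p' (fun x y => pd q' f x y * g x y) (fun x y => f x y * pd q' g x y));
      [|apply: reg_able => //; exact: regM|apply: reg_able => //; exact: regM].
    by rewrite !pdM //; exact: reg_able.
  by rewrite !h (ihf x y Oxy) (ihg x y Oxy) addrACA.
- have iv := regV hf f0.
  have h p' q' : pd p' (pd q' (fun x y => (f x y)^-1)) x y =
      2 * (f x y)^-1 * (f x y)^-1 * (f x y)^-1 * pd p' f x y * pd q' f x y
      - (f x y)^-1 * (f x y)^-1 * pd p' (pd q' f) x y.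
    rewrite (@pd_ext p' _ (fun x y => - (((f x y)^-1 * (f x y)^-1) * pd q' f x y))) //; last first.
      by move=> x' y' O'; rewrite pdV //; [exact: f0|exact: reg_able].
    have r1 := reg_pdr q' hf; have r2 := regM iv iv.
    rewrite (pdN p' (regM r2 r1)) //.
    rewrite (@pdM p' (fun x y => (f x y)^-1 * (f x y)^-1)); [|exact: reg_able|exact: reg_able].
    rewrite (@pdM p' (fun x y => (f x y)^-1)); [|exact: reg_able|exact: reg_able].
    by rewrite pdV; [ring|exact: f0|exact: reg_able].
  rewrite !h (ihf x y Oxy); congr (_ - _).
  by rewrite -!mulrA; do 4!congr (_ * _); exact: mulrC.
- have h p' q' : pd p' (pd q' g) x y = pd p' (pd q' f) x y.
    by apply: pd_ext => // x' y' O'; apply: pd_ext => // x'' y'' O''; rewrite fg.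
  by rewrite !h (ihf x y Oxy).
Qed.

End Regular.

Section RegRing.
Context {R : realType} {n : nat} (D : phase_domain R n).
Notation V := 'rV[R]_n.

(** Restricting regular functions to the points of the domain makes equality
    on the domain the equality of the ring. *)
Definition phase_points := {p : V * V | fib D p.1 p.2}.
Definition regpred : {pred phase_points -> R} := fun g =>
  `[< exists2 L, reg D L & forall p : phase_points, g p = L (sval p).1 (sval p).2 >].

Lemma regpred_closed : GRing.subring_closed regpred.
Proof.
split.
- by apply/asboolP; exists (fun _ _ => 1) => //; exact: reg_cst.
- move=> f g /asboolP[L hL eL] /asboolP[M hM eM]; apply/asboolP.
  exists (fun x y => L x y + - M x y); first by apply: regD => //; exact: regN.
  by move=> p; rewrite -eL -eM.
- move=> f g /asboolP[L hL eL] /asboolP[M hM eM]; apply/asboolP.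
  exists (fun x y => L x y * M x y); first exact: regM.
  by move=> p; rewrite -eL -eM.
Qed.

HB.instance Definition _ := GRing.isSubringClosed.Build (phase_points -> R) regpred regpred_closed.

Record regfun := RegFun { rval :> phase_points -> R; rvalP : rval \in regpred }.
HB.instance Definition _ := [isSub for rval].
HB.instance Definition _ := [Choice of regfun by <:].
HB.instance Definition _ := GRing.SubChoice_isSubComPzRing.Build (phase_points -> R) regpred regfun regpred_closed.

Definition mkreg L (hL : reg D L) : regfun :=
  RegFun (introT (asboolP _) (ex_intro2 _ _ L hL (fun p => erefl (L (sval p).1 (sval p).2)))).

(** The extension by zero of a regular function. The pairing and projecting of
    (x, y) makes the proof given by [pselect] one of membership in
    [phase_points]. *)
Definition ev (g : regfun) : V -> V -> R := fun x y =>
  if pselect (fib D (x, y).1 (x, y).2) is left h then rval g (exist _ (x, y) h) else 0.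

Lemma evE g x y (h : fib D x y) : ev g x y = rval g (exist _ (x, y) h).
Proof.
rewrite /ev; case: pselect => [h'|/(_ h)//].
by congr (rval g (exist _ _ _)); apply: Prop_irrelevance.
Qed.

Lemma ev_mkreg L (hL : reg D L) : eqO D (ev (mkreg hL)) L.
Proof. by move=> x y h; rewrite (evE _ h). Qed.

Lemma ev_inj f g : eqO D (ev f) (ev g) -> f = g.
Proof.
move=> e; apply: val_inj; apply/funext => -[[x y] h] /=.
by rewrite -!(evE _ h); apply: e.
Qed.

Lemma reg_ev g : reg D (ev g).
Proof.
have /asboolP[L hL e] := rvalP g; apply: reg_ext hL _ => x y h.
by rewrite (evE _ h) e.
Qed.

Lemma evD f g x y : fib D x y -> ev (f + g) x y = ev f x y + ev g x y.
Proof. by move=> h; rewrite !(evE _ h). Qed.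
Lemma evM f g x y : fib D x y -> ev (f * g) x y = ev f x y * ev g x y.
Proof. by move=> h; rewrite !(evE _ h). Qed.
Lemma evN f x y : fib D x y -> ev (- f) x y = - ev f x y.
Proof. by move=> h; rewrite !(evE _ h). Qed.
Lemma evB f g x y : fib D x y -> ev (f - g) x y = ev f x y - ev g x y.
Proof. by move=> h; rewrite evD // evN. Qed.
Lemma ev1 x y : fib D x y -> ev 1 x y = 1.
Proof. by move=> h; rewrite !(evE _ h). Qed.
Lemma ev0 x y : fib D x y -> ev 0 x y = 0.
Proof. by move=> h; rewrite !(evE _ h). Qed.
Lemma ev_nat m x y : fib D x y -> ev m%:R x y = m%:R.
Proof.
move=> h; elim: m => [|m IH]; first exact: ev0.
by rewrite -addn1 !natrD evD // IH ev1.
Qed.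
Lemma ev_sum (I : finType) (F : I -> regfun) x y : fib D x y ->
  ev (\sum_i F i) x y = \sum_i ev (F i) x y.
Proof.
move=> h; apply: (big_morph (fun g => ev g x y)) => [f g|]; [exact: evD|exact: ev0].
Qed.

Definition dR p (g : regfun) : regfun := mkreg (reg_pdr p (reg_ev g)).

Lemma ev_dR p g : eqO D (ev (dR p g)) (pd p (ev g)).
Proof. exact: ev_mkreg. Qed.

(** Derivatives of any function represented by a ring element are represented
    by the derivative of that element. *)
Lemma pd_ev p L g : eqO D L (ev g) -> eqO D (pd p L) (ev (dR p g)).
Proof. move=> e x y h; rewrite (ev_dR p g h); exact: (pd_ext p e h). Qed.

Lemma dR_add p f g : dR p (f + g) = dR p f + dR p g.
Proof.
apply: ev_inj => x y h; rewrite evD // !ev_dR // -pdD; try by apply/reg_able/h/reg_ev.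
by apply: pd_ext h => x' y' h'; rewrite evD.
Qed.

Lemma dR_mul p f g : dR p (f * g) = dR p f * g + f * dR p g.
Proof.
apply: ev_inj => x y h; rewrite evD // !evM // !ev_dR // -pdM;
  try by apply/reg_able/h/reg_ev.
by apply: pd_ext h => x' y' h'; rewrite evM.
Qed.

Definition dR_der p : derivation regfun := Derivation (dR_add p) (dR_mul p).

Lemma dRC p q f : dR p (dR q f) = dR q (dR p f).
Proof.
apply: ev_inj => x y h; rewrite !ev_dR //.
rewrite (pd_ext (D := D) (g := pd q (ev f)) p) //; last exact: ev_dR.
rewrite [RHS](pd_ext (D := D) (g := pd p (ev f)) q) //; last exact: ev_dR.
by apply: pdC h; exact: reg_ev.
Qed.

Definition cstR (c : R) : regfun := mkreg (reg_cst D c).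
Definition coefR c (hc : smooth (base D) c) : regfun := mkreg (reg_coef hc).
Definition yR k : regfun := mkreg (reg_y D k).

Lemma dRX_yR k l : dR (true, k) (yR l) = 0.
Proof.
apply: ev_inj => x y h; rewrite ev_dR // ev0 // -(pdX_y k l x y).
by apply: pd_ext h; exact: ev_mkreg.
Qed.
Lemma dRY_yR k l : dR (false, k) (yR l) = (k == l)%:R.
Proof.
apply: ev_inj => x y h; rewrite ev_dR // ev_nat // eq_sym -(pdY_y k l x y).
by apply: pd_ext h; exact: ev_mkreg.
Qed.
Lemma cstR_half : 2 * cstR 2^-1 = 1.
Proof.
apply: ev_inj => x y h; rewrite evM // ev_nat // ev1 // ev_mkreg //.
by rewrite mulfV.
Qed.

Definition phaseR : phase_ring n := @PhaseRing n regfun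
  (fun k => dR_der (true, k)) (fun k => dR_der (false, k))
  (fun k l => dRC (true, k) (true, l)) (fun k l => dRC (true, k) (false, l))
  (fun k l => dRC (false, k) (false, l)) yR dRX_yR dRY_yR (cstR 2^-1) cstR_half.

Lemma coefR_basic c (hc : smooth (base D) c) k : dR (false, k) (coefR hc) = 0.
Proof.
apply: ev_inj => x y h; rewrite ev_dR // ev0 // -(pdY_coef k c x y).
by apply: pd_ext h; exact: ev_mkreg.
Qed.

Lemma ev_dX_coefR c (hc : smooth (base D) c) k x y : fib D x y ->
  ev (dR (true, k) (coefR hc)) x y = partial k c x.
Proof.
move=> h; rewrite ev_dR // -(pdX_coef k c x y).
by apply: pd_ext h; exact: ev_mkreg.
Qed.

(** Functions without zeros on the domain are invertible in the ring. *)
Definition invR (g : regfun) (hg : forall x y, fib D x y -> ev g x y != 0) : regfun :=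
  mkreg (regV (reg_ev g) hg).

Lemma invRK g hg : @invR g hg * g = 1.
Proof.
by apply: ev_inj => x y h; rewrite evM // ev1 // ev_mkreg // mulVf // hg.
Qed.

End RegRing.

(** * Bilinear forms and smooth matrices *)

Section LinAlg.
Context {R : realType} {n : nat}.
Implicit Types (A : 'M[R]_n) (u v b y : 'rV[R]_n).

Lemma bilE A u v : bil A u v = (u *m A *m v^T) 0 0.
Proof.
rewrite mxE /bil; under [RHS]eq_bigr do rewrite !mxE mulr_suml.
rewrite [RHS]exchange_big; apply: eq_bigr => k _; apply: eq_bigr => l _ /=.
by congr (_ * _); exact: mulrC.
Qed.

Lemma pairingE b y : pairing b y = (b *m y^T) 0 0.
Proof. by rewrite mxE; apply: eq_bigr => k _; rewrite !mxE. Qed.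

Lemma bilDl A u v w : bil A (u + v) w = bil A u w + bil A v w.
Proof. by rewrite !bilE !mulmxDl mxE. Qed.
Lemma bilDr A u v w : bil A w (u + v) = bil A w u + bil A w v.
Proof. by rewrite !bilE linearD /= mulmxDr mxE. Qed.
Lemma bilZl A (c : R) u w : bil A (c *: u) w = c * bil A u w.
Proof. by rewrite !bilE -!scalemxAl mxE. Qed.
Lemma bilZr A (c : R) u w : bil A w (c *: u) = c * bil A w u.
Proof. by rewrite !bilE linearZ /= -scalemxAr mxE. Qed.
Lemma bilNl A u w : bil A (- u) w = - bil A u w.
Proof. by rewrite -scaleN1r bilZl mulN1r. Qed.
Lemma bilNr A u w : bil A w (- u) = - bil A w u.
Proof. by rewrite -scaleN1r bilZr mulN1r. Qed.
Lemma bil_sym A u v : A^T = A -> bil A u v = bil A v u.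
Proof.
move=> sA; rewrite !bilE -[LHS]/((u *m A *m v^T) 0 0).
have -> : u *m A *m v^T = (v *m A *m u^T)^T.
  by rewrite !trmx_mul trmxK sA mulmxA.
by rewrite mxE.
Qed.
Lemma pairingDr b u v : pairing b (u + v) = pairing b u + pairing b v.
Proof. by rewrite !pairingE linearD /= mulmxDr mxE. Qed.
Lemma pairingZr b (c : R) u : pairing b (c *: u) = c * pairing b u.
Proof. by rewrite !pairingE linearZ /= -scalemxAr mxE. Qed.
Lemma pairingNr b u : pairing b (- u) = - pairing b u.
Proof. by rewrite -scaleN1r pairingZr mulN1r. Qed.

Definition posdef A := forall y, y != 0 -> 0 < bil A y y.

Lemma posdef_unit A : posdef A -> A \in unitmx.
Proof.
move=> pA; rewrite -row_free_unit; apply: inj_row_free => v vA.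
apply/eqP; apply: contraT => /pA; rewrite bilE vA mul0mx mxE ltxx.
by [].
Qed.

Lemma bil_ge0 A y : posdef A -> 0 <= bil A y y.
Proof.
move=> pA; have [->|/pA/ltW//] := eqVneq y 0.
by rewrite bilE mul0mx mul0mx mxE.
Qed.

Lemma bil_eq0 A y : posdef A -> bil A y y = 0 -> y = 0.
Proof. by move=> pA e; apply/eqP; apply: contraT => /pA; rewrite e ltxx. Qed.

End LinAlg.

Section SmoothMatrix.
Context {R : realType} {n : nat} (Om : set 'rV[R]_n) (oOm : open Om).

Lemma smooth_det m (A : 'rV[R]_n -> 'M[R]_m) :
  (forall i j, smooth Om (fun x => A x i j)) -> smooth Om (fun x => \det (A x)).
Proof.
move=> hA; apply: smooth_sum => // s; apply: smoothM => //; first exact: smooth_cst.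
by apply: smooth_prod.
Qed.

(** Cramer's formula. *)
Lemma smooth_invmx m (A : 'rV[R]_n -> 'M[R]_m) :
  (forall i j, smooth Om (fun x => A x i j)) ->
  (forall x, Om x -> A x \in unitmx) ->
  forall i j, smooth Om (fun x => invmx (A x) i j).
Proof.
move=> hA uA i j.
have hd : smooth Om (fun x => (\det (A x))^-1).
  apply: smoothV (smooth_det hA) => // x Ox.
  by rewrite -unitfE -unitmxE uA.
have hc : smooth Om (fun x => cofactor (A x) j i).
  apply: smoothM => //; first exact: smooth_cst.
  apply: smooth_det => k l; apply: smooth_ext (hA (lift j k) (lift i l)) => // x _.
  by rewrite !mxE.
apply: smooth_ext (smoothM oOm hd hc) => // x Ox.
by rewrite /invmx uA // !mxE.
Qed.
End SmoothMatrix.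

(** * Coordinate expressions as elements of the ring of regular functions *)

Section Domains.
Context {R : realType} {n : nat} (Om : set 'rV[R]_n) (oOm : open Om).
Variable b : 'rV[R]_n -> 'rV[R]_n.
Hypothesis hb : forall k, smooth Om (fun x => b x 0 k).

Lemma smooth_pairing y : smooth Om (fun x => pairing (b x) y).
Proof.
by apply: smooth_sum => // k; apply: smoothM => //; apply: smooth_cst.
Qed.

Lemma half_openX y : open [set x | Om x /\ 0 < pairing (b x) y].
Proof.
rewrite openE => x [Ox bx]; rewrite /interior.
have c := smooth_continuous (smooth_pairing y) Ox.
have h1 : \forall z \near x, 0 < pairing (b z) y.
  by apply: (cvgr_gt (pairing (b x) y) c).
have h0 : \forall z \near x, Om z by exact: open_nbhs_nbhs.
by apply: filterS2 h0 h1.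
Qed.

Lemma smooth_entry (A : set 'rV[R]_n) l : smooth A (fun y => y 0 l).
Proof.
have c y : {for y, continuous (fun y : 'rV[R]_n => y 0 l)}.
  exact: mathcomp.analysis.normedtype_theory.matrix_normedtype.coord_continuous.
case=> [|r]; split=> //; try by move=> y _; exact: c.
move=> k; split; first by move=> y _; exact: pderivable_entry.
rewrite (_ : partial k _ = fun=> (l == k)%:R); first exact: Cr_cst.
by apply/funext => y; exact: partial_entry.
Qed.

Lemma pairing_continuous (c : 'rV[R]_n) y : {for y, continuous (pairing c)}.
Proof.
have : smooth [set: 'rV[R]_n] (pairing c).
  apply: smooth_sum => [|k]; first exact: openT.
  apply: smoothM; [exact: openT|exact: smooth_cst|exact: smooth_entry].
by move=> /smooth_continuous; apply.
Qed.

Lemma half_openY x : open [set y | Om x /\ 0 < pairing (b x) y].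
Proof.
rewrite openE => y [Ox bx]; rewrite /interior.
have h1 : \forall z \near y, 0 < pairing (b x) z.
  by apply: (cvgr_gt (pairing (b x) y) (@pairing_continuous (b x) y)).
by apply: filterS h1 => z hz; split.
Qed.

(** The domain of a Kropina metric. *)
Definition half_domain : phase_domain R n :=
  @PhaseDomain R n Om (fun x => [set y | Om x /\ 0 < pairing (b x) y]) oOm
    (fun x y h => h.1) half_openX half_openY.

Lemma full_openX (y : 'rV[R]_n) : open [set x : 'rV[R]_n | Om x].
Proof. exact: oOm. Qed.

Lemma full_openY (x : 'rV[R]_n) : open [set y : 'rV[R]_n | Om x].
Proof. by rewrite openE => y Ox; apply: filterS filterT => z _. Qed.

(** The domain of alpha^2 and beta themselves, used for identities without
    denominators: these hold for all directions, including those where beta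
    vanishes. *)
Definition full_domain : phase_domain R n :=
  @PhaseDomain R n Om (fun x => [set y | Om x]) oOm (fun x y h => h) full_openX full_openY.
End Domains.

(** The coordinate expression of a normalized pair of a metric and a form over
    an open set. *)
Record unit_pair (R : realType) n (Om : set 'rV[R]_n)
    (a : 'rV[R]_n -> 'M[R]_n) (b : 'rV[R]_n -> 'rV[R]_n) : Prop := UnitPair {
  up_a : forall k l, smooth Om (fun x => a x k l);
  up_b : forall k, smooth Om (fun x => b x 0 k);
  up_sym : forall x, Om x -> (a x)^T = a x;
  up_pos : forall x, Om x -> posdef (a x);
  up_unit : forall x, Om x -> bil (invmx (a x)) (b x) (b x) = 1
}.

Section UnitFormOf.
Context {R : realType} {n : nat} (D : phase_domain R n)
  (a : 'rV[R]_n -> 'M[R]_n) (b : 'rV[R]_n -> 'rV[R]_n).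
Hypothesis H : unit_pair (base D) a b.
Notation A := (phaseR D).
Notation X := (dX A).
Notation ev := (@ev R n D).

Lemma up_inv k l : smooth (base D) (fun x => invmx (a x) k l).
Proof.
apply: smooth_invmx; [exact: base_open|exact: up_a H|].
by move=> x Ox; apply: posdef_unit; apply: up_pos H _ Ox.
Qed.

Definition metricR k l : A := coefR (up_a H k l).
Definition cometricR k l : A := coefR (up_inv k l).
Definition formR k : A := coefR (up_b H k).

Lemma ev_coefR c (hc : smooth (base D) c) x y : fib D x y -> ev (coefR hc) x y = c x.
Proof. by move=> h; rewrite ev_mkreg. Qed.

Lemma metricR_sym k l : metricR k l = metricR l k.
Proof.
apply: ev_inj => x y h; rewrite !ev_coefR //.
by rewrite -{1}(up_sym H (fib_base h)) mxE.
Qed.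
Lemma cometricR_sym k l : cometricR k l = cometricR l k.
Proof.
apply: ev_inj => x y h; rewrite !ev_coefR //.
by rewrite -{1}(up_sym H (fib_base h)) -trmx_inv mxE.
Qed.
Lemma metricRK k l : \sum_m metricR k m * cometricR m l = (k == l)%:R.
Proof.
apply: ev_inj => x y h; rewrite ev_sum // ev_nat //.
have u := posdef_unit (up_pos H (fib_base h)).
transitivity ((a x *m invmx (a x)) k l); last by rewrite mulmxV // mxE.
by rewrite mxE; apply: eq_bigr => m _; rewrite evM // !ev_coefR.
Qed.
Lemma cometricRK k l : \sum_m cometricR k m * metricR m l = (k == l)%:R.
Proof.
apply: ev_inj => x y h; rewrite ev_sum // ev_nat //.
have u := posdef_unit (up_pos H (fib_base h)).
transitivity ((invmx (a x) *m a x) k l); last by rewrite mulVmx // mxE.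
by rewrite mxE; apply: eq_bigr => m _; rewrite evM // !ev_coefR.
Qed.
Lemma formR_unit : \sum_k \sum_l cometricR k l * formR k * formR l = 1.
Proof.
apply: ev_inj => x y h; rewrite ev_sum // ev1 // -(up_unit H (fib_base h)).
apply: eq_bigr => k _; rewrite ev_sum //; apply: eq_bigr => l _.
by rewrite !evM // !ev_coefR.
Qed.

Definition UF : unit_form A := @UnitForm n A metricR cometricR formR (fun k l m => coefR_basic (up_a H k l) m)
  (fun k l m => coefR_basic (up_inv k l) m) (fun k m => coefR_basic (up_b H k) m)
  metricR_sym cometricR_sym metricRK cometricRK formR_unit.

Lemma ev_metric k l x y : fib D x y -> ev (metric UF k l) x y = a x k l.
Proof. exact: ev_coefR. Qed.
Lemma ev_cometric k l x y : fib D x y -> ev (cometric UF k l) x y = invmx (a x) k l.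
Proof. exact: ev_coefR. Qed.
Lemma ev_form k x y : fib D x y -> ev (form UF k) x y = b x 0 k.
Proof. exact: ev_coefR. Qed.
Lemma ev_yc k x y : fib D x y -> ev (yc A k) x y = y 0 k.
Proof. by move=> h; rewrite ev_mkreg. Qed.
Lemma ev_half x y : fib D x y -> ev (onehalf A) x y = 2^-1.
Proof. by move=> h; rewrite ev_mkreg. Qed.

Lemma ev_asq x y : fib D x y -> ev (asq UF) x y = bil (a x) y y.
Proof.
move=> h; rewrite ev_sum //; apply: eq_bigr => k _; rewrite ev_sum //.
by apply: eq_bigr => l _; rewrite !evM // ev_metric // !ev_yc.
Qed.
Lemma ev_bform x y : fib D x y -> ev (bform UF) x y = pairing (b x) y.
Proof.
move=> h; rewrite ev_sum //; apply: eq_bigr => k _.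
by rewrite !evM // ev_form // !ev_yc.
Qed.
(** The vector dual to b. The metric being symmetric, multiplication by its
    inverse from the right raises the index. *)
Definition Wv x : 'rV[R]_n := b x *m invmx (a x).

Lemma ev_W k x y : fib D x y -> ev (W UF k) x y = Wv x 0 k.
Proof.
move=> h; rewrite ev_sum // mxE; apply: eq_bigr => l _.
by rewrite evM // ev_cometric // ev_form // mulrC -{1}(up_sym H (fib_base h)) -trmx_inv mxE.
Qed.

Lemma pairing_bil x y : base D x -> pairing (b x) y = bil (a x) (Wv x) y.
Proof.
move=> Ox; have u := posdef_unit (up_pos H Ox).
by rewrite pairingE bilE /Wv mulmxKV.
Qed.

Lemma pairing_W x : base D x -> pairing (b x) (Wv x) = 1.
Proof.
move=> Ox; rewrite -(up_unit H Ox) bilE pairingE /Wv trmx_mul -mulmxA.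
by rewrite trmx_inv (up_sym H Ox).
Qed.

Lemma bil_W x : base D x -> bil (a x) (Wv x) (Wv x) = 1.
Proof. by move=> Ox; rewrite -pairing_bil // pairing_W. Qed.

Lemma ev_Gam i k l x y : fib D x y -> ev (Gam UF i k l) x y = christoffel a i k l x.
Proof.
move=> h; rewrite /Gam /christoffel evM // ev_half // ev_sum //; congr (_ * _).
apply: eq_bigr => s _; rewrite evM // ev_cometric // evB // evD //; congr (_ * (_ + _ - _));
  exact: ev_dX_coefR.
Qed.

Lemma ev_Db k l x y : fib D x y -> ev (Db UF k l) x y = cov_deriv a b k l x.
Proof.
move=> h; rewrite /Db /cov_deriv evB // ev_sum //; congr (_ - _); first exact: ev_dX_coefR.
by apply: eq_bigr => m _; rewrite (evM (Gam UF m k l) _ h) (ev_Gam _ _ _ h) ev_form.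
Qed.

Lemma ev_dX_Gam i k l m x y : fib D x y ->
  ev (X m (Gam UF i k l)) x y = partial m (christoffel a i k l) x.
Proof.
move=> h; have e : eqO D (fun x _ => christoffel a i k l x) (ev (Gam UF i k l)).
  by move=> x' y' h'; rewrite ev_Gam.
exact: esym (pd_ev (true, m) e h).
Qed.

Lemma ev_curv i j k l x y : fib D x y -> ev (curv UF i j k l) x y = riemann_tensor a i j k l x.
Proof.
move=> h; rewrite /curv /riemann_tensor evD // evB // ev_sum //.
congr (_ - _ + _); [exact: ev_dX_Gam|exact: ev_dX_Gam|].
apply: eq_bigr => m _; rewrite evB //.
by rewrite (evM (Gam UF i k m) _ h) (evM (Gam UF i l m) _ h) !(ev_Gam _ _ _ h).
Qed.

End UnitFormOf.

(** * The Finsler curvature of a Kropina metric in coordinates *)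

Section KropinaLocal.
Context {R : realType} {n : nat} (D : phase_domain R n)
  (a : 'rV[R]_n -> 'M[R]_n) (b : 'rV[R]_n -> 'rV[R]_n).
Hypothesis H : unit_pair (base D) a b.
Hypothesis hD : forall x y, fib D x y -> 0 < pairing (b x) y.
Notation A := (phaseR D).
Notation X := (dX A).
Notation Y := (dY A).
Notation ev := (@ev R n D).
Notation U := (UF H).

Lemma fib_neq0 x y : fib D x y -> y != 0.
Proof.
move=> /hD; apply: contraL => /eqP ->.
by rewrite pairingE trmx0 mulmx0 mxE ltxx.
Qed.

Lemma bil_gt0 x y : fib D x y -> 0 < bil (a x) y y.
Proof. by move=> h; apply: (up_pos H (fib_base h)); exact: fib_neq0 h. Qed.

Lemma ev_bform_neq0 x y : fib D x y -> ev (bform U) x y != 0.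
Proof. by move=> h; rewrite ev_bform // gt_eqF // hD. Qed.
Lemma ev_asq_neq0 x y : fib D x y -> ev (asq U) x y != 0.
Proof. by move=> h; rewrite ev_asq // gt_eqF // bil_gt0. Qed.

Definition ibR : A := invR ev_bform_neq0.
Definition iaR : A := invR ev_asq_neq0.
Lemma ibRK : ibR * bform U = 1. Proof. exact: invRK. Qed.
Lemma iaRK : iaR * asq U = 1. Proof. exact: invRK. Qed.

Lemma ev_ib x y : fib D x y -> ev ibR x y = (pairing (b x) y)^-1.
Proof. by move=> h; rewrite ev_mkreg // ev_bform. Qed.
Lemma ev_ia x y : fib D x y -> ev iaR x y = (bil (a x) y y)^-1.
Proof. by move=> h; rewrite ev_mkreg // ev_asq. Qed.

Notation FF := (kropF U ibR).
Notation ThG := (Th_kr U ibR iaR).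
Notation NG := (N_kr U ibR iaR).

Lemma ev_kropF x y : fib D x y -> ev FF x y = bil (a x) y y / pairing (b x) y.
Proof. by move=> h; rewrite (evM (asq U) ibR h) ev_asq // ev_ib. Qed.

Variable L : 'rV[R]_n -> 'rV[R]_n -> R.
Hypothesis hL : eqO D L (ev FF).

Lemma sq_ev : eqO D (sq L) (ev (FF * FF)).
Proof. by move=> x y h; rewrite /sq (hL h) (evM FF FF h) expr2. Qed.

Lemma ev_hessian k l x y : fib D x y ->
  fundamental_tensor L x y k l = ev (onehalf A * Y k (Y l (FF * FF))) x y.
Proof.
move=> h; rewrite mxE (evM (onehalf A) _ h) ev_half //; congr (_ * _).
exact: (pd_ev (false, k) (pd_ev (false, l) sq_ev) h).
Qed.

(** The quadratic form of the fundamental tensor is a sum of squares by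
    [hessian_form]; it is enough to evaluate this identity at constant
    vectors. *)
Lemma fundamental_unit x y : fib D x y -> fundamental_tensor L x y \in unitmx.
Proof.
move=> h; have Ox := fib_base h; have pos := up_pos H Ox.
rewrite -row_free_unit; apply: inj_row_free => v vg.
have be0 : pairing (b x) y != 0 by rewrite gt_eqF // hD.
have al0 := bil_gt0 h.
pose vA k : A := cstR D (v 0 k).
have ev_vA k : ev (vA k) x y = v 0 k by rewrite ev_mkreg.
have e := congr1 (fun f => ev f x y) (hessian_form ibRK vA).
have : bil (fundamental_tensor L x y) v v = 0 by rewrite bilE vg mul0mx mxE.
have -> : bil (fundamental_tensor L x y) v v =
    ev (\sum_k \sum_l onehalf A * Y k (Y l (FF * FF)) * vA k * vA l) x y.
  rewrite ev_sum //; apply: eq_bigr => k _; rewrite ev_sum //; apply: eq_bigr => l _.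
  rewrite ev_hessian // (evM _ (vA l) h) (evM _ (vA k) h).
  by congr (_ * _ * _); rewrite ev_vA.
rewrite {}e.
set t := (pairing (b x) y)^-1 * pairing (b x) v.
pose w := v - t *: y.
have ev_t : ev (\sum_m form U m * vA m) x y = pairing (b x) v.
  rewrite ev_sum //; apply: eq_bigr => m _.
  by rewrite (evM _ (vA m) h) ev_form // ev_vA.
set wA := fun k => vA k - ibR * (\sum_m form U m * vA m) * yc A k.
have ev_w k : ev (wA k) x y = w 0 k.
  rewrite evB // (evM _ (yc A k) h) (evM ibR _ h) ev_t ev_ib // ev_vA ev_yc //.
  by rewrite !mxE.
rewrite evD // (evM _ (\sum_k wA k * flat U wA k) h) evM //.
have -> : ev (\sum_k wA k * flat U wA k) x y = bil (a x) w w.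
  rewrite ev_sum //; apply: eq_bigr => k _.
  rewrite (evM (wA k) _ h) ev_sum // mulr_sumr; apply: eq_bigr => l _.
  by rewrite (evM (metric U k l) (wA l) h) !ev_w ev_metric //; ring.
have c0 : 0 < ev (2 * asq U * ibR * ibR) x y.
  rewrite (evM _ ibR h) (evM _ ibR h) (evM 2 (asq U) h) ev_nat // ev_asq // ev_ib //.
  by rewrite !mulr_gt0 // invr_gt0 hD.
set s := ev (\sum_k vA k * Y k FF) x y => /eqP.
rewrite paddr_eq0; last 2 first.
- by rewrite -expr2 sqr_ge0.
- by rewrite mulr_ge0 ?(ltW c0) // bil_ge0.
rewrite -expr2 sqrf_eq0 => /andP[/eqP s0]; rewrite mulf_eq0 gt_eqF //= => /eqP w0.
have vE : v = t *: y by apply/eqP; rewrite -subr_eq0; apply/eqP; apply: bil_eq0 pos w0.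
(* By the vanishing of the second square v = t y, and then the first square is
   t^2 F^2 by Euler's theorem. *)
suff t0 : t = 0 by rewrite vE t0 scale0r.
have sE : s = t * ev FF x y.
  rewrite -(euler_kropF ibRK) /euler act_sum /s !ev_sum // mulr_sumr; apply: eq_bigr => k _.
  rewrite mul0r add0r (evM (vA k) _ h) (evM (yc A k) _ h) ev_vA ev_yc // {1}vE mxE.
  by rewrite mulrA.
move: s0; rewrite sE => /eqP; rewrite mulf_eq0 => /orP[/eqP//|].
by rewrite ev_kropF // mulf_eq0 invr_eq0 gt_eqF //= (negbTE be0).
Qed.

Definition Gspray i : A := onehalf A * ThG i.

(** The linear system with the fundamental tensor as matrix that defines the
    spray is solved by the coefficients of [euler_lagrange], and its solution
    is unique. *)
Lemma ev_spray i : eqO D (spray L i) (ev (Gspray i)).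
Proof.
move=> x y h; rewrite /spray (evM (onehalf A) _ h) ev_half //.
pose g := fundamental_tensor L x y.
pose E := \col_l (\sum_m dx m (dy l (sq L)) x y * y 0 m - dx l (sq L) x y).
pose T := \col_m (2 * ev (ThG m) x y).
have gT : g *m T = E.
  apply/colP => l; rewrite !mxE.
  have e := congr1 (fun f => ev f x y) (euler_lagrange ibRK iaRK l).
  have two0 : (2 : R) != 0 by rewrite pnatr_eq0.
  apply: (mulfI two0); rewrite (evM 2 _ h) (evM 2 _ h) ev_nat // in e.
  transitivity (2 * ev (\sum_m onehalf A * Y l (Y m (FF * FF)) * (2 * ThG m)) x y).
    congr (_ * _); rewrite ev_sum //; apply: eq_bigr => m _.
    by rewrite (evM _ (2 * ThG m) h) (evM 2 _ h) ev_nat // /g ev_hessian // !mxE.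
  rewrite e; congr (_ * _); rewrite evB // ev_sum //; congr (_ - _); last first.
    exact: esym (pd_ev (true, l) sq_ev h).
  apply: eq_bigr => m _; rewrite (evM _ (yc A m) h) ev_yc //; congr (_ * _).
  exact: esym (pd_ev (true, m) (pd_ev (false, l) sq_ev) h).
have TE : T = invmx g *m E by rewrite -gT mulKmx // fundamental_unit.
have -> : \sum_l invmx g i l * (\sum_m dx m (dy l (sq L)) x y * y 0 m - dx l (sq L) x y)
   = T i 0.
  by rewrite TE mxE; apply: eq_bigr => l _; rewrite !mxE.
rewrite mxE; lra.
Qed.

Lemma N_kr_Gspray i k : NG i k = Y k (Gspray i).
Proof. by rewrite /Gspray (derM _ (onehalf A)) der_onehalf mul0r add0r. Qed.

(** The formula defining the curvature is [jacobi_end] for T = 2 G and N =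
    dG/dy. *)
Lemma ev_riemann i k x y : fib D x y ->
  riemann_curvature L i k x y = ev (jacobi_end ThG NG i k) x y.
Proof.
move=> h; rewrite /riemann_curvature /jacobi_end.
have eX j : dx j (spray L i) x y = ev (X j (Gspray i)) x y.
  exact: (pd_ev (true, j) (ev_spray i) h).
have eY j i' : dy j (spray L i') x y = ev (Y j (Gspray i')) x y.
  exact: (pd_ev (false, j) (ev_spray i') h).
have eXY j : dx j (dy k (spray L i)) x y = ev (X j (Y k (Gspray i))) x y.
  exact: (pd_ev (true, j) (pd_ev (false, k) (ev_spray i)) h).
have eYY j : dy j (dy k (spray L i)) x y = ev (Y j (Y k (Gspray i))) x y.
  exact: (pd_ev (false, j) (pd_ev (false, k) (ev_spray i)) h).
have -> : X k (ThG i) = 2 * X k (Gspray i).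
  by rewrite /Gspray (derM _ (onehalf A)) der_onehalf mul0r add0r mulrA onehalfK mul1r.
rewrite spray_derE; under [\sum_m NG i m * _]eq_bigr do rewrite !N_kr_Gspray.
rewrite N_kr_Gspray.
have -> : \sum_m ThG m * Y m (Y k (Gspray i)) = 2 * \sum_m Gspray m * Y m (Y k (Gspray i)).
  rewrite mulr_sumr; apply: eq_bigr => m _.
  by rewrite /Gspray !mulrA onehalfK mul1r.
have -> : forall p q r t : regfun D, p - (q - r) - t = p - q + r - t by move=> *; ring.
rewrite evB // evD // evB // (evM 2 (X k _) h) (evM 2 (\sum_m _) h) ev_nat //.
rewrite !ev_sum // eX; congr (_ - _ + _ * _ - _); apply: eq_bigr => m _.
- by rewrite (evM (yc A m) _ h) ev_yc // eXY.
- by rewrite (evM (Gspray m) _ h) eYY (ev_spray m h).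
- by rewrite (evM (Y m (Gspray i)) _ h) !eY.
Qed.

Lemma ev_ricci x y : fib D x y ->
  ricci L x y = ev (\sum_k jacobi_end ThG NG k k) x y.
Proof. by move=> h; rewrite ev_sum //; apply: eq_bigr => k _; rewrite ev_riemann. Qed.

End KropinaLocal.

(** * Weak Einstein metrics have a Killing form *)

Section PolyFacts.
Context {R : realType}.

(** The field is infinite. *)
Lemma poly_ext (p q : {poly R}) : (forall t, p.[t] = q.[t]) -> p = q.
Proof.
move=> e; apply/eqP; rewrite -subr_eq0; apply: contraT => nz.
have := max_poly_roots nz (rs := [seq i%:R | i <- iota 0 (size (p - q))]).
rewrite size_map size_iota ltnn; apply.
  by apply/allP => t _; rewrite /root !hornerE e subrr.
rewrite map_inj_uniq ?iota_uniq // => i j /eqP.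
by rewrite eqr_nat => /eqP.
Qed.

(** The quotient P has degree at most 2. Comparing coefficients, P has no
    constant and no linear term, so the coefficient of t^3 gives B C = 0, and
    those of t^2 and t^4 give C^2 = m B^2. *)
Lemma square_multiple (B C m : R) (P : {poly R}) : 0 < m ->
  (forall t, (B * t + C * t ^+ 2) ^+ 2 = (1 + m * t ^+ 2) * P.[t]) -> B = 0 /\ C = 0.
Proof.
move=> m0 h.
have e : (B *: 'X + C *: 'X^2) ^+ 2 = (1 + m *: 'X^2) * P.
  apply: poly_ext => t; transitivity ((B * t + C * t ^+ 2) ^+ 2).
    by rewrite !hornerE; ring.
  by rewrite h !hornerE; ring.
have q3 : size (1 + m *: 'X^2 : {poly R}) = 3.
  by rewrite addrC size_polyDl ?size_scale ?gt_eqF // ?size_polyXn // size_poly1.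
have sP : (size P <= 3)%N.
  have [->|P0] := eqVneq P 0; first by rewrite size_poly0.
  have s1 : size ((1 + m *: 'X^2) * P) = (size P).+2.
    by rewrite size_mul // -?size_poly_eq0 q3.
  have s2 : (size ((B *: 'X + C *: 'X^2) ^+ 2 : {poly R}) <= 5)%N.
    have s : (size (B *: 'X + C *: 'X^2 : {poly R})%R <= 3)%N.
      apply: leq_trans (size_polyD _ _) _; rewrite geq_max; apply/andP; split.
        by apply: leq_trans (size_scale_leq _ _) _; rewrite size_polyX.
      by apply: leq_trans (size_scale_leq _ _) _; rewrite size_polyXn.
    rewrite expr2 (leq_trans (size_polyMleq _ _)) //.
    by move: s; case: size => [|[|[|[|k]]]].
  by move: s2; rewrite e s1.
have c i : ((B *: 'X + C *: 'X^2) ^+ 2 : {poly R})`_i = P`_i + m * (if (i < 2)%N then 0 else P`_(i - 2)).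
  by rewrite e mulrDl mul1r coefD -scalerAl coefZ coefXnM.
have d : (B *: 'X + C *: 'X^2) ^+ 2 = (B ^+ 2) *: 'X^2 + (2 * B * C) *: 'X^3 + (C ^+ 2) *: 'X^4 :> {poly R}.
  by apply: poly_ext => t; rewrite !(hornerD, hornerZ, horner_exp, hornerXn, hornerX); ring.
have c0 := c 0%N; have c2 := c 2%N; have c3 := c 3%N; have c4 := c 4%N; have c1 := c 1%N.
have P3 : P`_3 = 0 by apply: nth_default.
have P4 : P`_4 = 0 by apply: nth_default; apply: leq_trans sP _.
move: c0 c1 c2 c3 c4; rewrite d !coefD !coefZ !coefXn /= P3 P4 !(mulr0, mulr1, addr0, add0r).
move=> c0 c1 c2 c3 c4; rewrite -c0 mulr0 addr0 in c2; rewrite -c1 mulr0 in c3; rewrite -c2 in c4.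
have BC : B * C = 0 by lra.
move/eqP: BC; rewrite mulf_eq0 => /orP[/eqP B0|/eqP C0].
  split=> //; move: c4; rewrite B0 expr0n mulr0 => /eqP.
  by rewrite sqrf_eq0 => /eqP.
split=> //; move: c4; rewrite C0 expr0n /= => /esym/eqP.
by rewrite mulf_eq0 gt_eqF //= sqrf_eq0 => /eqP.
Qed.
End PolyFacts.

Section WeakEinstein.
Context {R : realType} {n : nat} (D : phase_domain R n)
  (a : 'rV[R]_n -> 'M[R]_n) (b : 'rV[R]_n -> 'rV[R]_n).
Hypothesis H : unit_pair (base D) a b.
Hypothesis hD : forall x y, fib D x y -> 0 < pairing (b x) y.
Hypothesis hD' : forall x y, base D x -> 0 < pairing (b x) y -> fib D x y.
Notation A := (phaseR D).
Notation ev := (@ev R n D).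
Notation U := (UF H).
Notation ib := (ibR H hD).
Notation ia := (iaR H hD).
Variables (x u : 'rV[R]_n).
Hypotheses (Ox : base D x) (bu : pairing (b x) u = 0).
Let w : 'rV[R]_n := Wv a b x.

Lemma line_pairing t : pairing (b x) (w + t *: u) = 1.
Proof. by rewrite pairingDr pairingZr bu mulr0 addr0 (pairing_W H). Qed.
Lemma line_fib t : fib D x (w + t *: u).
Proof. by apply: hD' => //; rewrite line_pairing. Qed.

(** Elements whose derivatives in y vanish are locally constant in y; along a
    line contained in the domain they are constant. *)
Lemma basic_line (c : A) t : basic c -> ev c x (w + t *: u) = ev c x w.
Proof.
move=> hc; rewrite -[in RHS](addr0 w) -(scale0r u).
apply: (@is_derive_0_is_cst R (fun t : R => ev c x (w + t *: u))) => s.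
have loc : \forall z \near (w + s *: u), ev c x z = ev c x (w + s *: u).
  apply: (@partial0_locally_cst _ _ (fib D x)); [exact: fib_openY|exact: line_fib| |].
    by move=> z k h; exact: (reg_able (false, k) (reg_ev c) h).
  move=> z k h; have := ev_dR (false, k) c h.
  by rewrite -[dR (false, k) c]/(dY A k c) hc ev0.
have cont : {for s, continuous (fun t : R => w + t *: u)}.
  by apply: cvgD; [exact: cvg_cst|apply: cvgZr_tmp; exact: cvg_id].
refine (near_eq_is_derive (f := cst (ev c x (w + s *: u))) _ (is_derive_cst _ _ _)).
have := cont _ loc; rewrite nbhs_simpl /=; apply: filterS => t' /= e; exact: esym.
Qed.

(** On the line, functions of the position are constant, the coordinates are
    affine functions of t and the inverse of beta is 1. *)
Lemma polar_line (g : A) : polar ib g ->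
  exists p : {poly R}, forall t, ev g x (w + t *: u) = p.[t].
Proof.
elim=> {g} [c hc|k||f g _ [p hp] _ [q hq]|f g _ [p hp] _ [q hq]].
- by exists (ev c x w)%:P => t; rewrite hornerC basic_line.
- exists ((w 0 k)%:P + (u 0 k) *: 'X) => t.
  by rewrite !hornerE (ev_yc k (line_fib t)) !mxE mulrC.
- by exists 1 => t; rewrite hornerC (ev_ib H hD (line_fib t)) line_pairing invr1.
- by exists (p + q) => t; rewrite hornerD -hp -hq (evD _ _ (line_fib t)).
- by exists (p * q) => t; rewrite hornerM -hp -hq (evM _ _ (line_fib t)).
Qed.

Variables (L : 'rV[R]_n -> 'rV[R]_n -> R) (th : 'rV[R]_n) (sg : R).
Hypothesis hL : eqO D L (ev (kropF U ib)).
Hypothesis n_ge2 : (2 <= n)%N.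
Hypothesis einstein : forall y, 0 < pairing (b x) y ->
  ricci L x y = n.-1%:R * (3 * pairing th y / L x y + sg) * L x y ^+ 2.

Let C : 'M[R]_n := \matrix_(k, l) cov_deriv a b k l x.

(** The first index of [cov_deriv] is that of the form, so this is the
    derivative of |b| = 1. *)
Lemma cov_deriv_W v : bil C w v = 0.
Proof.
rewrite /bil exchange_big big1 // => l _ /=.
transitivity (v 0 l * ev (\sum_k W U k * Db U k l) x w); last first.
  have h : fib D x w by have := line_fib 0; rewrite scale0r addr0.
  by rewrite W_Db ev0 // mulr0.
have h : fib D x w by have := line_fib 0; rewrite scale0r addr0.
rewrite ev_sum // mulr_sumr; apply: eq_bigr => k _.
rewrite (evM (W U k) _ h) (ev_W H k h) (ev_Db H k l h) mxE -/w; ring.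
Qed.

Lemma r00_line t : ev (r00 U) x (w + t *: u) = bil C u w * t + bil C u u * t ^+ 2.
Proof.
have h := line_fib t.
transitivity (bil C (w + t *: u) (w + t *: u)).
  rewrite r00E ev_sum //; apply: eq_bigr => k _; rewrite ev_sum //; apply: eq_bigr => l _.
  by rewrite (evM _ (yc A l) h) (evM _ (yc A k) h) (ev_Db H k l h) !(ev_yc _ h) [C k l]mxE.
rewrite bilDl cov_deriv_W add0r bilZl bilDr bilZr; ring.
Qed.

(** On the line F = alpha^2 = 1 + m t^2, with m = |u|^2. Multiplying the weak
    Einstein equation by alpha^4 shows that alpha^2 divides 3 (n - 1) pnum^2,
    and pnum = - r - (1/2) alpha^2 c(W) on the line; so alpha^2 divides
    r^2. *)
Lemma weak_einstein_line : u != 0 -> bil C u w = 0 /\ bil C u u = 0.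
Proof.
move=> u0; set m := bil (a x) u u.
have m0 : 0 < m by apply: (up_pos H Ox).
have pE := polar_line (polar_ricci_reg (ibRK H hD)).
have [pR hR] := pE; have [pU hU] := polar_line (polar_pnum (ibRK H hD)).
have [pS hS] := polar_line (polar_S_reg_pnum (ibRK H hD)).
have [pc hc] := polar_line (polar_curlW (ibRK H hD)).
have alL t : bil (a x) (w + t *: u) (w + t *: u) = 1 + m * t ^+ 2.
  rewrite !(bilDl, bilDr, bilZl, bilZr) (bil_sym u w (up_sym H Ox)) -(pairing_bil H u Ox).
  rewrite bu (bil_W H Ox) -/m; ring.
have FL t : L x (w + t *: u) = 1 + m * t ^+ 2.
  by rewrite (hL (line_fib t)) (ev_kropF H hD (line_fib t)) alL line_pairing divr1.
have q0 t : 1 + m * t ^+ 2 != 0.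
  by rewrite gt_eqF // ltr_wpDr // mulr_ge0 ?sqr_ge0 // ltW.
have UUL t : pU.[t] = - (bil C u w * t + bil C u u * t ^+ 2 + 2^-1 * (1 + m * t ^+ 2) * pc.[t]).
  have h := line_fib t.
  rewrite -hU -hc /pnum (evN _ h) (evM (lam U ib) _ h) (ev_bform H h) line_pairing mulr1.
  rewrite /lam (evD (r00 U) _ h) (evM (halfF U ib) _ h) r00_line.
  rewrite /halfF (evM (onehalf A) _ h) (ev_half h) (ev_kropF H hD h) alL line_pairing divr1.
  by [].
have nE : (n.-1%:R : R) = n%:R - 1.
  by rewrite -subn1 natrB // (leq_trans _ n_ge2).
(* In dimension 1 the Ricci curvature vanishes and carries no information. *)
have n1 : (n%:R - 1 : R) != 0 by rewrite -nE pnatr_eq0 -lt0n -ltnS prednK // (leq_trans _ n_ge2).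
have main t : 3 * (n%:R - 1) * pU.[t] ^+ 2 = (1 + m * t ^+ 2) * ((n%:R - 1) * pS.[t]
   + (1 + m * t ^+ 2) * ((n%:R - 1) * (3 * (pairing th w + t * pairing th u)
      * (1 + m * t ^+ 2) + sg * (1 + m * t ^+ 2) ^+ 2) - pR.[t])).
  have h := line_fib t.
  have := @einstein (w + t *: u); rewrite line_pairing ltr01 => /(_ isT).
  rewrite (ev_ricci hL h) (ricci_pole (ibRK H hD) (iaRK H hD)) (evD _ _ h) hR.
  rewrite (evM (n%:R - 1) _ h) (evB n%:R 1 h) (ev_nat _ h) (ev1 h).
  rewrite (evB _ (S_reg U ib (pnum U ib) * ia) h) (evM (S_reg U ib (pnum U ib)) ia h) hS.
  rewrite (evM _ (ia * ia) h) (evM 3 _ h) (ev_nat _ h) (evM (pnum U ib) _ h) hU.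
  rewrite (evM ia ia h) (ev_ia H hD h) alL FL nE pairingDr pairingZr.
  set q := 1 + m * t ^+ 2 => e.
  have qq : q != 0 by exact: q0.
  have -> : pR.[t] = (n%:R - 1) * (3 * (pairing th w + t * pairing th u) / q + sg) * q ^+ 2
     - (n%:R - 1) * (3 * (pU.[t] * pU.[t]) * (q^-1 / q) - pS.[t] / q).
    by rewrite -e addrK.
  by field.
have n3 : 3 * (n%:R - 1) != 0 :> R by rewrite mulf_neq0 // pnatr_eq0.
pose q : {poly R} := 1 + m *: 'X^2.
(* The quotient of r^2 by 1 + m t^2. *)
pose P := (3 * (n%:R - 1))^-1 *: ((n%:R - 1) *: pS
   + q * ((n%:R - 1) *: (3 *: (((pairing th w)%:P + pairing th u *: 'X) * q) + sg *: q ^+ 2) - pR))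
   + pc * pU + 4^-1 *: (q * pc ^+ 2).
apply: (@square_multiple R _ _ m P m0) => t.
have hP : P.[t] = (3 * (n%:R - 1))^-1 * ((n%:R - 1) * pS.[t]
   + (1 + m * t ^+ 2) * ((n%:R - 1) * (3 * ((pairing th w + pairing th u * t) * (1 + m * t ^+ 2))
      + sg * (1 + m * t ^+ 2) ^+ 2) - pR.[t]))
   + pc.[t] * pU.[t] + 4^-1 * ((1 + m * t ^+ 2) * pc.[t] ^+ 2).
  by rewrite /P /q !hornerE; ring.
rewrite hP; clear hP.
have -> : bil C u w * t + bil C u u * t ^+ 2 = - (pU.[t] + 2^-1 * (1 + m * t ^+ 2) * pc.[t]).
  by rewrite UUL; ring.
have -> : forall p r : R, (- (p + r)) ^+ 2 = (3 * (n%:R - 1))^-1 * (3 * (n%:R - 1) * p ^+ 2) + 2 * p * r + r ^+ 2.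
  by move=> p r; rewrite mulKf //; ring.
rewrite main; field.
by rewrite n1.
Qed.

End WeakEinstein.

Lemma bil_delta (R : realType) n (C : 'M[R]_n) k l :
  bil C (delta_mx 0 k) (delta_mx 0 l) = C k l.
Proof. by rewrite bilE -rowE trmx_delta -colE !mxE. Qed.

Section KillingFromEinstein.
Context {R : realType} {n : nat} (D : phase_domain R n)
  (a : 'rV[R]_n -> 'M[R]_n) (b : 'rV[R]_n -> 'rV[R]_n).
Hypothesis H : unit_pair (base D) a b.
Hypothesis hD : forall x y, fib D x y -> 0 < pairing (b x) y.
Hypothesis hD' : forall x y, base D x -> 0 < pairing (b x) y -> fib D x y.
Notation ev := (@ev R n D).

(** Split v into its component along W and a vector u orthogonal to W:
    [weak_einstein_line] treats the values at (u, u) and (u, W), and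
    [cov_deriv_W] those with W in first position. *)
Lemma weak_einstein_killing (L : 'rV[R]_n -> 'rV[R]_n -> R) x th sg :
  eqO D L (ev (kropF (UF H) (ibR H hD))) -> (2 <= n)%N -> base D x ->
  (forall y, 0 < pairing (b x) y ->
    ricci L x y = n.-1%:R * (3 * pairing th y / L x y + sg) * L x y ^+ 2) ->
  forall k l, cov_deriv a b k l x + cov_deriv a b l k x = 0.
Proof.
move=> hL n2 Ox einst.
pose C : 'M[R]_n := \matrix_(k, l) cov_deriv a b k l x.
have r0 v : bil C v v = 0.
  pose u := v - pairing (b x) v *: Wv a b x.
  have bu : pairing (b x) u = 0.
    by rewrite pairingDr pairingNr pairingZr (pairing_W H Ox) mulr1 subrr.
  have vE : v = pairing (b x) v *: Wv a b x + u by rewrite addrC subrK.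
  clearbody u; move: vE; move: (pairing (b x) v) => be ->.
  have [Cuw Cuu] : bil C u (Wv a b x) = 0 /\ bil C u u = 0.
    have [->|u0] := eqVneq u 0; last exact: (weak_einstein_line hD' Ox bu hL n2 einst u0).
    by rewrite -(scale0r 0) !bilZl !mul0r.
  rewrite !(bilDl, bilDr, bilZl, bilZr) Cuw Cuu.
  rewrite !(cov_deriv_W H hD' Ox bu); ring.
move=> k l; have := r0 (delta_mx 0 k + delta_mx 0 l).
rewrite bilDl !bilDr !r0 add0r addr0 !bil_delta.
by rewrite [C k l]mxE [C l k]mxE.
Qed.

Lemma killing_r00 :
  (forall x, base D x -> forall k l, cov_deriv a b k l x + cov_deriv a b l k x = 0) ->
  r00 (UF H) = 0.
Proof.
move=> kil; apply: ev_inj => x y h; rewrite ev0 // r00E.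
rewrite -[LHS](_ : bil (\matrix_(k, l) cov_deriv a b k l x) y y = _); last first.
  rewrite ev_sum //; apply: eq_bigr => k _; rewrite ev_sum //; apply: eq_bigr => l _.
  rewrite (evM _ (yc (phaseR D) l) h) (evM _ (yc (phaseR D) k) h) (ev_Db H k l h) !(ev_yc _ h).
  by rewrite [fun_of_matrix _ k l]mxE.
set C := \matrix_(k, l) _.
suff : bil C y y = - bil C y y by move=> e; lra.
rewrite {2}/bil exchange_big -sumrN; apply: eq_bigr => k _ /=.
rewrite -sumrN; apply: eq_bigr => l _; rewrite !mxE.
have := kil x (fib_base h) k l => /eqP; rewrite addr_eq0 => /eqP ->; ring.
Qed.

Hypothesis killing : r00 (UF H) = 0.

Lemma Th_kr_Th_reg i : Th_kr (UF H) (ibR H hD) (iaR H hD) i = Th_reg (UF H) (ibR H hD) i.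
Proof.
by rewrite /Th_kr /pfactor (lam0 _ killing) mul0r mul0r oppr0 mulr0 mul0r addr0.
Qed.

End KillingFromEinstein.

(** * Constant flag curvature *)

(** The Cauchy-Schwarz inequality is strict for independent vectors: the
    difference, multiplied by |v|^2, is the squared norm of |v|^2 u - (u, v)
    v. *)
Lemma cauchy_strict (R : realType) n (M : 'M[R]_n) (u v : 'rV[R]_n) : M^T = M -> posdef M ->
  row_free (col_mx u v) -> bil M u u * bil M v v - bil M u v ^+ 2 != 0.
Proof.
move=> sM pM fr.
have free c d : c *: u + d *: v = 0 -> c = 0 /\ d = 0.
  move=> e; have e' : row_mx c%:M d%:M = 0 :> 'M[R]_(1, 1 + 1).
    by apply: (row_free_inj fr); rewrite mul0mx mul_row_col !mul_scalar_mx e.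
  split.
    have := congr1 (fun N : 'M[R]_(1, 1 + 1) => lsubmx N 0 0) e'.
    by rewrite row_mxKl !mxE eqxx mulr1n.
  have := congr1 (fun N : 'M[R]_(1, 1 + 1) => rsubmx N 0 0) e'.
  by rewrite row_mxKr !mxE eqxx mulr1n.
have v0 : v != 0.
  apply/eqP => e; have z : 0 *: u + 1 *: v = 0 by rewrite e scaler0 scale0r addr0.
  by have [_ /eqP] := free _ _ z; rewrite oner_eq0.
pose w := bil M v v *: u - bil M u v *: v.
have w0 : w != 0.
  apply/eqP => e; have z : bil M v v *: u + (- bil M u v) *: v = 0 by rewrite scaleNr.
  by have [e' _] := free _ _ z; have := pM v v0; rewrite e' ltxx.
have := pM w w0; rewrite /w !(bilDl, bilDr, bilNl, bilNr, bilZl, bilZr) (bil_sym v u sM).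
move=> h; apply/eqP => e; move: h.
set t := (X in 0 < X).
have -> : t = bil M v v * (bil M u u * bil M v v - bil M u v ^+ 2) by rewrite /t; ring.
by rewrite e mulr0 ltxx.
Qed.

Section ConstantFlag.
Context {R : realType} {n : nat} (D : phase_domain R n)
  (a : 'rV[R]_n -> 'M[R]_n) (b : 'rV[R]_n -> 'rV[R]_n).
Hypothesis H : unit_pair (base D) a b.
Hypothesis hD : forall x y, fib D x y -> 0 < pairing (b x) y.
Hypothesis hD' : forall x y, base D x -> 0 < pairing (b x) y -> fib D x y.
Hypothesis killing : r00 (UF H) = 0.
Notation A := (phaseR D).
Notation Y := (dY A).
Notation ev := (@ev R n D).
Notation U := (UF H).
Notation ib := (ibR H hD).
Notation ia := (iaR H hD).
Variables (L : 'rV[R]_n -> 'rV[R]_n -> R) (K : R).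
Hypothesis hL : eqO D L (ev (kropF U ib)).
Hypothesis flag : forall x y k l, fib D x y ->
  riemann_curvature L k l x y =
  K * (L x y ^+ 2 * (k == l)%:R - L x y * dy l L x y * y 0 k).

Lemma ev_cstR c x y : fib D x y -> ev (cstR D c) x y = c.
Proof. by move=> h; rewrite ev_mkreg. Qed.

(** As F = 2 f, constant flag curvature K in terms of F is constant flag
    curvature 4 K in terms of f. *)
Lemma flag_jacobi i k : jacobi_end (Th_reg U ib) (N_reg U ib) i k =
  cstR D (4 * K) * (halfF U ib * halfF U ib * (i == k)%:R - halfF U ib * Y k (halfF U ib) * yc A i).
Proof.
have -> : jacobi_end (Th_reg U ib) (N_reg U ib) i k = jacobi_end (Th_kr U ib ia) (N_kr U ib ia) i k.
  have T j : Th_kr U ib ia j = Th_reg U ib j by rewrite Th_kr_Th_reg.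
  have Ne j m : N_kr U ib ia j m = N_reg U ib j m by rewrite /N_kr T.
  rewrite /jacobi_end T Ne; congr (_ - _ - _).
    rewrite !spray_derE; congr (_ - _); apply: eq_bigr => m _; by rewrite T.
  by apply: eq_bigr => m _; rewrite !Ne.
apply: ev_inj => x y h; rewrite -(ev_riemann hL i k h) flag //.
have e1 : L x y = 2 * ev (halfF U ib) x y.
  by rewrite (hL h) -(halfF_double U ib) (evM 2 _ h) ev_nat.
have e2 : dy k L x y = 2 * ev (Y k (halfF U ib)) x y.
  have -> : dy k L x y = ev (Y k (kropF U ib)) x y by exact: (pd_ev (false, k) hL h).
  by rewrite -(halfF_double U ib) (derM (Y k) 2) der_nat mul0r add0r (evM 2 _ h) ev_nat.
rewrite e1 e2 (evM (cstR D _) _ h) (ev_cstR _ h) evB // (evM _ (i == k)%:R h).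
rewrite (evM (halfF U ib) (halfF U ib) h) (evM _ (yc A i) h) (evM (halfF U ib) _ h) ev_yc //.
by rewrite ev_nat //; ring.
Qed.

(** Given v with b(v) >= 0 and of norm s, the direction y = v + s W lies in
    the cone, and the navigation data there are f = s and z = v. The case b(v)
    < 0 follows because both sides are even in v. *)
Lemma flag_riemann_tensor x (v : 'rV[R]_n) i k : base D x ->
  \sum_j \sum_l riemann_tensor a i j k l x * v 0 j * v 0 l =
  4 * K * (bil (a x) v v * (i == k)%:R - (\sum_l a x k l * v 0 l) * v 0 i).
Proof.
move=> Ox; have pos := up_pos H Ox.
wlog bv : v / 0 <= pairing (b x) v.
  move=> h; have [/h//|bv] := leP 0 (pairing (b x) v).
  have := h (- v); rewrite pairingNr oppr_ge0 => /(_ (ltW bv)) e.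
  move: e; rewrite bilNl bilNr opprK mxE => e.
  transitivity (\sum_j \sum_l riemann_tensor a i j k l x * (- v) 0 j * (- v) 0 l).
    by apply: eq_bigr => j _; apply: eq_bigr => l _; rewrite !mxE; ring.
  rewrite e; congr (_ * (_ - _)).
  rewrite (_ : \sum_l a x k l * (- v) 0 l = - \sum_l a x k l * v 0 l) ?mulrNN //.
  by rewrite -sumrN; apply: eq_bigr => l _; rewrite mxE mulrN.
have [->|v0] := eqVneq v 0.
  rewrite big1; last first.
    by move=> j _; rewrite big1 // => l _; rewrite !mxE !mulr0.
  by rewrite bilE !mul0mx !mxE !(mul0r, mulr0) subrr mulr0.
set w := Wv a b x; set s := Num.sqrt (bil (a x) v v).
have s0 : 0 < s by rewrite sqrtr_gt0 pos.
have ss : s * s = bil (a x) v v by rewrite -expr2 sqr_sqrtr // ltW // pos.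
pose y := v + s *: w.
have by_ : pairing (b x) y = pairing (b x) v + s.
  by rewrite pairingDr pairingZr (pairing_W H Ox) mulr1.
have h : fib D x y by apply: hD' => //; rewrite by_ ltr_wpDl.
have fE : ev (halfF U ib) x y = s.
  rewrite /halfF (evM (onehalf A) _ h) (ev_half h) (ev_kropF H hD h) by_.
  have -> : bil (a x) y y = 2 * s * (pairing (b x) v + s).
    rewrite /y !(bilDl, bilDr, bilZl, bilZr) (bil_sym v w (up_sym H Ox)).
    rewrite -(pairing_bil H v Ox) (bil_W H Ox) -ss; ring.
  have nz : pairing (b x) v + s != 0 by rewrite gt_eqF // ltr_wpDl.
  by field.
have zE j : ev (znav U ib j) x y = v 0 j.
  rewrite evB // (evM (halfF U ib) _ h) fE (ev_yc _ h) (ev_W H _ h) !mxE; ring.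
have := constant_curvature (ibRK H hD) (iaRK H hD) killing flag_jacobi i k.
move=> /(congr1 (fun f => ev f x y)).
rewrite (evM (cstR D _) _ h) (ev_cstR _ h) evB // (evM _ (i == k)%:R h) (ev_nat _ h).
rewrite (evM _ (znav U ib i) h) zE.
have lz m : ev (flat U (znav U ib) m) x y = \sum_l a x m l * v 0 l.
  rewrite ev_sum //; apply: eq_bigr => l _.
  by rewrite (evM (metric U m l) _ h) (ev_metric H _ _ h) zE.
rewrite lz.
have -> : ev (\sum_m znav U ib m * flat U (znav U ib) m) x y = bil (a x) v v.
  rewrite ev_sum //; apply: eq_bigr => m _.
  rewrite (evM (znav U ib m) _ h) zE lz mulr_sumr; apply: eq_bigr => l _; ring.
move=> <-; rewrite ev_sum //; apply: eq_bigr => j _; rewrite ev_sum //.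
apply: eq_bigr => l _.
by rewrite (evM _ (znav U ib l) h) (evM _ (znav U ib j) h) (ev_curv H _ _ _ _ h) !zE.
Qed.

Lemma flag_sectional x u v : base D x -> row_free (col_mx u v) ->
  sectional_curvature a x u v = 4 * K.
Proof.
move=> Ox fr; rewrite /sectional_curvature.
have nz := cauchy_strict (up_sym H Ox) (up_pos H Ox) fr.
rewrite -[RHS](mulfK nz); congr (_ / _).
transitivity (\sum_i \sum_k (\sum_m a x i m * u 0 m) * u 0 k *
   \sum_j \sum_l riemann_tensor a i j k l x * v 0 j * v 0 l).
  apply: eq_bigr => i _; rewrite exchange_big; apply: eq_bigr => k _ /=.
  rewrite mulr_sumr; apply: eq_bigr => j _; rewrite mulr_sumr; apply: eq_bigr => l _.
  rewrite !mulr_suml; apply: eq_bigr => m _; ring.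
under eq_bigr do under eq_bigr do rewrite flag_riemann_tensor //.
have auu : bil (a x) u u = \sum_i (\sum_m a x i m * u 0 m) * u 0 i.
  by apply: eq_bigr => i _; rewrite mulr_suml; apply: eq_bigr => m _; ring.
have auv : bil (a x) u v = \sum_i (\sum_m a x i m * u 0 m) * v 0 i.
  rewrite (bil_sym u v (up_sym H Ox)).
  by apply: eq_bigr => i _; rewrite mulr_suml; apply: eq_bigr => m _; ring.
have avu : bil (a x) u v = \sum_k u 0 k * (\sum_l a x k l * v 0 l).
  by apply: eq_bigr => i _; rewrite mulr_sumr; apply: eq_bigr => m _; ring.
transitivity (4 * K * (bil (a x) v v * bil (a x) u u - bil (a x) u v * bil (a x) u v)); last by ring.
have uv2 : bil (a x) u v * bil (a x) u v = \sum_i \sum_k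
    (\sum_m a x i m * u 0 m) * v 0 i * (u 0 k * \sum_l a x k l * v 0 l).
  by rewrite {1}auv avu big_distrlr.
rewrite uv2 auu; clear uv2 auu auv avu.
rewrite [bil (a x) v v * _]mulr_sumr -sumrB mulr_sumr.
apply: eq_bigr => i _.
set ai := \sum_m a x i m * u 0 m.
transitivity (4 * K * (bil (a x) v v * (ai * \sum_k (i == k)%:R * u 0 k) -
  \sum_k ai * v 0 i * (u 0 k * \sum_l a x k l * v 0 l))).
  rewrite mulr_sumr [bil (a x) v v * _]mulr_sumr -sumrB mulr_sumr.
  by apply: eq_bigr => k _; ring.
have -> : \sum_k (i == k)%:R * u 0 k = u 0 i.
  rewrite (bigD1 i) //= eqxx mul1r big1 ?addr0 // => k ki.
  by rewrite eq_sym (negbTE ki) mul0r.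
rewrite -mulr_sumr; congr (_ * (_ - _)); ring.
Qed.

End ConstantFlag.

(** * Conformal fields in coordinates *)

Lemma pairingDl (R : realType) n (b c y : 'rV[R]_n) :
  pairing (b + c) y = pairing b y + pairing c y.
Proof. by rewrite !pairingE mulmxDl mxE. Qed.
Lemma pairingZl (R : realType) n (t : R) (b y : 'rV[R]_n) :
  pairing (t *: b) y = t * pairing b y.
Proof. by rewrite !pairingE -scalemxAl mxE. Qed.

Lemma pairing_delta (R : realType) n (b : 'rV[R]_n) k :
  pairing b (delta_mx 0 k) = b 0 k.
Proof. by rewrite pairingE trmx_delta -colE mxE. Qed.

Lemma kernel_vector (R : realType) n (b : 'rV[R]_n) : (2 <= n)%N ->
  exists2 y, y != 0 & pairing b y = 0.
Proof.
move=> n2; pose i := Ordinal (ltnW n2); pose j := Ordinal n2.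
have [bi|bi] := eqVneq (b 0 i) 0.
  exists (delta_mx 0 i); last by rewrite pairing_delta.
  by apply/eqP => /rowP /(_ i) /eqP; rewrite !mxE !eqxx oner_eq0.
exists (b 0 j *: delta_mx 0 i - b 0 i *: delta_mx 0 j); last first.
  by rewrite pairingDr pairingNr !pairingZr !pairing_delta mulrC subrr.
apply/eqP => /rowP /(_ j) /eqP; rewrite !mxE !eqxx mulr0 add0r mulr1 oppr_eq0.
by rewrite (negbTE bi).
Qed.

Section QuadraticDivision.
Context {R : realType} {n : nat}.

(** The polynomial A(y, y) is prime to b: on the kernel of b the equation
    gives A(y, y) l(y) = 0, and A is positive there, so l vanishes on the
    kernel of b and is a multiple of b. Then b can be cancelled outside its
    kernel, and the resulting equality of quadratic forms extends to the
    kernel. *)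
Lemma quadratic_division (A Q : 'M[R]_n) (b l w : 'rV[R]_n) :
  posdef A -> A^T = A -> pairing b w = 1 ->
  (forall y, 0 < pairing b y ->
     bil Q y y * pairing b y = bil A y y * pairing l y) ->
  exists mu, (forall y, bil Q y y = mu * bil A y y) /\
             (forall y, pairing l y = mu * pairing b y).
Proof.
move=> pA sA bw h.
have h1 y : pairing b y != 0 ->
    bil Q y y * pairing b y = bil A y y * pairing l y.
  rewrite neq_lt => /orP[by_|]; last exact: h.
  have := h (- y); rewrite pairingNr oppr_gt0 => /(_ by_).
  by rewrite !(bilNl, bilNr, pairingNr) !opprK !mulrN => /oppr_inj.
have bt y t : pairing b y = 0 -> pairing b (y + t *: w) = t.
  by move=> e; rewrite pairingDr pairingZr e bw add0r mulr1.
have l0 y : pairing b y = 0 -> pairing l y = 0.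
  move=> e; have [->|y0] := eqVneq y 0.
    by rewrite pairingE trmx0 mulmx0 mxE.
  have E (M : 'M[R]_n) t : bil M (y + t *: w) (y + t *: w) =
      bil M y y + t * (bil M y w + bil M w y) + t ^+ 2 * bil M w w.
    by rewrite !(bilDl, bilDr, bilZl, bilZr); ring.
  have g (t : R) : t != 0 -> (bil Q y y + t * (bil Q y w + bil Q w y) + t ^+ 2 * bil Q w w) * t =
     (bil A y y + t * (bil A y w + bil A w y) + t ^+ 2 * bil A w w) * (pairing l y + t * pairing l w).
    by move=> t0; have := h1 (y + t *: w); rewrite bt // !E pairingDr pairingZr => /(_ t0).
  have A0 : bil A y y != 0 by rewrite gt_eqF // pA.
  have n2 : (2 : R) != 0 by rewrite pnatr_eq0.
  have n1 : (1 : R) != 0 by exact: oner_neq0.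
  (* Both sides are polynomials of degree 3 in t, so four values of t besides
     0 determine the constant coefficients. *)
  have := g 1 n1; have := g 2 n2.
  have := g (-1); rewrite oppr_eq0 => /(_ n1).
  have := g (-2); rewrite oppr_eq0 => /(_ n2).
  move: (bil Q y w + bil Q w y) (bil A y w + bil A w y) (bil Q y y) (bil Q w w) (bil A w w).
  move: (pairing l w) => p1 q1 a1 q0 q2 a2 e1 e2 e3 e4.
  have : bil A y y * pairing l y = 0 by lra.
  by move/eqP; rewrite mulf_eq0 (negbTE A0) => /eqP.
have lE y : pairing l y = pairing l w * pairing b y.
  have : pairing l (y - pairing b y *: w) = 0.
    by apply: l0; rewrite pairingDr pairingNr pairingZr bw mulr1 subrr.
  rewrite pairingDr pairingNr pairingZr => /eqP; rewrite subr_eq0 => /eqP ->.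
  exact: mulrC.
exists (pairing l w); split=> // y.
have q y' : pairing b y' != 0 -> bil Q y' y' = pairing l w * bil A y' y'.
  move=> b0; apply: (mulIf b0); rewrite h1 // lE; ring.
have [e|/q//] := eqVneq (pairing b y) 0.
have E (M : 'M[R]_n) t : bil M (y + t *: w) (y + t *: w) =
      bil M y y + t * (bil M y w + bil M w y) + t ^+ 2 * bil M w w.
  by rewrite !(bilDl, bilDr, bilZl, bilZr); ring.
have g t : t != 0 -> bil Q y y + t * (bil Q y w + bil Q w y) + t ^+ 2 * bil Q w w =
   pairing l w * (bil A y y + t * (bil A y w + bil A w y) + t ^+ 2 * bil A w w).
  by move=> t0; rewrite -!E; apply: q; rewrite bt.
have qw := q w; rewrite bw oner_eq0 in qw; have {}qw := qw isT.
have n1 : (1 : R) != 0 by exact: oner_neq0.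
have := g 1 n1; have := g (-1); rewrite oppr_eq0 => /(_ n1).
rewrite qw; move: (bil Q y w + bil Q w y) (bil A y w + bil A w y) => q1 a1 e1 e2.
lra.
Qed.

End QuadraticDivision.

Section ConformalLocal.
Context {R : realType} {n : nat} (D : phase_domain R n).
Variables (V : 'rV[R]_n -> 'rV[R]_n).
Hypothesis hV : forall k, smooth (base D) (fun x => V x 0 k).
Notation A := (phaseR D).
Notation ev := (@ev R n D).

Definition VR k : A := coefR (hV k).

Lemma ev_lift L (g : A) : eqO D L (ev g) ->
  eqO D (complete_lift V L) (ev (clift VR g)).
Proof.
move=> hL x y h; rewrite /complete_lift /clift actE evD //; congr (_ + _).
  rewrite ev_sum //; apply: eq_bigr => k _.
  rewrite (evM (VR k) _ h) (ev_mkreg _ h); congr (_ * _).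
  exact: (pd_ev (true, k) hL h).
rewrite ev_sum // exchange_big; apply: eq_bigr => l _ /=.
rewrite (evM _ (dY A l g) h) ev_sum // mulr_suml; apply: eq_bigr => k _.
rewrite (evM (yc A k) _ h) ev_yc //; congr (_ * _ * _).
  exact: (esym (ev_dX_coefR (hV l) k h)).
exact: (pd_ev (false, l) hL h).
Qed.
End ConformalLocal.

Section LieForms.
Context {R : realType} {n : nat} (D : phase_domain R n)
  (a : 'rV[R]_n -> 'M[R]_n) (b V : 'rV[R]_n -> 'rV[R]_n).
Hypothesis H : unit_pair (base D) a b.
Hypothesis hV : forall k, smooth (base D) (fun x => V x 0 k).
Notation A := (phaseR D).
Notation ev := (@ev R n D).
Notation U := (UF H).
Notation VA := (VR hV).

(** The coordinate expressions of [lie_g] and [lie_b]. *)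
Definition lie_metric x : 'M[R]_n := \matrix_(k, l)
  (\sum_m V x 0 m * partial m (fun z => a z k l) x
   + 2 * \sum_j partial k (fun z => V z 0 j) x * a x j l).
Definition lie_form x : 'rV[R]_n := \row_k
  (\sum_m V x 0 m * partial m (fun z => b z 0 k) x
   + \sum_j partial k (fun z => V z 0 j) x * b x 0 j).

Lemma VR_basic k : basic (VA k). Proof. exact: coefR_basic. Qed.
Lemma ev_VR k x y : fib D x y -> ev (VA k) x y = V x 0 k.
Proof. exact: ev_coefR. Qed.

Lemma ev_lie_g k l x y : fib D x y -> ev (lie_g U VA k l) x y = lie_metric x k l.
Proof.
move=> h; rewrite mxE evD // (evM 2 _ h) ev_nat // !ev_sum //.
congr (_ + _ * _); apply: eq_bigr => m _.
  by rewrite (evM (VA m) _ h) ev_VR //; congr (_ * _); exact: ev_dX_coefR.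
by rewrite (evM _ (metric U m l) h) (ev_metric H _ _ h); congr (_ * _); exact: ev_dX_coefR.
Qed.
Lemma ev_lie_b k x y : fib D x y -> ev (lie_b U VA k) x y = lie_form x 0 k.
Proof.
move=> h; rewrite mxE evD // !ev_sum //.
congr (_ + _); apply: eq_bigr => m _.
  by rewrite (evM (VA m) _ h) ev_VR //; congr (_ * _); exact: ev_dX_coefR.
by rewrite (evM _ (form U m) h) (ev_form H _ h); congr (_ * _); exact: ev_dX_coefR.
Qed.

Lemma ev_clift_asq x y : fib D x y -> ev (clift VA (asq U)) x y = bil (lie_metric x) y y.
Proof.
move=> h; rewrite clift_asq ev_sum //; apply: eq_bigr => k _; rewrite ev_sum //.
apply: eq_bigr => l _.
by rewrite (evM _ (yc A l) h) (evM _ (yc A k) h) ev_lie_g // !ev_yc.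
Qed.
Lemma ev_clift_bform x y : fib D x y -> ev (clift VA (bform U)) x y = pairing (lie_form x) y.
Proof.
move=> h; rewrite clift_bform ev_sum //; apply: eq_bigr => k _.
by rewrite (evM _ (yc A k) h) ev_lie_b // !ev_yc.
Qed.

Lemma complete_lift_asq x y : fib D x y ->
  complete_lift V (fun x y => bil (a x) y y) x y = bil (lie_metric x) y y.
Proof.
move=> h; rewrite -ev_clift_asq //; apply: ev_lift h => x' y' h'.
by rewrite ev_asq.
Qed.
Lemma complete_lift_bform x y : fib D x y ->
  complete_lift V (fun x y => pairing (b x) y) x y = pairing (lie_form x) y.
Proof.
move=> h; rewrite -ev_clift_bform //; apply: ev_lift h => x' y' h'.
by rewrite ev_bform.
Qed.

Lemma lie_unit_form x y : fib D x y ->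
  bil (lie_metric x) (Wv a b x) (Wv a b x) = 2 * pairing (lie_form x) (Wv a b x).
Proof.
move=> h; have := congr1 (fun f => ev f x y) (lie_unit U VA).
rewrite (evM 2 _ h) ev_nat // !ev_sum //.
have -> : \sum_i ev (\sum_l lie_g U VA i l * W U i * W U l) x y = bil (lie_metric x) (Wv a b x) (Wv a b x).
  apply: eq_bigr => k _; rewrite ev_sum //; apply: eq_bigr => l _.
  by rewrite (evM _ (W U l) h) (evM _ (W U k) h) ev_lie_g // !(ev_W H _ h).
move=> ->; congr (_ * _); apply: eq_bigr => k _.
by rewrite (evM _ (W U k) h) ev_lie_b // !(ev_W H _ h).
Qed.

Hypothesis hD : forall x y, fib D x y -> 0 < pairing (b x) y.

Lemma complete_lift_kropina L x y : eqO D L (ev (kropF U (ibR H hD))) -> fib D x y ->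
  complete_lift V L x y = bil (lie_metric x) y y / pairing (b x) y
    - bil (a x) y y * pairing (lie_form x) y / pairing (b x) y ^+ 2.
Proof.
move=> hL h; rewrite (ev_lift hV hL h) /kropF.
rewrite derM (derV _ (ibRK H hD)) mulrN evB // (evM (clift VA (asq U)) _ h).
rewrite (evM (asq U) _ h) (evM _ (clift VA (bform U)) h) (evM (ibR H hD) _ h).
rewrite ev_clift_asq // ev_clift_bform // (ev_ib H hD h) ev_asq //.
rewrite expr2 invfM; ring.
Qed.
End LieForms.

Section LocalConformal.
Context {R : realType} {n : nat} (Om : set 'rV[R]_n) (oOm : open Om)
  (a : 'rV[R]_n -> 'M[R]_n) (b V : 'rV[R]_n -> 'rV[R]_n) (c : 'rV[R]_n -> R).
Hypothesis H : unit_pair Om a b.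
Hypothesis hV : forall k, smooth Om (fun x => V x 0 k).
Variable L : 'rV[R]_n -> 'rV[R]_n -> R.
Hypothesis hL : forall x y, Om x -> 0 < pairing (b x) y ->
  L x y = bil (a x) y y / pairing (b x) y.

Let DH := half_domain oOm (up_b H).
Let DF : phase_domain R n := full_domain oOm.
Let HH : unit_pair (base DH) a b := H.
Let HF : unit_pair (base DF) a b := H.
Let hVH : forall k, smooth (base DH) (fun x => V x 0 k) := hV.
Let hVF : forall k, smooth (base DF) (fun x => V x 0 k) := hV.
Let hDH : forall x y, fib DH x y -> 0 < pairing (b x) y := fun x y h => h.2.

Lemma hL_half : eqO DH L (ev (kropF (UF HH) (ibR HH hDH))).
Proof. by move=> x y h; rewrite (ev_kropF HH hDH h) hL //; case: h. Qed.

(** The infinitesimal scaling of alpha^2 and beta, in a chart; it is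
    equivalent to the conformal equation of F. *)
Definition scales := forall x y, Om x ->
  complete_lift V (fun x y => bil (a x) y y) x y = 4 * c x * bil (a x) y y /\
  complete_lift V (fun x y => pairing (b x) y) x y = 2 * c x * pairing (b x) y.

(** The conformal equation multiplied by beta^2 is the hypothesis of
    [quadratic_division], for the form V^c(beta) + 2 c beta. *)
Lemma conformal_scales :
  (forall x y, Om x -> 0 < pairing (b x) y -> complete_lift V L x y = 2 * c x * L x y) ->
  scales.
Proof.
move=> conf x y Ox.
pose w := Wv a b x.
have bw : pairing (b x) w = 1 by exact: (pairing_W HF Ox).
have [y' by'|mu [qE lE]] := @quadratic_division R n (a x) (lie_metric a V x) (b x)
   (lie_form b V x + (2 * c x) *: b x) w (up_pos H Ox) (up_sym H Ox) bw.
  have h : fib DH x y' by [].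
  have := conf x y' Ox by'; rewrite (complete_lift_kropina hVH hL_half h) hL // => e.
  rewrite pairingDl pairingZl.
  have nz : pairing (b x) y' != 0 by rewrite gt_eqF.
  have e1 : bil (lie_metric a V x) y' y' / pairing (b x) y' = 2 * c x * (bil (a x) y' y' / pairing (b x) y')
     + bil (a x) y' y' * pairing (lie_form b V x) y' / pairing (b x) y' ^+ 2.
    by rewrite -e subrK.
  have -> : bil (lie_metric a V x) y' y' = (bil (lie_metric a V x) y' y' / pairing (b x) y') * pairing (b x) y'.
    by rewrite divfK.
  by rewrite e1; field.
have lE' z : pairing (lie_form b V x) z = (mu - 2 * c x) * pairing (b x) z.
  have := lE z; rewrite pairingDl pairingZl => e.
  by rewrite mulrBl -e addrK.
have h : fib DF x y by [].
have := lie_unit_form HF hVF h; rewrite qE lE' (bil_W HF Ox) (pairing_W HF Ox) !mulr1 => e.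
have muE : mu = 4 * c x by lra.
rewrite (complete_lift_asq HF hVF h) (complete_lift_bform HF hVF h) qE lE' muE.
by split=> //; congr (_ * _); ring.
Qed.

Lemma scales_conformal : scales ->
  forall x y, Om x -> 0 < pairing (b x) y -> complete_lift V L x y = 2 * c x * L x y.
Proof.
move=> sc x y Ox by_; have h : fib DH x y by [].
have [] := sc x y Ox; rewrite (complete_lift_asq HH hVH h) (complete_lift_bform HH hVH h).
move=> e1 e2; rewrite (complete_lift_kropina hVH hL_half h) e1 e2 hL //.
have nz : pairing (b x) y != 0 by rewrite gt_eqF.
by field.
Qed.

Hypothesis n_ge2 : (2 <= n)%N.
Hypothesis kil : forall x, Om x -> forall k l, cov_deriv a b k l x + cov_deriv a b l k x = 0.
Hypothesis hc : smooth Om c.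

(** In [conformal_gradient], a direction y with beta(y) = 0 and y nonzero
    gives W(c) = 0; then dc(y) = 0 wherever beta(y) is nonzero, hence
    everywhere. *)
Lemma conformal_factor_cst : scales -> forall x k, Om x -> partial k c x = 0.
Proof.
move=> sc x k Ox.
pose A := phaseR DF.
have hcF : smooth (base DF) c := hc.
pose cA : A := coefR hcF.
have cAb : basic cA by exact: coefR_basic.
pose U := UF HF.
have killing : r00 U = 0 by exact: (killing_r00 HF kil).
have Val : clift (@VR R n DF V hVF) (asq U) = 4 * cA * asq U.
  apply: ev_inj => x' y' h; rewrite (ev_clift_asq HF hVF h) -(complete_lift_asq HF hVF h).
  by rewrite (proj1 (sc x' y' h)) (evM _ (asq U) h) (evM 4 cA h) ev_nat // ev_coefR // ev_asq.
have Vbeta : clift (@VR R n DF V hVF) (bform U) = 2 * cA * bform U.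
  apply: ev_inj => x' y' h; rewrite (ev_clift_bform HF hVF h) -(complete_lift_bform HF hVF h).
  by rewrite (proj2 (sc x' y' h)) (evM _ (bform U) h) (evM 2 cA h) ev_nat // ev_coefR // ev_bform.
have grad := conformal_gradient killing (VR_basic hVF) cAb Val Vbeta.
pose dc : 'rV[R]_n := \row_m partial m c x.
have G y : pairing dc (Wv a b x) * bil (a x) y y = pairing dc y * pairing (b x) y.
  have h : fib DF x y by [].
  have := congr1 (fun f => ev f x y) grad.
  rewrite (evM _ (asq U) h) (evM _ (bform U) h) ev_asq // ev_bform // !ev_sum //.
  have -> : \sum_i ev (W U i * dX A i cA) x y = pairing dc (Wv a b x).
    apply: eq_bigr => i _; rewrite (evM (W U i) _ h) (ev_W HF i h) [dc 0 i]mxE mulrC; congr (_ * _).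
    exact: ev_dX_coefR.
  move=> ->; congr (_ * _); apply: eq_bigr => i _.
  rewrite (evM (yc A i) _ h) ev_yc // [dc 0 i]mxE mulrC; congr (_ * _).
  exact: ev_dX_coefR.
have dW : pairing dc (Wv a b x) = 0.
  have [y y0 by0] : exists2 y, y != 0 & pairing (b x) y = 0.
    exact: kernel_vector.
  have := G y; rewrite by0 mulr0 => /eqP; rewrite mulf_eq0 => /orP[/eqP//|].
  by rewrite gt_eqF // (up_pos H Ox).
have dcb y : pairing (b x) y != 0 -> pairing dc y = 0.
  move=> b0; have := G y; rewrite dW mul0r => /esym/eqP; rewrite mulf_eq0 (negbTE b0) orbF.
  by move/eqP.
have dc0 y : pairing dc y = 0.
  have [e|/dcb//] := eqVneq (pairing (b x) y) 0.
  have := dcb (y + Wv a b x); rewrite !pairingDr e (pairing_W HF Ox) add0r oner_eq0 dW addr0.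
  by apply.
by have := dc0 (delta_mx 0 k); rewrite pairing_delta mxE.
Qed.

End LocalConformal.

(** * From coordinates to the manifold *)

Lemma bil_invmx (R : realType) n (A : 'M[R]_n) (b : 'rV[R]_n) : A^T = A -> A \in unitmx ->
  bil (invmx A) b b = bil A (b *m invmx A) (b *m invmx A).
Proof.
move=> sA uA; rewrite !bilE mulmxKV // trmx_mul trmx_inv sA mulmxA.
by [].
Qed.

Lemma bil_scale (R : realType) n (t : R) (A : 'M[R]_n) u v : bil (t *: A) u v = t * bil A u v.
Proof. by rewrite !bilE -scalemxAr -scalemxAl mxE. Qed.

Section Charts.
Context {R : realType} {n : nat} {M : manifold R n}.
Implicit Types (i j : chart M) (p : M) (U : set M).

(** The coordinate image of U in a chart, which is the set on which smoothness
    over U is expressed. *)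
Definition cimage i U : set 'rV[R]_n := Defs.coord i @` (dom i `&` U).

Lemma cimageP i U p : dom i p -> U p -> cimage i U (Defs.coord i p).
Proof. by move=> dp Up; exists p. Qed.

Lemma cimage_param i U x : cimage i U x ->
  [/\ dom i (param i x), U (param i x) & Defs.coord i (param i x) = x].
Proof. by case=> p [dp Up] <-; rewrite coordK. Qed.

Lemma cimage_open i U : open U -> open (cimage i U).
Proof.
move=> oU; rewrite openE => _ [p [dp Up] <-]; rewrite /interior.
have h0 : nbhs (Defs.coord i p) (Defs.coord i @` dom i).
  by apply: open_nbhs_nbhs; split; [exact: coord_open|exists p].
have h1 : nbhs (Defs.coord i p) (param i @^-1` U).
  apply: (param_continuous dp); rewrite coordK //.
  exact: open_nbhs_nbhs.
apply: filterS (filterI h0 h1) => x [[q dq <-]]; rewrite /preimage /= coordK // => Uq.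
by exists q.
Qed.

(** The level sets of c and their complements are open. *)
Lemma locally_cst_cst U (c : M -> R) : open U -> connected U ->
  (forall p, U p -> \forall q \near p, c q = c p) ->
  exists k, forall p, U p -> c p = k.
Proof.
move=> oU cU loc; have [[p0 U0]|none] := pselect (exists p, U p); last first.
  by exists 0 => p Up; case: none; exists p.
have lev (Q : R -> Prop) : open [set q | U q /\ Q (c q)].
  rewrite openE => q [Uq Qq]; rewrite /interior.
  have h0 : nbhs q U by apply: open_nbhs_nbhs.
  apply: filterS (filterI h0 (loc q Uq)) => q' [Uq' e].
  by split=> //; rewrite e.
exists (c p0) => p Up.
pose B : set M := [set q | U q /\ c q = c p0].
have BU : B = U.
  apply: cU.
  - by exists p0.
  - exists B; first exact: (lev (fun t => t = c p0)).
    by apply/seteqP; split=> [q [Uq e]|q [_ []]].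
  - exists (~` [set q | U q /\ c q <> c p0]).
      by apply: open_closedC; exact: (lev (fun t => t <> c p0)).
    apply/seteqP; split=> [q [Uq e]|q [Uq nq]]; first by split=> // -[_].
    by split=> //; apply: contrapT => ne; apply: nq.
have [] : B p by rewrite BU.
by [].
Qed.

End Charts.

Section Normalization.
Context {R : realType} {n : nat} {M : manifold R n} (a : bilfield M) (b : covfield M).
Hypotheses (ma : is_riemannian_metric a) (fb : is_one_form b) (nz : nowhere_vanishing b).
Implicit Types (i j : chart M) (p : M) (U : set M).

Definition sqnorm i p := bil (invmx (a i p)) (b i p) (b i p).
(** Dividing both by the squared norm does not change alpha^2/beta, and the
    norm of b becomes 1: the inverse of the metric is multiplied by [sqnorm]
    and the form divided by it. *)
Definition unit_a : bilfield M := fun i p => (sqnorm i p)^-1 *: a i p.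
Definition unit_b : covfield M := fun i p => (sqnorm i p)^-1 *: b i p.

Lemma a_sym i p : dom i p -> (a i p)^T = a i p.
Proof. by case: ma => _ _ h _; apply: h. Qed.
Lemma a_pos i p : dom i p -> posdef (a i p).
Proof. by case: ma => _ _ _ h dp y; apply: h. Qed.
Lemma a_unit i p : dom i p -> a i p \in unitmx.
Proof. by move=> dp; apply/posdef_unit/a_pos. Qed.

Lemma sqnorm_gt0 i p : dom i p -> 0 < sqnorm i p.
Proof.
move=> dp; rewrite /sqnorm bil_invmx ?a_sym ?a_unit //.
apply: a_pos => //; apply/eqP => e; have /eqP := nz dp; apply.
by rewrite -(mulmxKV (a_unit dp) (b i p)) e mul0mx.
Qed.

Lemma sqnorm_chart i j p : dom i p -> dom j p -> sqnorm i p = sqnorm j p.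
Proof.
move=> di dj; case: ma => ta _ _ _; case: fb => tb _.
have ea := ta i j p di dj; have eb := tb i j p di dj.
set J := jac i j p in ea eb.
have uJ : J \in unitmx.
  have := a_unit di; rewrite ea unitmx_mul => /andP[_].
  by rewrite unitmx_tr.
have uJT : J^T \in unitmx by rewrite unitmx_tr.
rewrite /sqnorm !bilE eb.
have -> : invmx (a i p) = invmx J^T *m invmx (a j p) *m invmx J.
  apply: (can_inj (mulKmx (a_unit di))).
  rewrite mulmxV ?a_unit // {1}ea -!mulmxA (mulmxA J^T) mulmxV // mul1mx.
  by rewrite (mulmxA (a j p)) mulmxV ?a_unit // mul1mx mulmxV.
rewrite trmx_mul trmxK -!mulmxA (mulmxA J^T) mulmxV // mul1mx (mulmxA (invmx J)).
by rewrite mulVmx // mul1mx.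
Qed.

Lemma smooth_sqnorm i : smooth (cimage i setT) (fun x => sqnorm i (param i x)).
Proof.
have oO : open (cimage i setT) by apply: cimage_open; exact: openT.
case: ma => _ sa _ _; case: fb => _ sb.
have ia k l : smooth (cimage i setT) (fun x => invmx (a i (param i x)) k l).
  apply: smooth_invmx => // [k' l'|x /cimage_param[dx _ _]]; first exact: sa.
  exact: a_unit.
apply: smooth_sum => // k; apply: smooth_sum => // l.
by apply: smoothM => //; [apply: smoothM => //|]; exact: sb.
Qed.

Lemma smooth_sqnormV i : smooth (cimage i setT) (fun x => (sqnorm i (param i x))^-1).
Proof.
apply: smoothV; [by apply: cimage_open; exact: openT| |exact: smooth_sqnorm].
by move=> x /cimage_param[dx _ _]; rewrite gt_eqF // sqnorm_gt0.
Qed.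

Lemma unit_a_metric : is_riemannian_metric unit_a.
Proof.
have oO i : open (cimage i setT) by apply: cimage_open; exact: openT.
case: (ma) => ta sa _ _; split.
- move=> i j p di dj; rewrite /unit_a (sqnorm_chart di dj) (ta i j p di dj).
  by rewrite -scalemxAr -scalemxAl.
- move=> i k l; apply: smooth_ext (smoothM (oO i) (smooth_sqnormV i) (sa i k l)) => //.
  by move=> x _; rewrite mxE.
- by move=> i p di; rewrite /unit_a linearZ /= a_sym.
- by move=> i p y di y0; rewrite bil_scale mulr_gt0 ?invr_gt0 ?sqnorm_gt0 // a_pos.
Qed.

Lemma unit_b_form : is_one_form unit_b.
Proof.
have oO i : open (cimage i setT) by apply: cimage_open; exact: openT.
case: (fb) => tb sb; split.
- move=> i j p di dj; rewrite /unit_b (sqnorm_chart di dj) (tb i j p di dj).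
  by rewrite -scalemxAl.
- move=> i k; apply: smooth_ext (smoothM (oO i) (smooth_sqnormV i) (sb i k)) => //.
  by move=> x _; rewrite mxE.
Qed.

Lemma unit_ab_length : unit_length unit_a unit_b.
Proof.
move=> i p di; have n0 := sqnorm_gt0 di; have u := a_unit di.
have ui : (sqnorm i p)^-1 \is a GRing.unit by rewrite unitfE invr_eq0 gt_eqF.
have una : (sqnorm i p)^-1 *: a i p \in unitmx.
  by apply: posdef_unit => y y0; rewrite bil_scale mulr_gt0 ?invr_gt0 // a_pos.
rewrite /unit_a /unit_b invmxZ // bil_scale bilZl bilZr -/(sqnorm i p) invrK.
by rewrite mulrA mulfV ?gt_eqF // mul1r mulVf // gt_eqF.
Qed.

Lemma unit_ab_kropina : eq_conic (kropina unit_a unit_b) (kropina a b).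
Proof.
move=> i p di; have n0 := sqnorm_gt0 di; split.
  apply/seteqP; split=> y /=; rewrite /unit_b pairingZl pmulr_rgt0 ?invr_gt0 //.
move=> y _ /=; rewrite coordK // /unit_a /unit_b bil_scale pairingZl.
by rewrite invfM invrK mulrACA mulVf ?mul1r // gt_eqF.
Qed.

End Normalization.

Section Main.
Context {R : realType} {n : nat} {M : manifold R n} (a : bilfield M) (b : covfield M).
Hypotheses (n_ge2 : (2 <= n)%N).
Hypotheses (ma : is_riemannian_metric a) (fb : is_one_form b) (nz : nowhere_vanishing b).
Implicit Types (i j : chart M) (p : M) (U : set M).
Notation na := (unit_a a b).
Notation nb := (unit_b a b).
Notation F := (kropina a b).

Lemma unit_ab_pair i U :
  unit_pair (cimage i U) (na i \o param i) (nb i \o param i).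
Proof.
have sub : cimage i U `<=` cimage i setT by move=> _ [p [dp _] <-]; exists p.
case: (unit_a_metric ma fb nz) => _ sa sym pos; case: (unit_b_form ma fb nz) => _ sb.
split.
- by move=> k l; apply: smooth_sub sub (sa i k l).
- by move=> k; apply: smooth_sub sub (sb i k).
- by move=> x /cimage_param[dx _ _]; apply: sym.
- by move=> x /cimage_param[dx _ _] y; apply: pos.
- by move=> x /cimage_param[dx _ _]; apply: (unit_ab_length ma nz).
Qed.

Lemma kropina_unit_ab i U x y : cimage i U x -> 0 < pairing (nb i (param i x)) y ->
  F i x y = bil (na i (param i x)) y y / pairing (nb i (param i x)) y.
Proof.
move=> /cimage_param[dx _ ex] h.
have [e ey] := unit_ab_kropina ma nz dx.
have := ey y; rewrite e ex => /(_ _)<- //.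
by rewrite -e.
Qed.

Lemma cone_unit_b i p y : dom i p -> (0 < pairing (nb i p) y) = (0 < pairing (b i p) y).
Proof.
by move=> dp; rewrite /unit_b pairingZl pmulr_rgt0 // invr_gt0 sqnorm_gt0.
Qed.

Definition chart_domain i : phase_domain R n :=
  half_domain (cimage_open (i := i) openT) (up_b (unit_ab_pair i setT)).

Lemma chart_pair i : unit_pair (base (chart_domain i)) (na i \o param i) (nb i \o param i).
Proof. exact: unit_ab_pair. Qed.

Lemma chart_pos i x y : fib (chart_domain i) x y -> 0 < pairing ((nb i \o param i) x) y.
Proof. by case. Qed.

Lemma chart_fib i x y : base (chart_domain i) x ->
  0 < pairing ((nb i \o param i) x) y -> fib (chart_domain i) x y.
Proof. by move=> Ox by_; split. Qed.

Lemma kropina_unit_ab_ev i :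
  eqO (chart_domain i) (F i) (ev (kropF (UF (chart_pair i)) (ibR (chart_pair i) (@chart_pos i)))).
Proof.
move=> x y h; rewrite (ev_kropF (chart_pair i) (@chart_pos i) h).
by rewrite (kropina_unit_ab (fib_base h)) //; exact: chart_pos h.
Qed.

Lemma einstein_cov_deriv : weak_einstein F -> forall i x, cimage i setT x ->
  forall k l, cov_deriv (na i \o param i) (nb i \o param i) k l x
     + cov_deriv (na i \o param i) (nb i \o param i) l k x = 0.
Proof.
move=> [theta [sigma [_ _ einst]]] i x Ox.
have [dx _ ex] := cimage_param Ox.
apply: (weak_einstein_killing (th := theta i (param i x)) (sg := sigma (param i x))
  (@chart_fib i) (@kropina_unit_ab_ev i) n_ge2 Ox) => y hy.
have := einst i (param i x) y dx; rewrite ex; apply.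
by rewrite /= -cone_unit_b.
Qed.

Lemma einstein_weak : einstein F -> weak_einstein F.
Proof.
move=> [sigma ss einst]; exists (fun _ _ => 0), sigma; split=> //; split.
  by move=> i j p _ _; rewrite mul0mx.
move=> i k; rewrite /smooth_on (_ : (fun x => _) = fun=> 0); first exact: smooth_cst.
by apply/funext => x; rewrite mxE.
Qed.

Hypothesis einst : weak_einstein F.

Lemma unit_b_killing : is_killing_form na nb.
Proof.
by move=> i p k l dp; apply: (einstein_cov_deriv einst); exists p.
Qed.

Lemma conformal_local U (V : vfield M) (c : M -> R) i : open U -> conformal_with U F V c ->
  scales (cimage i U) (na i \o param i) (nb i \o param i) (V i \o param i) (c \o param i) /\
  forall x k, cimage i U x -> partial k (c \o param i) x = 0.
Proof.
move=> oU [[_ sV] sc lc].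
have oO := cimage_open (i := i) oU.
have sub : cimage i U `<=` cimage i setT by move=> _ [p [dp _] <-]; exists p.
have hL x y : cimage i U x -> 0 < pairing ((nb i \o param i) x) y ->
    F i x y = bil ((na i \o param i) x) y y / pairing ((nb i \o param i) x) y.
  exact: kropina_unit_ab.
have S : scales (cimage i U) (na i \o param i) (nb i \o param i) (V i \o param i) (c \o param i).
  apply: (conformal_scales oO (unit_ab_pair i U) (sV i) hL).
  move=> x y Ox by_; have [dx Ux ex] := cimage_param Ox.
  have := lc i (param i x) y Ux dx; rewrite ex; apply.
  by rewrite /= -cone_unit_b.
split=> // x k Ox.
apply: (conformal_factor_cst oO (unit_ab_pair i U) (sV i) n_ge2 _ (sc i) S k Ox).
by move=> x' Ox' k' l'; apply: (einstein_cov_deriv einst); exact: sub.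
Qed.

Lemma conformal_factor_constant U V (c : M -> R) : open U -> connected U ->
  conformal_with U F V c -> exists k, forall p, U p -> c p = k.
Proof.
move=> oU cU conf; apply: locally_cst_cst => // p Up.
have [i di] := dom_cover p.
have [_ dc] := conformal_local i oU conf.
have [_ sc _] := conf.
have Ox : cimage i U (Defs.coord i p) by exists p.
have h : \forall z \near Defs.coord i p, (c \o param i) z = (c \o param i) (Defs.coord i p).
  apply: (partial0_locally_cst (cimage_open oU) Ox).
    by move=> z k Oz; apply: smooth_pderivable (sc i) Oz.
  by move=> z k; apply: dc.
have h1 : \forall q \near p, (c \o param i) (Defs.coord i q) = (c \o param i) (Defs.coord i p).
  exact: (Defs.coord_continuous di h).
have h0 : nbhs p (dom i) by apply: open_nbhs_nbhs; split=> //; exact: dom_open.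
by apply: filterS (filterI h0 h1) => q [dq] /=; rewrite !coordK.
Qed.

Lemma smooth_cst_on U (c : M -> R) k : open U -> (forall p, U p -> c p = k) -> smooth_scalar U c.
Proof.
move=> oU ck i; apply: smooth_ext (smooth_cst (cimage i U) k); first exact: cimage_open.
by move=> x /cimage_param[_ Ux _]; rewrite ck.
Qed.

Lemma conformal_homothetic V : connected [set: M] -> conformal F V -> homothetic F V.
Proof.
move=> cM [c conf]; have [k ck] := conformal_factor_constant openT cM conf.
have [vV _ lc] := conf; exists k; split=> //; first exact: (smooth_cst_on openT (k := k)).
by move=> i p y Up dp cy; rewrite lc // ck.
Qed.

(** In one direction this is [conformal_local] and the constancy of c; in the
    other, V^c(F) is computed from V^c(alpha^2) and V^c(beta). *)
Lemma conformal_iff U (V : vfield M) (c : M -> R) : open U -> connected U ->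
  conformal_with U F V c <->
  [/\ is_vector_field U V, exists k : R, forall p, U p -> c p = k,
      lift_scales U V (alpha2 na) (fun p => 4 * c p) &
      lift_scales U V (beta nb) (fun p => 2 * c p)].
Proof.
move=> oU cU; split=> [conf|[vV [k ck] la lb]].
  have [vV _ _] := conf; split=> //.
  - exact: (conformal_factor_constant oU cU conf).
  - move=> i p y Up dp _; have [S _] := conformal_local i oU conf.
    have [+ _] := S (Defs.coord i p) y (cimageP dp Up).
    by rewrite /= coordK.
  - move=> i p y Up dp _; have [S _] := conformal_local i oU conf.
    have [_ +] := S (Defs.coord i p) y (cimageP dp Up).
    by rewrite /= coordK.
split=> //; first exact: smooth_cst_on ck.
move=> i p y Up dp cy.
have Ox := cimageP dp Up.
have hL x y' : cimage i U x -> 0 < pairing ((nb i \o param i) x) y' ->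
    F i x y' = bil ((na i \o param i) x) y' y' / pairing ((nb i \o param i) x) y'.
  exact: kropina_unit_ab.
have S : scales (cimage i U) (na i \o param i) (nb i \o param i) (V i \o param i) (c \o param i).
  move=> x z /cimage_param[dx Ux ex]; split.
    by have := la i (param i x) z Ux dx I; rewrite ex.
  by have := lb i (param i x) z Ux dx I; rewrite ex.
have := scales_conformal (cimage_open oU) (unit_ab_pair i U) (vV.2 i) hL S Ox (y := y).
rewrite /= coordK //; apply.
by rewrite cone_unit_b.
Qed.

Lemma unit_a_constant_curvature K : constant_flag_curvature F K ->
  has_constant_sectional_curvature na (4 * K).
Proof.
move=> flag i p u v dp fr.
have Ox : base (chart_domain i) (Defs.coord i p) by exists p.
apply: (flag_sectional (@chart_fib i) _ (@kropina_unit_ab_ev i) _ Ox fr).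
  by apply: killing_r00; exact: (einstein_cov_deriv einst (i := i)).
move=> x y k l h; have [dx _ ex] := cimage_param (fib_base h).
have := flag i (param i x) y k l dx; rewrite ex; apply.
by rewrite /= -cone_unit_b //; exact: chart_pos h.
Qed.

End Main.

Theorem theorem5p5 (R : realType) (n : nat) (n_ge2 : (2 <= n)%N)
  (M : manifold R n) (M_connected : connected [set: M])
  (a : bilfield M) (b : covfield M)
  (a_metric : is_riemannian_metric a)
  (b_form : is_one_form b) (b_neq0 : nowhere_vanishing b)
  (F_einstein : einstein (kropina a b) \/ weak_einstein (kropina a b)) :
  (forall V : vfield M,
     conformal (kropina a b) V -> homothetic (kropina a b) V) /\
  (forall K : R, constant_flag_curvature (kropina a b) K ->
   exists (a' : bilfield M) (b' : covfield M),
     [/\ is_riemannian_metric a', is_one_form b', unit_length a' b' &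
         eq_conic (kropina a' b') (kropina a b)] /\
     [/\ exists mu : R, has_constant_sectional_curvature a' mu,
         is_killing_form a' b' &
         forall (U : set M) (V : vfield M) (c : M -> R),
           open U -> connected U ->
           conformal_with U (kropina a b) V c <->
           [/\ is_vector_field U V,
               exists k : R, forall p, U p -> c p = k,
               lift_scales U V (alpha2 a') (fun p => 4 * c p) &
               lift_scales U V (beta b') (fun p => 2 * c p)]]).
Proof.
have einst : weak_einstein (kropina a b).
  by case: F_einstein => // /einstein_weak.
split=> [V|K flag]; first exact: conformal_homothetic.
exists (unit_a a b), (unit_b a b); split; split.
- exact: unit_a_metric.
- exact: unit_b_form.
- exact: unit_ab_length.
- exact: unit_ab_kropina.
- by exists (4 * K); exact: unit_a_constant_curvature.
- exact: unit_b_killing.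
- by move=> U V c oU cU; exact: conformal_iff.
Qed.
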